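(* Assume that the control system $\Sigma$ is of regularity class $C^2$ and let $Q\subset M$ be a compact all-time controlled invariant set such that: (A1) $Q$ is uniformly hyperbolic; (A2) $L(Q)$ is an isolated invariant set of the control flow; (A3) the fiber map $u\mapsto Q(u)$ is lower semicontinuous. Then $$\sup_{P\in\mathcal M(\theta)}\pi_{\mathrm{top}}(\varphi^Q,P;-\log J^+\varphi)=\sup_{u\in\mathcal U}\lim_{\varepsilon\downarrow0}\limsup_{\tau\to\infty}\frac1\tau\log\pi_{-\log J^+\varphi}(u,\tau,\varepsilon),$$ where $\mathcal M(\theta)$ is the set of all $\theta$-invariant Borel probability measures on $\mathcal U$.
   Context: Setting: $\Sigma: x_{t+1}=f(x_t,u_t)$ with $f:M\times U\to M$, where $M$ is a connected smooth finite-dimensional manifold with a fixed Riemannian metric (norm $|\cdot|$, distance $d$), $U$ is a compact connected metric space, each $f_u:=f(\cdot,u)$ is a $C^1$-diffeomorphism of $M$ whose derivative depends jointly continuously on $(u,x)$, and $f$ and $(x,u)\mapsto f_u^{-1}(x)$ are continuous. Regularity class $C^2$: each $f_u$ is a $C^2$-diffeomorphism with first and second derivatives depending continuously on $(u,x)$. $\mathcal U:=U^{\mathbb Z}$ has the product topology, $(\theta u)_t:=u_{t+1}$. The transition map is $\varphi(t,x,u)=\varphi_{t,u}(x)=f_{u_{t-1}}\circ\cdots\circ f_{u_0}(x)$ for $t>0$, $\varphi(0,x,u)=x$, $\varphi(t,x,u)=f_{u_t}^{-1}\circ\cdots\circ f_{u_{-1}}^{-1}(x)$ for $t<0$. The control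 flow is $\Phi_t(u,x)=(\theta^tu,\varphi(t,x,u))$ on $\mathcal U\times M$. $Q\subset M$ is all-time controlled invariant if for every $x\in Q$ there is $u\in\mathcal U$ with $\varphi(\mathbb Z,x,u)\subset Q$. $L(Q):=\{(u,x):\varphi(\mathbb Z,x,u)\subset Q\}$, $Q(u):=\{x:(u,x)\in L(Q)\}$ (under (A1), (A2) all $Q(u)$, $u\in\mathcal U$, are nonempty). A closed invariant set $A$ of $\Phi$ is isolated invariant if it has a neighborhood $N$ such that $\Phi_t(z)\in N$ for all $t\in\mathbb Z$ implies $z\in A$. Uniformly hyperbolic: $Q$ is nonempty, compact, all-time controlled invariant, and for every $(u,x)\in L(Q)$ there is a splitting $T_xM=E^-(u,x)\oplus E^+(u,x)$ with (i) $\mathrm D\varphi_{t,u}(x)E^\pm(u,x)=E^\pm(\Phi_t(u,x))$ for all $t\in\mathbb Z$; (ii) there are $c\ge1$, $\lambda\in(0,1)$ with $|\mathrm D\varphi_{t,u}(x)v|\le c\lambda^t|v|$ for $v\in E^-(u,x)$ and $|\mathrm D\varphi_{-t,u}(x)v|\le c\lambda^t|v|$ for $v\in E^+(u,x)$, for all $(u,x)\in L(Q)$, $t\ge0$; (iii) $\dim E^\pm(u,x)$ are constant on $L(Q)$. $J^+\varphi$ denotes the function $(u,x)\mapsto J^+\varphi_{1,u}(x):=|\det\mathrm D\varphi_{1,u}(x)_{|E^+(u,x)}:E^+(u,x)\to E^+(\Phi_1(u,x))|$ on $L(Q)$. A set $F$ is $(u,\tau,\varepsilon)$-separated if for all distinct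 $x,y\in F$ one has $d(\varphi(t,x,u),\varphi(t,y,u))>\varepsilon$ for some $0\le t<\tau$. For continuous $\alpha:L(Q)\to\mathbb R$, $\pi_\alpha(u,\tau,\varepsilon):=\sup\{\sum_{x\in F}2^{\sum_{s=0}^{\tau-1}\alpha(\Phi_s(u,x))}: F\subset Q(u)\ (u,\tau,\varepsilon)\text{-separated}\}$ (measurable in $u$ with respect to the completed Borel $\sigma$-algebra). For $P\in\mathcal M(\theta)$, $\pi_{\mathrm{top}}(\varphi^Q,P;\alpha):=\lim_{\varepsilon\downarrow0}\limsup_{\tau\to\infty}\frac1\tau\int\log\pi_\alpha(u,\tau,\varepsilon)\,\mathrm dP(u)$ (topological pressure of the bundle random dynamical system $\varphi^Q$ given by $\Phi_{|L(Q)}$ and $P$). Logarithms are to base 2. *)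

(* Defs.v *)
From HB Require Import structures.
From mathcomp Require Import all_boot all_order all_algebra.
From mathcomp Require Import all_classical all_reals all_analysis.
Set Implicit Arguments.
Unset Strict Implicit.
Unset Printing Implicit Defensive.
Import Order.TTheory GRing.Theory Num.Theory.
Import numFieldNormedType.Exports.
Local Open Scope classical_set_scope.
Local Open Scope ring_scope.

(* Pointedness is required by the library's measurable spaces; it only says
   that the metric space is nonempty. *)
#[short(type="pmetricType")]
HB.structure Definition PointedMetric (K : numDomainType) :=
  { M of Pointed M & Metric K M }.

(* [Ck k D f] and [Ck_param k D F] are meant for open D. In finite dimension
   (the only case used) [Ck k D f] is the usual class C^k on D; [Ck_param k D F]
   says that each F t is C^k and that all derivatives in x of order at most k
   are jointly continuous in (t, x). *)
Fixpoint Ck (R : realType) (E V : normedModType R) (k : nat) (D : set E)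
    (f : E -> V) : Prop :=
  {within D, continuous f} /\
  (if k is k'.+1 then
     (forall x, D x -> differentiable f x) /\
     (forall v : E, Ck k' D (fun x => 'd f x v))
   else True).

Fixpoint Ck_param (R : realType) (T : topologicalType) (E V : normedModType R)
    (k : nat) (D : set (T * E)) (F : T -> E -> V) : Prop :=
  {within D, continuous (fun p : T * E => F p.1 p.2)} /\
  (if k is k'.+1 then
     (forall p, D p -> differentiable (F p.1) p.2) /\
     (forall v : E, Ck_param k' D (fun t x => 'd (F t) x v))
   else True).

(* Vectors are row vectors: the bilinear form with Gram matrix G. *)
Definition bilin (R : realType) (n : nat) (G : 'M[R]_n) (v w : 'rV[R]_n) : R :=
  (v *m G *m w^T) ord0 ord0.

(* A smooth n-manifold with a smooth Riemannian metric, given by an atlas.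
   [chart_coord i] and [chart_param i] are total functions, but only their
   values on [chart_dom i] and [chart_coord i @` chart_dom i] matter.
   [chart_gram i y] is the Gram matrix of the metric, in the chart i, at the
   point with coordinates y. *)
Record riemannian_manifold (R : realType) (n : nat) (M : topologicalType) :=
  RiemannianManifold {
  chart : Type ;
  chart_dom : chart -> set M ;
  chart_coord : chart -> M -> 'rV[R]_n ;
  chart_param : chart -> 'rV[R]_n -> M ;
  chart_gram : chart -> 'rV[R]_n -> 'M[R]_n ;
  chart_at : M -> chart ;
  manifold_hausdorff : hausdorff_space M ;
  manifold_second_countable : @second_countable M ;
  dom_open : forall i, open (chart_dom i) ;
  im_open : forall i, open (chart_coord i @` chart_dom i) ;
  coordK : forall i x, chart_dom i x -> chart_param i (chart_coord i x) = x ;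
  coord_continuous :
    forall i, {within chart_dom i, continuous (chart_coord i)} ;
  param_continuous :
    forall i, {within chart_coord i @` chart_dom i,
                 continuous (chart_param i)} ;
  chart_atP : forall x, chart_dom (chart_at x) x ;
  transition_smooth : forall i j k,
    Ck k (chart_coord i @` (chart_dom i `&` chart_dom j))
         (chart_coord j \o chart_param i) ;
  gram_smooth : forall i k, Ck k (chart_coord i @` chart_dom i) (chart_gram i) ;
  gram_sym : forall i x, chart_dom i x ->
    (chart_gram i (chart_coord i x))^T = chart_gram i (chart_coord i x) ;
  gram_pos : forall i x v, chart_dom i x -> v != 0 ->
    0 < bilin (chart_gram i (chart_coord i x)) v v ;
  gram_transition : forall i j x v w, chart_dom i x -> chart_dom j x ->
    bilin (chart_gram i (chart_coord i x)) v w =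
    bilin (chart_gram j (chart_coord j x))
      ('d (chart_coord j \o chart_param i) (chart_coord i x) v)
      ('d (chart_coord j \o chart_param i) (chart_coord i x) w)
}.

Section Tangent.
Context (R : realType) (n : nat) (M : topologicalType).
Variable X : riemannian_manifold R n M.

(* T_xM is identified with R^n by means of the chart [chart_at X x]. *)
Definition tangent_inner (x : M) (v w : 'rV[R]_n) : R :=
  bilin (chart_gram (chart_at X x) (chart_coord (chart_at X x) x)) v w.

Definition tangent_norm (x : M) (v : 'rV[R]_n) : R :=
  Num.sqrt (tangent_inner x v v).

Definition tangent_map (h : M -> M) (x : M) : {linear 'rV[R]_n -> 'rV[R]_n} :=
  'd (chart_coord (chart_at X (h x)) \o h \o chart_param (chart_at X x))
     (chart_coord (chart_at X x) x).

Definition orthonormal_basis (x : M) (E : {vspace 'rV[R]_n}) (k : nat)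
    (b : k.-tuple 'rV[R]_n) : Prop :=
  basis_of E b /\
  forall i j : 'I_k, tangent_inner x (tnth b i) (tnth b j) = (i == j)%:R.

(* |det A| for a linear map A : E -> F between subspaces of T_xM and T_yM of
   the same dimension: the absolute value of the determinant of the matrix of A
   in orthonormal bases of E and F, which does not depend on these bases. *)
Definition abs_det (x y : M) (A : 'rV[R]_n -> 'rV[R]_n)
    (E F : {vspace 'rV[R]_n}) : R :=
  xget 0 [set r | exists (k : nat) (b c : k.-tuple 'rV[R]_n),
    [/\ orthonormal_basis x E b, orthonormal_basis y F c &
        r = `|\det (\matrix_(i < k, j < k)
                      tangent_inner y (A (tnth b i)) (tnth c j))|]].

Definition C1_curve (g : R -> M) : Prop :=
  continuous g /\
  forall i : chart X, Ck 1 (g @^-1` chart_dom i) (chart_coord i \o g).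

Definition velocity (g : R -> M) (t : R) : 'rV[R]_n :=
  derive1 (chart_coord (chart_at X (g t)) \o g) t.

Definition curve_length (g : R -> M) : R :=
  \int[lebesgue_measure]_(t in `[0, 1]) tangent_norm (g t) (velocity g t).

(* [path_length x y l]: l is the length of a piecewise C^1 curve from x to y,
   i.e., of a finite concatenation of restrictions to [0,1] of C^1 curves. *)
Inductive path_length : M -> M -> R -> Prop :=
| path_length_nil x : path_length x x 0
| path_length_cons g y l : C1_curve g -> path_length (g 1) y l ->
    path_length (g 0) y (curve_length g + l).

Definition rdist (x y : M) : R := inf [set l | path_length x y l].

End Tangent.

Section ControlSystem.
Context (R : realType) (n : nat) (M : topologicalType).
Variable X : riemannian_manifold R n M.
Variable U : pmetricType R.

(* In all pairs of charts: each f_u is a C^k-diffeomorphism with inverse [fi u],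
   and the derivatives of f_u of order at most k are continuous in (u, x). *)
Definition regularity_class (k : nat) (f : M -> U -> M) (fi : U -> M -> M) :
    Prop :=
  (forall i j : chart X, Ck_param k
     [set p : U * 'rV[R]_n |
        (chart_coord i @` chart_dom i) p.2 /\
        chart_dom j (f (chart_param i p.2) p.1)]
     (fun u y => chart_coord j (f (chart_param i y) u))) /\
  (forall (u : U) (i j : chart X), Ck k
     [set y | (chart_coord i @` chart_dom i) y /\
              chart_dom j (fi u (chart_param i y))]
     (chart_coord j \o fi u \o chart_param i)).

Record control_system := ControlSystem {
  rhs : M -> U -> M ;
  rhs_inv : U -> M -> M ;
  rhsK : forall u, cancel (rhs^~ u) (rhs_inv u) ;
  rhs_invK : forall u, cancel (rhs_inv u) (rhs^~ u) ;
  rhs_continuous : continuous (fun p : M * U => rhs p.1 p.2) ;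
  rhs_inv_continuous : continuous (fun p : M * U => rhs_inv p.2 p.1) ;
  rhs_C1 : regularity_class 1 rhs rhs_inv
}.

Definition system_class (k : nat) (S : control_system) : Prop :=
  regularity_class k (rhs S) (rhs_inv S).

Definition controls : Type := {ptws int -> U}.

HB.instance Definition _ := Topological.copy controls {ptws int -> U}.
HB.instance Definition _ := isPointed.Build controls (fun=> point).

Definition shift_by (t : int) (u : controls) : controls :=
  fun s : int => u (s + t).

Variable S : control_system.

Fixpoint forward (t : nat) (x : M) (u : controls) : M :=
  if t is t'.+1 then rhs S (forward t' x u) (u t'%:Z) else x.

Fixpoint backward (t : nat) (x : M) (u : controls) : M :=
  if t is t'.+1 then rhs_inv S (u (- t%:Z)) (backward t' x u) else x.

Definition transition (t : int) (x : M) (u : controls) : M :=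
  match t with
  | Posz k => forward k x u
  | Negz k => backward k.+1 x u
  end.

Definition control_flow (t : int) (z : controls * M) : controls * M :=
  (shift_by t z.1, transition t z.2 z.1).

Definition transition_deriv (t : int) (z : controls * M) :
    {linear 'rV[R]_n -> 'rV[R]_n} :=
  tangent_map X (fun x => transition t x z.1) z.2.

Variable Q : set M.

Definition all_time_controlled_invariant : Prop :=
  forall x, Q x -> exists u : controls, forall t : int, Q (transition t x u).

Definition all_time_lift : set (controls * M) :=
  [set z | forall t : int, Q (transition t z.2 z.1)].

Definition fiber (u : controls) : set M := [set x | all_time_lift (u, x)].

Definition fiber_lower_semicontinuous : Prop :=
  forall (u : controls) (x : M), fiber u x -> forall V : set M, nbhs x V ->
    \forall u' \near u, (fiber u' `&` V) !=set0.

Variables Em Ep : controls * M -> {vspace 'rV[R]_n}.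

(* [Em z] and [Ep z] are E^-(z) and E^+(z), for z in L(Q). *)
Definition hyperbolic_splitting : Prop :=
  [/\ forall z, all_time_lift z ->
        (Em z + Ep z)%VS = fullv /\ (Em z :&: Ep z)%VS = 0%VS,
      forall z (t : int), all_time_lift z ->
        (linfun (transition_deriv t z) @: Em z)%VS = Em (control_flow t z) /\
        (linfun (transition_deriv t z) @: Ep z)%VS = Ep (control_flow t z),
      exists c lambda : R, [/\ 1 <= c, 0 < lambda < 1 &
        forall z (t : nat), all_time_lift z ->
          (forall v, v \in Em z ->
             tangent_norm X (transition t%:Z z.2 z.1)
               (transition_deriv t%:Z z v)
             <= c * lambda ^+ t * tangent_norm X z.2 v) /\
          (forall v, v \in Ep z ->
             tangent_norm X (transition (- t%:Z) z.2 z.1)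
               (transition_deriv (- t%:Z) z v)
             <= c * lambda ^+ t * tangent_norm X z.2 v)] &
      exists dm dp : nat, forall z, all_time_lift z ->
        \dim (Em z) = dm /\ \dim (Ep z) = dp].

Definition uniformly_hyperbolic : Prop :=
  [/\ Q !=set0, compact Q, all_time_controlled_invariant &
      hyperbolic_splitting].

Definition unstable_jacobian (z : controls * M) : R :=
  abs_det X z.2 (transition 1 z.2 z.1) (transition_deriv 1 z)
    (Ep z) (Ep (control_flow 1 z)).

Definition orbit_separated (u : controls) (tau : nat) (eps : R) (F : set M) :
    Prop :=
  forall x y, F x -> F y -> x <> y ->
    exists2 t : nat, (t < tau)%N &
      eps < rdist X (transition t%:Z x u) (transition t%:Z y u).

Definition pressure_sum (alpha : controls * M -> R) (u : controls) (tau : nat)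
    (eps : R) : \bar R :=
  ereal_sup [set \esum_(x in F)
                   (2 `^ (\sum_(s < tau) alpha (control_flow s%:Z (u, x))))%:E
            | F in [set F | F `<=` fiber u /\ orbit_separated u tau eps F]].

End ControlSystem.

Definition isolated_invariant (Z : topologicalType) (Phi : int -> Z -> Z)
    (A : set Z) : Prop :=
  [/\ closed A, forall t, Phi t @` A = A &
      exists2 N : set Z, set_nbhs A N &
        forall z, (forall t, N (Phi t z)) -> A z].

Definition log2 (R : realType) (r : R) : R := ln r / ln 2.

Definition elog2 (R : realType) (x : \bar R) : \bar R :=
  (lne x * ((ln 2)^-1)%:E)%E.

Definition borel_controls (R : realType) (U : pmetricType R) :=
  g_sigma_algebraType (@open (controls U)).

Section Pressure.
Context (R : realType) (n : nat) (M : topologicalType).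
Variables (X : riemannian_manifold R n M) (U : pmetricType R).
Variables (S : control_system X U) (Q : set M).
Variable alpha : controls U * M -> R.
Local Open Scope ereal_scope.

Definition shift_invariant_measures :
    set (probability (borel_controls U) R) :=
  [set P | forall A : set (borel_controls U), measurable A ->
             P (@shift_by R U 1 @^-1` A) = P A].

(* The library integral is defined for every function, from the measurable
   simple functions below its positive and negative parts; on functions that are
   only measurable for the P-completion of the Borel sigma-algebra it agrees
   with the integral against the completed measure. *)
Definition top_pressure (P : probability (borel_controls U) R) : \bar R :=
  lim (limn_esup (fun tau : nat =>
         (tau%:R^-1)%:E *
         \int[P]_u elog2 (pressure_sum S Q alpha u tau eps))
       @[eps --> (0 : R)^'+]).

Definition fiber_pressure (u : controls U) : \bar R :=
  lim (limn_esup (fun tau : nat =>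
         (tau%:R^-1)%:E * elog2 (pressure_sum S Q alpha u tau eps))
       @[eps --> (0 : R)^'+]).

End Pressure.

(* Main.v *)
(** The only dynamical input is that L(Q) is compact, that no fiber Q(u) is empty
    and that alpha = - log J^+ is continuous on L(Q); the rest is a variational
    principle for subadditive cocycles over the shift.

    Cover L(Q) by finitely many small sets. The least weight of a family of
    itineraries of length t covering Q(u), in base-2 logarithm, is a subadditive
    upper semicontinuous cocycle g_t(u) which is sandwiched, up to eta * t,
    between the logarithms of the pressure sums at two scales eps and delta. If
    g_t(u)/t stays above s along a subsequence, an ultrafilter limit of the
    empirical means along the orbit of u is a finitely additive shift-invariant
    mean; regularizing it gives an invariant Borel probability P with
    mean C <= P C for closed C, so that P integrates upper semicontinuous
    functions to at least their mean, and the integral of g_t is at least s * t.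
    Conversely, if g_t(u)/t drops below s for every u at some time t, then by
    compactness g_t <= s * t + C uniformly. As g is measurable, no measurability
    of the pressure sums is needed.

    Continuity of J^+ reduces to that of E^+: along an ultrafilter converging to
    z, orthonormal bases of E^+(z') converge together with their whole backward
    orbits, the limits contract in backward time, hence lie in E^+(z), and they
    form a basis of it since the dimension is constant. *)

From HB Require Import structures.
Require Import Defs.
From mathcomp Require Import all_boot all_order all_algebra.
From mathcomp Require Import all_classical all_reals all_analysis.
From mathcomp Require Import measurable_realfun finmap ring lra zify.
Set Implicit Arguments.
Unset Strict Implicit.
Unset Printing Implicit Defensive.
Import Order.TTheory GRing.Theory Num.Theory.
Import numFieldNormedType.Exports.
Local Open Scope classical_set_scope.
Local Open Scope ring_scope.

(** * Invariant measures from finitely additive means *)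

(** An ultrafilter limit of empirical means is only finitely additive; making it countably additive
    may lose mass on open sets, never on closed ones. So the cocycle has to be upper semicontinuous,
    and this is why itineraries are counted by covers: logarithms of separated sums are not visibly
    subadditive or semicontinuous in u, whereas covering a fiber is an open condition on u. The
    price, two different scales, is harmless because both pressures are suprema over all scales. The
    distance is an infimum of lengths of piecewise C^1 curves and enters through two local facts.
    Nearby points have small distance, by a segment in a chart; points at small distance are nearby,
    by a bump function that is Lipschitz along curves. The second fact covers both orders of the
    arguments, since a maximal separated set provides one order or the other. Tangent vectors are
    stored in the chart attached to their base point, a choice that jumps from point to point;
    limits are therefore taken in the single chart at the limit point. *)

(* The algebra of clopen sets: since clopen sets are compact, every finitely
   additive content on it is countably additive. *)
Definition cantor_clopen : Type := cantor_space.

HB.instance Definition _ := Pointed.on cantor_clopen.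

Fact cantor_clopen_display : measure_display. Proof. exact: default_measure_display. Qed.

Lemma cantor_clopen0 : clopen (set0 : set cantor_space).
Proof. exact: clopen0. Qed.

Lemma cantor_clopenU : setU_closed (@clopen cantor_space).
Proof. exact: clopenU. Qed.

Lemma cantor_clopenC : setC_closed (@clopen cantor_space).
Proof. by move=> A; exact: clopenC. Qed.

HB.instance Definition _ := @isAlgebraOfSets.Build cantor_clopen_display
  cantor_clopen (@clopen cantor_space)
  cantor_clopen0 cantor_clopenU cantor_clopenC.

Definition cantor_borel := g_sigma_algebraType (@measurable _ cantor_clopen).

Definition cylinder (s : seq bool) : set cantor_space :=
  [set w | forall i, (i < size s)%N -> w i = nth false s i].

Lemma clopen_cylinder s : clopen (cylinder s).
Proof.
have -> : cylinder s =
    \big[setI/setT]_(i < size s) ((fun w : cantor_space => w i) @^-1` [set nth false s i]).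
  rewrite -(bigcap_mkord _ (fun i => (fun w : cantor_space => w i) @^-1` [set nth false s i])).
  by apply/seteqP; split=> w /= h i /=; exact: h.
elim/big_ind : _ => [|A B|i _]; [exact: clopenT|exact: clopenI|].
apply: preimage_clopen; first by split; [exact: discrete_open|exact: discrete_closed].
exact: (@proj_continuous nat (fun=> bool) i).
Qed.

Lemma nbhs_cylinder (w : cantor_space) (O : set cantor_space) : nbhs w O ->
  exists2 s, cylinder s w & cylinder s `<=` O.
Proof.
move=> wO; apply: contrapT => h.
have {}h n : exists v : cantor_space, (forall i, (i < n)%N -> v i = w i) /\ ~ O v.
  apply: contrapT => h'; apply: h; exists (mkseq w n).
    by move=> i; rewrite size_mkseq => ?; rewrite nth_mkseq.
  move=> v hv; apply: contrapT => Ov; apply: h'; exists v; split => // i ni.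
  by rewrite hv ?size_mkseq// nth_mkseq.
pose v n := projT1 (cid (h n)).
have vE n i : (i < n)%N -> v n i = w i.
  by move=> ni; have [+ _] := projT2 (cid (h n)); exact.
have nv n : ~ O (v n) by have [] := projT2 (cid (h n)).
suff : v @ \oo --> w by move=> /(_ _ wO)[N _ /(_ N (leqnn N))]; exact: nv.
apply/cvg_sup => i U [V] [[A oA <-] Awi] AU.
apply: (filterS AU); exists i.+1 => // n /= /vE vn.
by move: Awi; rewrite /= vn.
Qed.

(** Cylinders are indexed by finite words, hence countable through [pickle]. A number that codes no
    cylinder inside [O] contributes the empty set. *)
Lemma open_cantorP (O : set cantor_space) : open O ->
  exists2 F : (set cantor_space)^nat, (forall n, clopen (F n)) &
    O = \bigcup_n F n.
Proof.
move=> oO; exists (fun n => if @choice.unpickle (seq bool) n is Some s then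
    if `[< cylinder s `<=` O >] then cylinder s else set0 else set0).
  move=> n; case: choice.unpickle => [s|]; last exact: clopen0.
  by case: ifP => _; [exact: clopen_cylinder|exact: clopen0].
apply/seteqP; split=> [w Ow|w [n _]].
  have [s ws sO] := nbhs_cylinder (open_nbhs_nbhs (conj oO Ow)).
  by exists (choice.pickle s) => //; rewrite choice.pickleK asboolT.
by case: choice.unpickle => // s; case: asboolP => // h /h.
Qed.

Section CantorMean.
Variables (R : realType) (mean : set cantor_space -> R).
Hypothesis mean_ge0 : forall A, 0 <= mean A.
Hypothesis meanU : forall A B, A `&` B = set0 ->
  mean (A `|` B) = mean A + mean B.
Hypothesis meanT : mean setT = 1.

Let mean0 : mean set0 = 0.
Proof. by apply: (@addrI _ (mean set0)); rewrite -meanU ?setI0// setU0 addr0. Qed.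

Let le_mean A B : A `<=` B -> mean A <= mean B.
Proof. by move=> AB; rewrite -(setDUK AB) meanU ?lerDl// setDIK. Qed.

Let mean_bigcup (F : (set cantor_space)^nat) n :
  mean (\big[setU/set0]_(i < n) F i) <= \sum_(i < n) mean (F i).
Proof.
elim: n => [|n ih]; first by rewrite !big_ord0 mean0.
rewrite !big_ord_recr/=; apply: le_trans (lerD ih (lexx _)).
set A := \big[_/_]_(_ < _) _.
have -> : A `|` F n = A `|` (F n `\` A).
  apply/seteqP; split=> w [Aw|Fw]; [by left| |by left|by right; case: Fw].
  by have [Aw|Aw] := pselect (A w); [left|right].
by rewrite meanU ?lerD2l ?le_mean// setDIK.
Qed.

Definition cantor_content (A : set cantor_clopen) : \bar R := (mean A)%:E.

Let cantor_content_additive : measure_function.semi_additive cantor_content.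
Proof.
move=> F n _ tF _; rewrite /cantor_content sumEFin; congr EFin.
elim: n => [|n ih]; first by rewrite !big_ord0 mean0.
rewrite !big_ord_recr/= meanU ?ih//.
rewrite -bigcup_mkord -subset0 => w [[i /= ni Fi] Fn].
by have := tF i n I I (ex_intro _ w (conj Fi Fn)) => ni'; rewrite ni' ltnn in ni.
Qed.

HB.instance Definition _ := isContent.Build _ _ R cantor_content
  (fun A => mean_ge0 A) cantor_content_additive.

Let cantor_content_sigma_subadditive :
  measure_function.measurable_subset_sigma_subadditive cantor_content.
Proof.
move=> A F mF [_ cA] AF.
have : compact A by apply: subclosed_compact cantor_space_compact _.
rewrite compact_cover => /(_ nat setT F)[|w /AF [i _ Fi]|D _ AD].
- by move=> i _; case: (mF i).
- by exists i.
- pose N := (\max_(i <- D) i).+1.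
  have AN : A `<=` \big[setU/set0]_(i < N) F i.
    move=> w /AD [i /= Di Fi]; rewrite -bigcup_mkord; exists i => //=.
    by rewrite ltnS /N; apply: leq_bigmax_seq.
  apply: (@le_trans _ _ (\sum_(i < N) cantor_content (F i))).
    by rewrite /cantor_content sumEFin lee_fin (le_trans (le_mean AN) (mean_bigcup F N)).
  rewrite -(big_mkord xpredT (fun i => cantor_content (F i))).
  apply: nneseries_lim_ge => i _ _; exact: mean_ge0.
Qed.

HB.instance Definition _ := Content_SigmaSubAdditive_isMeasure.Build _ _ _
  cantor_content cantor_content_sigma_subadditive.

Definition cantor_measure : {measure set cantor_borel -> \bar R} :=
  measure_extension cantor_content.

Lemma cantor_measureE A : clopen A -> cantor_measure A = (mean A)%:E.
Proof. by move=> cA; rewrite /cantor_measure/= /measure_extension measurable_mu_extE. Qed.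
End CantorMean.

Lemma cvg_ptws (I : choiceType) (V : topologicalType)
    (F : set_system {ptws I -> V}) (f : {ptws I -> V}) : Filter F ->
  (forall i, (fun g : I -> V => g i) @ F --> f i) -> F --> f.
Proof.
move=> FF h; apply/cvg_sup => i W [V' [[A oA <-] Afi] VW].
by apply: (filterS VW); apply: (h i A); apply: open_nbhs_nbhs.
Qed.

Lemma continuous_ptws (T : topologicalType) (I : choiceType)
    (V : topologicalType) (F : T -> {ptws I -> V}) :
  (forall i, continuous (fun x => F x i)) -> continuous F.
Proof. by move=> h x; apply: cvg_ptws => i; exact: h. Qed.

Lemma eval_continuous (I : choiceType) (V : topologicalType) (i : I) :
  continuous (fun f : {ptws I -> V} => f i).
Proof. exact: (@proj_continuous I (fun=> V) i). Qed.

Lemma shift_continuous (R : realType) (U : pmetricType R) t :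
  continuous (@shift_by R U t).
Proof. by apply: continuous_ptws => s; exact: eval_continuous. Qed.

(** * Binary coding of controls *)

Section Coding.
Variables (R : realType) (U : pmetricType R).
Variables (dec : cantor_space -> U) (enc : U -> cantor_space).
Hypotheses (decC : continuous dec) (encK : cancel enc dec).

(** One Boolean sequence interleaves the codes of all coordinates: position [pickle (j, k)] holds
    bit k of coordinate j. [decode] is continuous, while [encode] comes from an arbitrary section
    and serves only to pull sets back under a mean that is defined on all sets. *)
Definition decode (w : cantor_space) : controls U :=
  fun j => dec (fun k => w (choice.pickle (j, k))).

Definition encode (u : controls U) : cantor_space := fun n =>
  if @choice.unpickle (int * nat)%type n is Some jk then enc (u jk.1) jk.2
  else false.

Definition shift_code (w : cantor_space) : cantor_space := fun n =>
  if @choice.unpickle (int * nat)%type n is Some jk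
  then w (choice.pickle (jk.1 + 1, jk.2)) else false.

Lemma encodeK : cancel encode decode.
Proof.
move=> u; apply/funext => j; rewrite /decode /encode -[RHS]encK; congr dec.
by apply/funext => k; rewrite choice.pickleK.
Qed.

Lemma decode_shift w : decode (shift_code w) = shift_by 1 (decode w).
Proof.
apply/funext => j; rewrite /decode /shift_code /shift_by; congr dec.
by apply/funext => k; rewrite choice.pickleK.
Qed.

Lemma encode_shift u : encode (shift_by 1 u) = shift_code (encode u).
Proof.
apply/funext => n; rewrite /encode /shift_code /shift_by.
by case: choice.unpickle => // -[j k]; rewrite choice.pickleK.
Qed.

Lemma decode_continuous : continuous decode.
Proof.
apply: continuous_ptws => j w; apply: (@continuous_comp _ _ _ _ dec).
  by apply: continuous_ptws => k; exact: eval_continuous.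
exact: decC.
Qed.

Lemma shift_code_continuous : continuous shift_code.
Proof.
apply: continuous_ptws => n; rewrite /shift_code.
by case: choice.unpickle => [jk|]; [exact: eval_continuous|move=> w; exact: cvg_cst].
Qed.

End Coding.

Lemma open_cantor_measurable (O : set cantor_borel) :
  open (O : set cantor_space) -> measurable O.
Proof.
move=> /open_cantorP[F cF ->]; apply: bigcupT_measurable => n.
by apply: sub_sigma_algebra; exact: cF.
Qed.

Lemma continuous_cantor_measurable (R : realType) (U : pmetricType R)
    (f : cantor_space -> controls U) : continuous f ->
  measurable_fun [set: cantor_borel] (f : cantor_borel -> borel_controls U).
Proof.
move=> cf; apply: (@measurability _ _ cantor_borel (borel_controls U) setT f
  (@open (controls U))); first by [].
move=> _ [V oV <-].
by rewrite setTI; apply: open_cantor_measurable; exact: open_comp.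
Qed.

Lemma continuous_cantor_measurable_self (f : cantor_space -> cantor_space) :
  continuous f ->
  measurable_fun [set: cantor_borel] (f : cantor_borel -> cantor_borel).
Proof.
move=> cf; apply: (@measurability _ _ cantor_borel cantor_borel setT f
  (@measurable _ cantor_clopen)); first by [].
move=> _ [V cV <-].
by rewrite setTI; apply: sub_sigma_algebra; exact: preimage_clopen.
Qed.

Lemma probability_of_measure d (T : measurableType d) (R : realType)
    (mu : {measure set T -> \bar R}) : mu setT = 1%E ->
  exists P : probability T R, forall A, P A = mu A.
Proof.
move=> muT; exists (mnormalize mu (\d_point : probability T R)) => A.
by rewrite /= /mnormalize muT onee_eq0/= invr1 mule1.
Qed.

Lemma exists_pushforward d d' (T1 : measurableType d) (T2 : measurableType d')
    (R : realType) (mu : {measure set T1 -> \bar R}) (f : T1 -> T2) :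
  measurable_fun setT f ->
  exists nu : {measure set T2 -> \bar R}, forall A, nu A = mu (f @^-1` A).
Proof.
move=> mf; have mpre (A : set T2) : measurable A -> measurable (f @^-1` A).
  by move=> mA; rewrite -[X in measurable X]setTI; exact: mf.
pose nu A := mu (f @^-1` A).
have nu0 : nu set0 = 0%E by rewrite /nu preimage_set0 measure0.
have nu_sigma : semi_sigma_additive nu.
  move=> F mF tF mUF; rewrite /nu preimage_bigcup.
  apply: measure_semi_sigma_additive.
  - by move=> n; exact: mpre.
  - apply/trivIsetP => /= i j _ _ ij; rewrite -preimage_setI.
    by move/trivIsetP : tF => /(_ _ _ _ _ ij) ->//; rewrite preimage_set0.
  - by rewrite -preimage_bigcup; exact: mpre.
pose h := isMeasure.Build _ T2 R nu nu0 (fun A => measure_ge0 mu _) nu_sigma.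
by exists (HB.pack_for {measure set T2 -> \bar R} nu h).
Qed.

(* The mean is transported to the Cantor space by a section of a continuous
   surjection onto U^Z that intertwines the shifts. *)
Theorem exists_invariant_measure (R : realType) (U : pmetricType R)
    (mean : set (controls U) -> R) : compact [set: U] ->
  (forall A, 0 <= mean A) ->
  (forall A B, A `&` B = set0 -> mean (A `|` B) = mean A + mean B) ->
  mean setT = 1 ->
  (forall A, mean (@shift_by R U 1 @^-1` A) = mean A) ->
  exists2 P : probability (borel_controls U) R, shift_invariant_measures P &
    forall C, closed C -> ((mean C)%:E <= P C)%E.
Proof.
move=> cU m0 mU mT mS.
have [dec decC] := @cantor_surj R U cU (@metric_hausdorff _ _).
have [enc encK] : exists enc : U -> cantor_space, cancel enc dec.
  have h a : exists w, dec w = a by have [w _ <-] := @surj _ _ _ _ dec a I; exists w.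
  by exists (fun a => projT1 (cid (h a))) => a; exact: (projT2 (cid (h a))).
pose cmean (A : set cantor_space) := mean (encode enc @^-1` A).
have cm0 A : 0 <= cmean A by exact: m0.
have cmU A B : A `&` B = set0 -> cmean (A `|` B) = cmean A + cmean B.
  by move=> AB0; rewrite /cmean preimage_setU mU// -preimage_setI AB0 preimage_set0.
have cmT : cmean setT = 1 by rewrite /cmean preimage_setT.
pose nu := cantor_measure cm0 cmU.
have nuE A : clopen A -> nu A = (cmean A)%:E by exact: cantor_measureE.
have le_cmean A B : A `<=` B -> cmean A <= cmean B.
  by move=> AB; rewrite -(setDUK AB) cmU ?lerDl// setDIK.
(* An open set is an increasing union of clopen sets, on which [nu] equals the mean. [nu] is
   continuous along this union but the mean is merely monotone, hence an inequality. *)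
have nu_open O : open O -> (nu O <= (cmean O)%:E)%E.
  move=> oO; have [F cF OE] := open_cantorP oO.
  pose G n := \big[setU/set0]_(i < n) F i.
  have cG n : clopen (G n).
    by rewrite /G; elim/big_ind : _ => [|A B|i _]; [exact: clopen0|exact: clopenU|].
  have -> : O = \bigcup_n G n.
    rewrite OE; apply/seteqP; split=> [w [n _ Fw]|w [n _]].
      by exists n.+1 => //; rewrite /G -bigcup_mkord; exists n => /=.
    by rewrite /G -bigcup_mkord => -[i _ Fw]; exists i.
  have GO n : G n `<=` O.
    by rewrite /G -bigcup_mkord OE => w [i _ Fw]; exists i.
  have mG n : measurable (G n : set cantor_borel).
    by apply: sub_sigma_algebra; exact: cG.
  have /(cvg_lim (@ereal_hausdorff R)) <- : nu \o G @ \oo --> nu (\bigcup_n G n).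
    apply: nondecreasing_cvg_mu => //; first exact: bigcupT_measurable.
    by move=> m n mn; apply/subsetPset; exact: subset_bigsetU.
  apply: lime_le.
    apply: ereal_nondecreasing_is_cvgn => m n mn; rewrite /= !nuE// lee_fin.
    by apply: le_cmean; exact: subset_bigsetU.
  apply: nearW => n; rewrite /= nuE// lee_fin; apply: le_cmean.
  by move=> w Gw; exists n.
have dC := decode_continuous decC; have mD := continuous_cantor_measurable dC.
have [nuD nuDE] := exists_pushforward nu mD.
have nuDT : nuD setT = 1%E.
  by rewrite nuDE preimage_setT nuE ?cmT//; exact: clopenT.
have [P PE] := probability_of_measure nuDT.
have {nuD nuDE nuDT}PE A : P A = nu (decode dec @^-1` A) by rewrite PE.
exists P.
  move=> A mA; rewrite !PE.
  have -> : decode dec @^-1` (shift_by 1 @^-1` A) =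
            shift_code @^-1` (decode dec @^-1` A).
    by apply/seteqP; split=> w /=; rewrite -decode_shift.
  have mS1 := continuous_cantor_measurable_self shift_code_continuous.
  have [nuS nuSE] := exists_pushforward nu mS1; rewrite -nuSE.
  (* Clopen sets are stable under intersection and generate the Borel sets, so invariance is tested
     on them, where it is the invariance of the mean. *)
  apply: (@measure_unique _ R cantor_borel (@measurable _ cantor_clopen) (fun=> setT)
    _ _ _ _ nuS nu) => //.
  - by move=> ? ?; exact: clopenI.
  - by apply/seteqP; split=> // w _; exists 0%N.
  - move=> B cB; rewrite nuSE !nuE//; last exact: (preimage_clopen cB shift_code_continuous).
    congr (_%:E); rewrite /cmean -[RHS]mS; congr mean.
    by apply/seteqP; split=> u /=; rewrite encode_shift.
  - by move=> _; rewrite nuSE preimage_setT nuE ?ltry//; exact: clopenT.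
  - by rewrite -[X in measurable X]setTI; exact: mD.
move=> C cC.
have mC : measurable (C : set (borel_controls U)).
  by rewrite -[C]setCK; apply: measurableC; apply: sub_sigma_algebra; exact: closed_openC.
(* The bound on open sets is applied to the complement. Its preimage under [decode] has the same
   mean because [encode] is a section of [decode]. *)
have : (P (~` C) <= (mean (~` C))%:E)%E.
  rewrite PE; have -> : mean (~` C) = cmean (decode dec @^-1` (~` C)).
    by congr mean; apply/seteqP; split=> u /=; rewrite encodeK.
  by apply: nu_open; apply: open_comp => [? _|]; [exact: dC|exact: closed_openC].
have := mU C (~` C) (setICr C); rewrite setUCr mT => h.
rewrite probability_setC// -(fineK (fin_num_measure P C mC)) -EFinB !lee_fin.
lra.
Qed.

(** Both parts of the integral are suprema over simple functions lying below, so monotonicity holds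
    for arbitrary functions, in particular for logarithms of pressure sums. *)
Lemma le_integral_total d (T : measurableType d) (R : realType)
    (mu : {measure set T -> \bar R}) (f g : T -> \bar R) :
  (forall x, (f x <= g x)%E) -> (\int[mu]_x f x <= \int[mu]_x g x)%E.
Proof.
move=> fg; rewrite /integral !patch_setT; apply: leeD.
  apply: ereal_sup_le => _ [h hf <-]; exists h => // x.
  apply: le_trans (hf x) _; rewrite !funeposE.
  by rewrite ge_max !le_max fg lexx orbT.
rewrite leeN2; apply: ereal_sup_le => _ [h hf <-]; exists h => // x.
apply: le_trans (hf x) _; rewrite !funenegE.
by rewrite ge_max !le_max leeN2 fg lexx orbT.
Qed.

Lemma integral_le_cst d (T : measurableType d) (R : realType)
    (P : probability T R) (f : T -> \bar R) (c : R) :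
  (forall x, (f x <= c%:E)%E) -> (\int[P]_x f x <= c%:E)%E.
Proof.
move=> fc; apply: le_trans (le_integral_total P fc) _.
by rewrite integral_cst//= probability_setT mule1.
Qed.

(* [layers N] is the layer-cake sum of the value h with N steps of height w. *)
Section Layers.
Variables (R : realFieldType) (w h : R).
Hypotheses (w0 : 0 < w) (h0 : 0 <= h).

Definition layers N : R := \sum_(j < N) w * (j.+1%:R * w <= h)%R%:R.

Lemma layersE N : N%:R * w <= h -> layers N = N%:R * w.
Proof.
move=> Nh; rewrite /layers (eq_bigr (fun=> w)) => [|j _].
  by rewrite sumr_const card_ord mulr_natl.
rewrite (_ : (_ <= _) = true) ?mulr1//; apply: le_trans Nh.
by rewrite ler_pM2r// ler_nat.
Qed.

Lemma layers_le N : layers N <= h.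
Proof.
elim: N => [|N ih]; first by rewrite /layers big_ord0.
have [Nh|Nh] := leP (N.+1%:R * w) h; first by rewrite layersE.
by rewrite /layers big_ord_recr/= (lt_geF Nh) mulr0 addr0.
Qed.

Lemma le_layersD N : h <= N%:R * w -> h <= layers N + w.
Proof.
elim: N => [|N ih].
  by rewrite mul0r => ?; rewrite /layers big_ord0 add0r (le_trans _ (ltW w0)).
move=> hN; have [Nh|Nh] := leP (N%:R * w) h.
  apply: le_trans hN _; rewrite -natr1 mulrDl mul1r lerD2r.
  rewrite -(layersE Nh) /layers big_ord_recr/= lerDl.
  by rewrite mulr_ge0// ltW.
apply: le_trans (ih (ltW Nh)) _; rewrite lerD2r /layers [leRHS]big_ord_recr/= lerDl.
by rewrite mulr_ge0// ltW.
Qed.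

End Layers.

(** Compactness gives a cluster point; an ultrafilter decides the preimage of each of its
    neighborhoods, and the complement cannot win. *)
Lemma ultra_cvg_compact (T : Type) (V : topologicalType) (G : set_system T)
    (f : T -> V) (A : set V) : UltraFilter G -> compact A -> G (f @^-1` A) ->
  exists2 p, A p & f @ G --> p.
Proof.
move=> UG cA GA; have [p [Ap clp]] := cA (f @ G) _ GA.
exists p => // W pW; have [//|GW] := in_ultra_setVsetC (f @^-1` W) UG.
have [q []] := clp (~` W) W GW pW; by [].
Qed.

Lemma cvg_ultra_bounded (R : realType) (T : Type) (G : set_system T)
    (f : T -> R) (B : R) : UltraFilter G -> (forall x, `|f x| <= B) ->
  cvg (f @ G).
Proof.
move=> UG fB; have [|p _ fp] := ultra_cvg_compact UG (@segment_compact R (- B) B) (f := f).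
  by apply: filterE => x /=; rewrite in_itv/= -ler_norml.
by apply/cvg_ex; exists p.
Qed.

(** * Ultrafilter limits of empirical means *)

Section BanachMean.
Variables (R : realType) (T : Type) (G : set_system T) (UG : UltraFilter G).
Variables (X : Type) (tau : T -> nat) (orb : nat -> X).
Hypothesis tau_gt0 : forall k, (0 < tau k)%N.

Definition average (f : X -> R) (k : T) : R :=
  (tau k)%:R^-1 * \sum_(i < tau k) f (orb i).

(** A Banach limit along [orb]. The limit exists for every bounded function, measurable or not; the
    bounds assumed in the lemmas below are what gives [lim] its meaning. *)
Definition banach_mean (f : X -> R) : R := lim (average f @ G).

Let tau_gt0R k : 0 < (tau k)%:R^-1 :> R.
Proof. by rewrite invr_gt0 ltr0n. Qed.

Lemma le_average f g k : (forall x, f x <= g x) -> average f k <= average g k.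
Proof.
by move=> fg; rewrite /average ler_wpM2l ?(ltW (tau_gt0R k))// ler_sum.
Qed.

Lemma average_cst c k : average (fun=> c) k = c.
Proof.
rewrite /average sumr_const card_ord -[c *+ _]mulr_natl mulrA mulVf ?mul1r//.
by rewrite pnatr_eq0 -lt0n.
Qed.

Lemma averageD f g k : average (f \+ g) k = average f k + average g k.
Proof. by rewrite /average big_split/= mulrDr. Qed.

Lemma averageZ c f k : average (fun x => c * f x) k = c * average f k.
Proof. by rewrite /average -mulr_sumr mulrCA. Qed.

Lemma average_bounded f B k : (forall x, `|f x| <= B) -> `|average f k| <= B.
Proof.
move=> fB; rewrite ler_norml -{1}(average_cst (- B) k) -{2}(average_cst B k).
by rewrite !le_average// => x; have := fB x; rewrite ler_norml => /andP[].
Qed.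

Lemma is_cvg_average f B : (forall x, `|f x| <= B) -> cvg (average f @ G).
Proof. by move=> fB; apply: (@cvg_ultra_bounded _ _ _ _ B) => k; exact: average_bounded. Qed.

Lemma le_banach_mean f g B C : (forall x, `|f x| <= B) -> (forall x, `|g x| <= C) ->
  (forall x, f x <= g x) -> banach_mean f <= banach_mean g.
Proof.
move=> /is_cvg_average cf /is_cvg_average cg fg.
rewrite -subr_ge0 /banach_mean -limB//; apply: limr_ge; first exact: is_cvgB.
by apply: filterE => k; rewrite subr_ge0; exact: le_average.
Qed.

Lemma banach_mean_cst c : banach_mean (fun=> c) = c.
Proof.
rewrite /banach_mean (_ : average _ = fun=> c) ?lim_cst//.
by apply/funext => k; exact: average_cst.
Qed.

Lemma banach_meanD f g B C : (forall x, `|f x| <= B) -> (forall x, `|g x| <= C) ->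
  banach_mean (f \+ g) = banach_mean f + banach_mean g.
Proof.
move=> /is_cvg_average cf /is_cvg_average cg; rewrite /banach_mean -limD//.
by congr (lim (_ @ G)); apply/funext => k; exact: averageD.
Qed.

Lemma banach_meanZ c f B : (forall x, `|f x| <= B) ->
  banach_mean (fun x => c * f x) = c * banach_mean f.
Proof.
move=> fB; rewrite /banach_mean.
rewrite (_ : average _ = (fun k => c * average f k)).
  by apply: cvg_lim => //; apply: cvgMl_tmp; exact: is_cvg_average fB.
by apply/funext => k; exact: averageZ.
Qed.

End BanachMean.

(** * Comparison of mean and integral *)

Section UpperSemicontinuousIntegral.
Variables (R : realType) (U : pmetricType R).
Variables (T : Type) (G : set_system T) (UG : UltraFilter G).
Variables (tau : T -> nat) (orb : nat -> controls U).
Hypothesis tau_gt0 : forall k, (0 < tau k)%N.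
Variable P : probability (borel_controls U) R.
Hypothesis P_closed : forall C, closed C ->
  ((banach_mean G tau orb (\1_C : _ -> R))%:E <= P C)%E.
Local Notation mean := (banach_mean G tau orb).

Lemma usc_measurable (h : controls U -> R) :
  (forall c, open [set u | h u < c]) ->
  measurable_fun [set: borel_controls U] (h : borel_controls U -> R).
Proof.
move=> oh; apply: (measurability _ (RGenInftyO.measurableE R)) => _ [_ [c ->] <-].
rewrite setTI; apply: sub_sigma_algebra => /=.
have -> : h @^-1` `]-oo, c[ = [set u | h u < c]; last exact: oh.
by apply/seteqP; split=> u /=; rewrite in_itv.
Qed.

Let closed_ge (h : controls U -> R) c :
  (forall c, open [set u | h u < c]) -> closed [set u | c <= h u].
Proof.
move=> oh; rewrite [X in closed X](_ : _ = ~` [set u | h u < c]).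
  exact: open_closedC.
by apply/seteqP; split=> u /=; [move=> cu; rewrite ltNge cu|move/negP; rewrite -leNgt].
Qed.

Let indic_bounded (A : set (controls U)) x : `|\1_A x : R| <= 1.
Proof. by rewrite indicE; case: (_ \in _); rewrite ?normr1// normr0. Qed.

Let mean_layers (h : controls U -> R) w N : 0 < w ->
  mean (fun u => layers w (h u) N) =
  \sum_(j < N) w * mean (\1_[set u | j.+1%:R * w <= h u]).
Proof.
move=> w0; elim: N => [|N ih].
  rewrite big_ord0 (_ : (fun _ => _) = fun=> 0); first exact: banach_mean_cst.
  by apply/funext => u; rewrite /layers big_ord0.
rewrite big_ord_recr/= -ih -(@banach_meanZ _ _ _ UG _ _ _ tau_gt0 _ _ 1)//.
rewrite -(@banach_meanD _ _ _ UG _ _ _ tau_gt0 _ _ (\sum_(j < N) w) w).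
- congr banach_mean; apply/funext => u.
  by rewrite /layers big_ord_recr/= indicE mem_setE.
- move=> u; rewrite ger0_norm ?sumr_ge0// => [|j _]; last by rewrite mulr_ge0// ltW.
  by apply: ler_sum => j _; rewrite ler_piMr ?(ltW w0)// lern1 leq_b1.
- by move=> u; rewrite normrM gtr0_norm// ler_piMr// ltW.
Qed.

Let integral_layers (h : controls U -> R) w N : 0 < w ->
  (forall c, open [set u | h u < c]) ->
  (\int[P]_u (layers w (h u) N)%:E =
  \sum_(j < N) w%:E * P [set u | (j.+1%:R * w <= h u)%R])%E.
Proof.
move=> w0 oh.
have mge c : measurable ([set u | c <= h u] : set (borel_controls U)).
  rewrite -[X in measurable X]setCK; apply: measurableC; apply: sub_sigma_algebra.
  exact/closed_openC/closed_ge.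
transitivity (\int[P]_u (\sum_(j < N) w%:E * (\1_[set u | (j.+1%:R * w <= h u)%R] u)%:E))%E.
  apply: eq_integral => u _; rewrite /layers -sumEFin; apply: eq_bigr => j _.
  by rewrite EFinM indicE mem_setE.
rewrite ge0_integral_sum//=.
- apply: eq_bigr => j _; rewrite ge0_integralZl_EFin ?(ltW w0)//.
    by rewrite integral_indic// setIT.
  by apply/measurable_EFinP; exact: measurable_indic.
- move=> j; apply/measurable_EFinP; apply: measurable_funM; first exact: measurable_cst.
  exact: measurable_indic.
- by move=> j u _; rewrite -EFinM lee_fin mulr_ge0// ltW.
Qed.

(** Layer cake: [N] layers of height [e] reach above [B], so their sum differs from [h] by at most
    [e]. Each layer is the indicator of a closed superlevel set, where [P] dominates the mean. *)
Let ge0_banach_mean_le (h : controls U -> R) B : (forall u, 0 <= h u <= B) ->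
  (forall c, open [set u | h u < c]) -> ((mean h)%:E <= \int[P]_u (h u)%:E)%E.
Proof.
move=> hB oh; apply/lee_addgt0Pr => e e0.
have B0 : 0 <= B by have /andP[/le_trans] := hB point; apply.
pose N := (Num.truncn (B / e)).+1.
have hN u : h u <= N%:R * e.
  have /andP[_ /le_trans] := hB u; apply.
  by rewrite -ler_pdivrMr// ltW// truncnS_gt.
apply: (@le_trans _ _ ((mean (fun u => layers e (h u) N))%:E + e%:E)%E).
  rewrite -EFinD lee_fin -[X in _ + X](@banach_mean_cst _ _ G _ _ tau orb tau_gt0).
  rewrite -(@banach_meanD _ _ _ UG _ _ _ tau_gt0 _ _ B e).
  - apply: (@le_banach_mean _ _ _ UG _ _ _ tau_gt0 _ _ B (B + e)).
    + by move=> u; have /andP[h0 h1] := hB u; rewrite ger0_norm.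
    + move=> u; have /andP[h0 h1] := hB u.
      rewrite ger0_norm; first by rewrite lerD2r (le_trans _ h1)// layers_le.
      by rewrite addr_ge0 ?(ltW e0)// sumr_ge0// => j _; rewrite mulr_ge0// ltW.
    + by move=> u; have /andP[h0 h1] := hB u; exact: le_layersD.
  - move=> u; have /andP[h0 h1] := hB u.
    rewrite ger0_norm; first by rewrite (le_trans _ h1)// layers_le.
    by rewrite sumr_ge0// => j _; rewrite mulr_ge0// ltW.
  - by move=> u; rewrite gtr0_norm.
rewrite leeD2r//.
apply: (@le_trans _ _ (\int[P]_u (layers e (h u) N)%:E)%E).
  rewrite mean_layers// integral_layers// -sumEFin; apply: lee_sum => j _.
  by rewrite EFinM lee_pmul2l ?ltry ?lte_fin// P_closed//; exact: closed_ge.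
apply: le_integral_total => u; rewrite lee_fin; have /andP[h0 h1] := hB u.
exact: layers_le.
Qed.

Lemma banach_mean_le_integral (h : controls U -> R) B :
  (forall u, `|h u| <= B) -> (forall c, open [set u | h u < c]) ->
  ((mean h)%:E <= \int[P]_u (h u)%:E)%E.
Proof.
move=> hB oh; have mh := usc_measurable oh.
have int_h : P.-integrable setT (EFin \o h).
  apply: measurable_bounded_integrable => //.
    by rewrite [ltLHS]probability_setT ltry.
  by exists B; split; [exact: num_real|move=> x Bx u _; exact: le_trans (hB u) (ltW Bx)].
have int_B : P.-integrable setT (EFin \o (fun=> - B)).
  exact: finite_measure_integrable_cst.
(* Adding [B] makes the function nonnegative and raises both sides by [B], since the mean and [P]
   have total mass 1. *)
have /(_ (B + B)) := @ge0_banach_mean_le (fun u => h u + B).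
have -> : (\int[P]_u (h u + B)%:E = \int[P]_u (h u)%:E + B%:E)%E.
  transitivity (\int[P]_u ((h u)%:E - (- B)%:E))%E.
    by apply: eq_integral => u _; rewrite -EFinB opprK.
  rewrite integralB_EFin//; congr (_ + _)%E.
  by rewrite integral_cst//= probability_setT mule1 EFinN oppeK.
have -> : mean (fun u => h u + B) = mean h + B.
  rewrite -[X in _ + X](@banach_mean_cst _ _ G _ _ tau orb tau_gt0).
  by rewrite -(@banach_meanD _ _ _ UG _ _ _ tau_gt0 _ _ B `|B|).
rewrite EFinD leeD2rE// => -> //.
  by move=> u; have := hB u; rewrite ler_norml => /andP[]; lra.
move=> c; rewrite [X in open X](_ : _ = [set u | h u < c - B])//.
by apply/seteqP; split=> u /=; rewrite ltrBrDr.
Qed.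

End UpperSemicontinuousIntegral.

Lemma shift_byD (R : realType) (U : pmetricType R) s t (u : controls U) :
  shift_by t (shift_by s u) = shift_by (s + t) u.
Proof. by apply/funext => k; rewrite /shift_by -addrA (addrC t). Qed.

Lemma controls_compact (R : realType) (U : pmetricType R) :
  compact [set: U] -> compact [set: controls U].
Proof.
move=> cU; have := @tychonoff int (fun=> U) (fun=> setT) (fun=> cU).
by congr (@compact _); apply/seteqP; split.
Qed.

(** * Subadditive cocycles over the shift *)

Section Subadditive.
Variables (R : realType) (U : pmetricType R).
Hypothesis cU : compact [set: U].
Variables (g : nat -> controls U -> R) (B : R).
Hypothesis gD : forall s t u, g (s + t) u <= g s u + g t (shift_by s%:Z u).
Hypothesis g_bounded : forall t u, `|g t u| <= B * t%:R.
Hypothesis g_usc : forall t c, open [set u | g t u < c].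

Let B0 : 0 <= B.
Proof. by have := le_trans (normr_ge0 _) (g_bounded 1 point); rewrite mulr1. Qed.

Let g_le t u : g t u <= B * t%:R.
Proof. exact: le_trans (ler_norm _) (g_bounded t u). Qed.

Let g_ge t u : - (B * t%:R) <= g t u.
Proof. by have := g_bounded t u; rewrite ler_norml => /andP[]. Qed.

(** By compactness finitely many times [t] suffice, so every orbit is cut greedily into pieces of
    bounded length that grow slower than rate [S]. Only a last piece of length at most [T] escapes,
    and the constant pays for it. *)
Lemma subadditive_uniform S :
  (forall u, exists2 t, (0 < t)%N & g t u < t%:R * S) ->
  exists C, forall t u, g t u <= t%:R * S + C.
Proof.
move=> h; have := controls_compact cU; rewrite compact_cover.
move=> /(_ nat [set t | (0 < t)%N] (fun t => [set u | g t u < t%:R * S])) [].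
- by move=> t _; exact: g_usc.
- by move=> u _; have [t t0 gt] := h u; exists t.
- move=> D D0 covD; pose T := \max_(t <- D) t.
  exists ((B + `|S|) * T%:R) => t; have [n] := ubnP t; elim: n t => // n ih t tn u.
  have [tT|Tt] := leqP t T.
    rewrite -lerBlDl; apply: le_trans (_ : (B + `|S|) * t%:R <= _).
      rewrite mulrDl lerD ?g_le// -mulrN mulrC ler_wpM2r//.
      by rewrite (le_trans (ler_norm _))// normrN.
    by rewrite ler_wpM2l ?addr_ge0// ler_nat.
  have [s /= sD gs] := covD u I; have s0 : (0 < s)%N by have := D0 _ sD => /set_mem.
  have st : (s <= t)%N by apply: leq_trans (ltnW Tt); apply: leq_bigmax_seq.
  rewrite -(subnKC st); apply: le_trans (gD _ _ _) _.
  have ts : (t - s < n)%N by lia.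
  have := ih _ ts (shift_by s%:Z u); rewrite natrD mulrDl.
  by move: gs; lra.
Qed.

(** The [m] possible offsets cut the orbit into blocks of length [m] in [m] ways, and together these
    use each starting point once. The error collects three terms of size [B * m ^ 2]: the initial
    offsets, the final remainders, and the last [m] starting points of the sum. *)
Lemma subadditive_orbit m t u : (0 < m)%N ->
  m%:R * g t u - 3 * B * m%:R ^+ 2 <= \sum_(i < t) g m (shift_by i%:Z u).
Proof.
move=> m0; have mB : 0 <= B * m%:R by rewrite mulr_ge0.
have sum_ge (a b : nat) : (b <= m)%N -> - (B * m%:R ^+ 2) <=
    \sum_(i < b) g m (shift_by (a + i)%N%:Z u).
  move=> bm; apply: (@le_trans _ _ (\sum_(i < b) - (B * m%:R))).
    rewrite sumr_const card_ord -[_ *+ b]mulr_natl mulrN lerN2.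
    by rewrite expr2 mulrA [leRHS]mulrC ler_wpM2r// ler_nat.
  by apply: ler_sum => i _; exact: g_ge.
have [tm|mt] := leqP t m.
  have := sum_ge 0%N t tm; under eq_bigr do rewrite add0n.
  move=> /(le_trans _); apply.
  have : m%:R * g t u <= m%:R * (B * m%:R).
    rewrite ler_wpM2l// (le_trans (g_le t u))// ler_wpM2l// ler_nat//.
  have : 0 <= B * m%:R ^+ 2 by rewrite mulr_ge0// exprn_ge0.
  have -> : m%:R * (B * m%:R) = B * m%:R ^+ 2 :> R by rewrite expr2 mulrCA.
  by lra.
(* [h i] is the cocycle over the part of the orbit that remains after time [i]. *)
pose h i := g (t - i) (shift_by i%:Z u).
have h_step i : (i + m <= t)%N -> h i <= g m (shift_by i%:Z u) + h (i + m)%N.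
  move=> imt; rewrite /h; have -> : (t - i = m + (t - (i + m)))%N by lia.
  by apply: le_trans (gD _ _ _) _; rewrite shift_byD PoszD.
(* A window of [m] consecutive values of [h] slides by one: [h n] leaves, [h (n + m)] enters, and
   [h_step] pays the difference with one value of [g m]. *)
have tele n : (n + m <= t)%N -> \sum_(j < m) h j <=
    \sum_(i < n) g m (shift_by i%:Z u) + \sum_(j < m) h (n + j)%N.
  elim: n => [|n ih] nm; first by rewrite big_ord0 add0r.
  apply: le_trans (ih (ltnW nm)) _; rewrite big_ord_recr/= -addrA lerD2l.
  rewrite -(prednK m0) big_ord_recl [in leRHS]big_ord_recr/= addn0.
  rewrite (eq_bigr (fun i : 'I_m.-1 => h (n.+1 + i)%N)); last first.
    by move=> i _; rewrite /bump/= addnA addn1.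
  rewrite [leRHS]addrA [leRHS]addrAC lerD2r.
  have -> : (n.+1 + m.-1 = n + m)%N by rewrite addSnnS prednK.
  by rewrite prednK//; apply: h_step; exact: ltnW.
have mt' := ltnW mt; have := tele (t - m)%N; rewrite subnK// => /(_ (leqnn _)).
have : \sum_(j < m) (g t u - B * m%:R) <= \sum_(j < m) h j.
  apply: ler_sum => j _; rewrite lerBlDr.
  have jt : (j <= t)%N by rewrite (leq_trans _ mt')// ltnW.
  rewrite -{1}(subnKC jt); apply: le_trans (gD _ _ _) _; rewrite addrC lerD2l.
  by apply: le_trans (g_le _ _) _; rewrite ler_wpM2l// ler_nat ltnW.
have : \sum_(j < m) h (t - m + j)%N <= \sum_(j < m) (B * m%:R).
  apply: ler_sum => j _; apply: le_trans (g_le _ _) _.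
  by rewrite ler_wpM2l// ler_nat; lia.
have := sum_ge (t - m)%N m (leqnn _).
have -> : \sum_(i < t) g m (shift_by i%:Z u) =
    \sum_(i < t - m) g m (shift_by i%:Z u) +
    \sum_(i < m) g m (shift_by (t - m + i)%N%:Z u).
  have split_sum (F : nat -> R) a b :
      \sum_(i < a + b) F i = \sum_(i < a) F i + \sum_(i < b) F (a + i)%N.
    by rewrite big_split_ord.
  have := split_sum (fun i => g m (shift_by i%:Z u)) (t - m)%N m.
  by rewrite subnK.
rewrite !sumr_const card_ord -[(g t u - _) *+ m]mulr_natl -[(B * _) *+ m]mulr_natl.
rewrite mulrBr [m%:R * (B * m%:R)]mulrCA -expr2; lra.
Qed.

Lemma subadditive_measure S u :
  (forall N, exists2 t, (N <= t)%N & t%:R * S <= g t u) ->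
  exists2 P : probability (borel_controls U) R, shift_invariant_measures P &
    forall m, (0 < m)%N -> ((m%:R * S)%:E <= \int[P]_u (g m u)%:E)%E.
Proof.
move=> h.
(* Asking for a time at least k + 1 makes every [tau k] positive and lets [tau] tend to infinity
   along [G]. *)
pose tau k := (projT1 (cid2 (h k.+1))).
have tauk k : (k < tau k)%N by rewrite /tau; case: cid2.
have gtau k : (tau k)%:R * S <= g (tau k) u by rewrite /tau; case: cid2.
have tau_gt0 k : (0 < tau k)%N by apply: leq_ltn_trans (tauk k).
have [G [UG ooG]] := @ultraFilterLemma _ \oo _.
pose orb (i : nat) := shift_by i%:Z u.
pose mean (A : set (controls U)) : R := banach_mean G tau orb (\1_A).
have indic_bounded (A : set (controls U)) x : `|\1_A x : R| <= 1.
  by rewrite indicE; case: (_ \in _); rewrite ?normr1// normr0.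
have small (C : R) e : 0 < e -> \forall k \near G, C / (tau k)%:R <= e.
  move=> e0; apply: ooG; exists (Num.truncn (C / e)).+1 => // k /= kN.
  have t0 : 0 < (tau k)%:R :> R by rewrite ltr0n.
  rewrite ler_pdivrMr// mulrC -ler_pdivrMr//.
  apply: (le_trans (ltW (truncnS_gt (C / e)))).
  by rewrite ler_nat (leq_trans kN)// ltnW.
have [|A B' AB0|||P Pinv Pge] := @exists_invariant_measure R U mean cU.
- move=> A; rewrite -(@banach_mean_cst _ _ G _ _ tau orb tau_gt0 0).
  apply: (@le_banach_mean _ _ _ UG _ _ _ tau_gt0 _ _ 0 1) => //.
    by move=> x; rewrite normr0.
- rewrite /mean -(@banach_meanD _ _ _ UG _ _ _ tau_gt0 _ _ 1 1)//.
  congr banach_mean; apply/funext => x; rewrite /= !indicE.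
  rewrite in_setU; case: (boolP (x \in A)) => xA; case: (boolP (x \in B')) => xB;
    rewrite ?addr0 ?add0r//=.
  have : (A `&` B') x by split; exact: set_mem.
  by rewrite AB0.
- rewrite /mean (_ : \1_setT = fun=> 1) ?banach_mean_cst//.
  by apply/funext => x; rewrite indicT.
(* The two sums telescope: shifting the set changes an average only through its end terms, hence by
   at most [2 / tau k]. *)
- move=> A; apply/eqP; rewrite -subr_eq0; apply/eqP.
  set A' := _ @^-1` A; pose ind (C : set (controls U)) : controls U -> R := \1_C.
  have -> : mean A' - mean A =
      lim ((average tau orb (ind A') - average tau orb (ind A)) @ G).
    by rewrite limB//; apply: is_cvg_average.
  apply: cvg_lim => //; apply/cvgr0Pnorm_le => e e0.
  near=> k.
  have -> : (average tau orb (ind A') - average tau orb (ind A)) k =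
      (tau k)%:R^-1 * (ind A (orb (tau k)) - ind A (orb 0%N)).
    transitivity (average tau orb (ind A') k - average tau orb (ind A) k); first by [].
    rewrite /average -mulrBr -sumrB; congr (_ * _).
    rewrite -(telescope_sumr (fun i => ind A (orb i)))// big_mkord.
    apply: eq_bigr => i _; congr (_ - _); rewrite /ind !indicE; congr ((nat_of_bool _)%:R).
    have -> : orb i.+1 = shift_by 1 (orb i) by rewrite /orb shift_byD -addn1 PoszD.
    by apply/idP/idP => /set_mem ?; exact/mem_set.
  have : 2 / (tau k)%:R <= e by near: k; exact: small.
  apply: le_trans; rewrite normrM mulrC ler_pM//.
    by apply: le_trans (ler_normB _ _) _; rewrite -[2]/(1 + 1) lerD.
  by rewrite ger0_norm ?invr_ge0.
exists P => // m m0.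
apply: le_trans (banach_mean_le_integral UG tau_gt0 Pge (g_bounded m) (g_usc m)).
(* By [subadditive_orbit], the average of [g m] is at least [m * S] minus [3 * B * m ^ 2 / tau k],
   an error that vanishes along [G]. *)
rewrite lee_fin; apply/ler_addgt0Pr => e e0; rewrite -lerBlDr.
apply: limr_ge; first by apply: is_cvg_average.
near=> k.
have : 3 * B * m%:R ^+ 2 / (tau k)%:R <= e by near: k; exact: small.
have tk0 : 0 < (tau k)%:R :> R by rewrite ltr0n.
rewrite ler_pdivrMr// /average ler_pdivlMl//.
have := subadditive_orbit (tau k) u m0.
have : m%:R * ((tau k)%:R * S) <= m%:R * g (tau k) u by rewrite ler_wpM2l.
move: (\sum_(i < _) _) => x; lra.
Unshelve. all: by end_near. Qed.

End Subadditive.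

Lemma sum_imset_le (R : numDomainType) (A B : finType) (f : A -> B)
    (D : {set A}) (F : B -> R) : (forall b, 0 <= F b) ->
  \sum_(b in f @: D) F b <= \sum_(a in D) F (f a).
Proof.
move=> F0; rewrite (partition_big_imset f)/=; apply: ler_sum => b /imsetP[a aD ->].
rewrite (bigD1 a)/= ?aD ?eqxx// lerDl.
by apply: sumr_ge0 => i _; exact: F0.
Qed.

Lemma continuous_pair (A B C : topologicalType) (f : A -> B) (g : A -> C) :
  continuous f -> continuous g -> continuous (fun x => (f x, g x)).
Proof. by move=> cf cg x; apply: cvg_pair; [exact: cf|exact: cg]. Qed.

Lemma continuous_compT (A B C : topologicalType) (f : A -> B) (g : B -> C) :
  continuous f -> continuous g -> continuous (g \o f).
Proof. by move=> cf cg x; apply: continuous_comp; [exact: cf|exact: cg]. Qed.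

Lemma continuous_fst (A B : topologicalType) : continuous (@fst A B).
Proof. by move=> x; exact: cvg_fst. Qed.

Lemma continuous_snd (A B : topologicalType) : continuous (@snd A B).
Proof. by move=> x; exact: cvg_snd. Qed.

Section Flow.
Variables (R : realType) (n : nat) (M : topologicalType).
Variables (X : riemannian_manifold R n M) (U : pmetricType R).
Variable S : control_system X U.

Lemma forwardD s t x u :
  forward S (s + t) x u = forward S t (forward S s x u) (shift_by s%:Z u).
Proof.
by elim: t => [|t ih]; rewrite ?addn0// addnS/= ih /shift_by PoszD addrC.
Qed.

Lemma control_flow_natD s t z :
  control_flow S t%:Z (control_flow S s%:Z z) = control_flow S (s + t)%N%:Z z.
Proof. by rewrite /control_flow/= shift_byD forwardD PoszD. Qed.

Lemma forward_continuous t :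
  continuous (fun z : controls U * M => forward S t z.2 z.1).
Proof.
elim: t => [|t ih]; first exact: continuous_snd.
have h : continuous (fun z : controls U * M => (forward S t z.2 z.1, z.1 t%:Z)).
  apply: continuous_pair; first exact: ih.
  exact: (continuous_compT (@continuous_fst _ _) (@eval_continuous int U t%:Z)).
exact: (continuous_compT h (@rhs_continuous _ _ _ _ _ S)).
Qed.

Lemma control_flow_nat_continuous t : continuous (control_flow S t%:Z).
Proof.
apply: continuous_pair; last exact: forward_continuous.
exact: (continuous_compT (@continuous_fst _ _) (@shift_continuous _ U t%:Z)).
Qed.

End Flow.

Lemma controls_hausdorff (R : realType) (U : pmetricType R) : hausdorff_space (controls U).
Proof. by apply: (@hausdorff_product int (fun=> U)) => _; exact: metric_hausdorff. Qed.

(** * Pressure by covers *)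

Section Covers.
Variables (R : realType) (n : nat) (M : topologicalType).
Variables (X : riemannian_manifold R n M) (U : pmetricType R).
Variables (S : control_system X U) (Q : set M).
Hypothesis cU : compact [set: U].
Hypothesis cQ : compact Q.
Local Notation L := (all_time_lift S Q).
Local Notation Phi t := (control_flow S t%:Z).
Hypothesis L_closed : closed L.
Hypothesis L_invariant : forall (t : nat) z, L z -> L (Phi t z).
Hypothesis fiber_neq0 : forall u, fiber S Q u !=set0.

Lemma lift_compact : compact L.
Proof.
apply: (subclosed_compact L_closed (compact_setX (controls_compact cU) cQ)).
by move=> z Lz; split => //; exact: (Lz 0).
Qed.

Variables (I : finType) (i0 : I) (V : I -> set (controls U * M)) (a : I -> R).
Hypothesis V_open : forall i, open (V i).
Hypothesis L_covered : forall z, L z -> exists i, V i z.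

Definition follows t (w : t.-tuple I) (z : controls U * M) :=
  forall k, (k < t)%N -> V (nth i0 w k) (Phi k z).

Definition covers t u (W : {set t.-tuple I}) :=
  forall x, fiber S Q u x -> exists2 w, w \in W & follows w (u, x).

Definition string_weight t (w : t.-tuple I) : R :=
  2 `^ (\sum_(k < t) a (nth i0 w k)).

Definition cover_weight t (W : {set t.-tuple I}) : R :=
  \sum_(w in W) string_weight w.

(** Sets of words form a finite type, so the minimum is attained. The set of all words covers every
    fiber and is therefore a legitimate default. *)
Definition min_cover t u : {set t.-tuple I} :=
  [arg min_(W < [set: t.-tuple I]%SET | `[< covers u W >]) cover_weight W]%O.

Definition cover_pressure t u : R := log2 (cover_weight (min_cover t u)).

Lemma string_weight_gt0 t (w : t.-tuple I) : 0 < string_weight w.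
Proof. by rewrite powR_gt0. Qed.

Lemma exists_string t (f : nat -> I) :
  exists w : t.-tuple I, forall k, (k < t)%N -> nth i0 w k = f k.
Proof.
exists (tcast (size_mkseq f t) (in_tuple (mkseq f t))) => k kt.
by rewrite val_tcast nth_mkseq.
Qed.

Lemma coversT t u : covers u [set: t.-tuple I]%SET.
Proof.
move=> x ux; have h k : exists i, V i (Phi k (u, x)).
  by apply: L_covered; exact: L_invariant.
have [w wE] := exists_string t (fun k => projT1 (cid (h k))).
exists w; first by rewrite inE.
by move=> k kt; rewrite wE//; exact: (projT2 (cid (h k))).
Qed.

Lemma min_coverP t u : covers u (min_cover t u).
Proof.
rewrite /min_cover; case: arg_minP; first by apply/asboolP; exact: coversT.
by move=> W /asboolP.
Qed.

Lemma min_cover_le t u (W : {set t.-tuple I}) : covers u W ->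
  cover_weight (min_cover t u) <= cover_weight W.
Proof.
move=> uW; rewrite /min_cover; case: arg_minP; first by apply/asboolP; exact: coversT.
by move=> W' _; apply; apply/asboolP.
Qed.

Lemma cover_weight_gt0 t u (W : {set t.-tuple I}) : covers u W -> 0 < cover_weight W.
Proof.
move=> uW; have [x ux] := fiber_neq0 u; have [w wW _] := uW x ux.
rewrite /cover_weight (bigD1 w)//=; apply: ltr_wpDr (string_weight_gt0 w).
by apply: sumr_ge0 => v _; exact/ltW/string_weight_gt0.
Qed.

Lemma ln2_gt0 : 0 < ln (2 : R).
Proof. by rewrite ln_gt0// ltr1n. Qed.

Lemma log2_powR (c : R) : log2 (2 `^ c) = c.
Proof. by rewrite /log2 ln_powR mulfK// gt_eqF// ln2_gt0. Qed.

Lemma le_log2 (c d : R) : 0 < c -> c <= d -> log2 c <= log2 d.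
Proof.
move=> c0 cd; rewrite ler_wpM2r ?invr_ge0 ?(ltW ln2_gt0)// ler_ln// posrE//.
exact: lt_le_trans cd.
Qed.

Lemma log2M (c d : R) : 0 < c -> 0 < d -> log2 (c * d) = log2 c + log2 d.
Proof. by move=> c0 d0; rewrite /log2 lnM ?posrE// mulrDl. Qed.

Lemma powR_log2 (c : R) : 0 < c -> 2 `^ (log2 c) = c.
Proof.
move=> c0; rewrite /powR gt_eqF//; rewrite /log2 mulfVK ?lnK ?posrE//.
by rewrite gt_eqF// ln2_gt0.
Qed.

(** Concatenating the words of optimal covers at [u] and at the shifted control gives a cover for
    time [s + t], and the weight of a concatenation is the product of the weights. *)
Lemma cover_pressure_subadditive s t u :
  cover_pressure (s + t) u <= cover_pressure s u + cover_pressure t (shift_by s%:Z u).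
Proof.
have cs := @min_coverP s u; have ct := @min_coverP t (shift_by s%:Z u).
rewrite /cover_pressure -log2M; [|exact: cover_weight_gt0 cs|exact: cover_weight_gt0 ct].
apply: le_log2; first exact: (cover_weight_gt0 (@min_coverP _ u)).
pose f (p : s.-tuple I * t.-tuple I) : (s + t).-tuple I := [tuple of p.1 ++ p.2].
pose W := (f @: [set p | (p.1 \in min_cover s u) && (p.2 \in min_cover t (shift_by s%:Z u))])%SET.
apply: le_trans (_ : cover_weight W <= _).
  apply: min_cover_le => x ux; have [w1 w1s w1f] := cs x ux.
  have [w2 w2t w2f] := ct (forward S s x u) (L_invariant s ux).
  exists (f (w1, w2)); first by apply/imset_f; rewrite inE w1s.
  move=> k kst; rewrite /f/= nth_cat size_tuple; case: ltnP => ks; first exact: w1f.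
  have kE : k = (s + (k - s))%N by rewrite subnKC.
  rewrite {2}kE -control_flow_natD; apply: w2f; lia.
apply: le_trans (sum_imset_le _ _ _) _; first by move=> w; exact/ltW/string_weight_gt0.
rewrite /cover_weight mulr_suml; under [leRHS]eq_bigr do rewrite mulr_sumr.
rewrite pair_big/= le_eqVlt; apply/orP; left; apply/eqP; apply: eq_big => [p|p _].
  by rewrite inE.
rewrite /string_weight -powRD; last by rewrite pnatr_eq0 implybT.
congr (_ `^ _); rewrite big_split_ord/=; congr (_ + _); apply: eq_bigr => k _.
  by rewrite nth_cat size_tuple ltn_ord.
by rewrite nth_cat size_tuple ltnNge leq_addr/= addKn.
Qed.

(** There are [#|I| ^ t] words of length [t], and the exponent of each weight is at most [t] times
    the sum of all [|a i|] in absolute value. *)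
Definition cover_bound : R := \sum_i `|a i| + log2 #|I|%:R.

Lemma cover_pressure_bounded t u : `|cover_pressure t u| <= cover_bound * t%:R.
Proof.
have I0 : 0 < #|I|%:R :> R by rewrite ltr0n; apply/card_gt0P; exists i0.
pose A : R := \sum_i `|a i|.
have A_ge i : `|a i| <= A.
  by rewrite /A (bigD1 i)//= lerDl; apply: sumr_ge0.
have sumA (w : t.-tuple I) : `|\sum_(k < t) a (nth i0 w k)| <= A * t%:R.
  apply: le_trans (ler_norm_sum _ _ _) _.
  apply: le_trans (_ : \sum_(k < t) A <= _); first by apply: ler_sum => k _.
  by rewrite sumr_const card_ord mulr_natr.
have lI : 0 <= log2 (#|I|%:R : R).
  by rewrite divr_ge0 ?(ltW ln2_gt0)// ln_ge0// ler1n -(ltr0n R).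
rewrite ler_norml; apply/andP; split.
  have [x ux] := fiber_neq0 u; have [w wW _] := @min_coverP t u x ux.
  apply: le_trans (_ : log2 (string_weight w) <= _).
    rewrite log2_powR; have := sumA w; rewrite ler_norml => /andP[h _].
    apply: le_trans h; rewrite lerN2 ler_wpM2r//.
    by rewrite /cover_bound lerDl.
  apply: le_log2; first exact: string_weight_gt0.
  rewrite /cover_weight (bigD1 w)//= lerDl.
  by apply: sumr_ge0 => v _; exact/ltW/string_weight_gt0.
apply: le_trans (_ : log2 (#|I|%:R ^+ t * 2 `^ (A * t%:R)) <= _).
  apply: le_log2; first exact: (cover_weight_gt0 (@min_coverP _ u)).
  apply: le_trans (min_cover_le (@coversT t u)) _.
  apply: le_trans (_ : \sum_(w in [set: t.-tuple I]%SET) 2 `^ (A * t%:R) <= _).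
    apply: ler_sum => w _; rewrite ler_powR ?ler1n//.
    by have := sumA w; rewrite ler_norml => /andP[].
  by rewrite sumr_const cardsT card_tuple -[leLHS]mulr_natl natrX.
rewrite log2M ?exprn_gt0// ?powR_gt0// log2_powR /cover_bound mulrDl addrC lerD2l.
by rewrite /log2 lnXn// mulr_natr mulrnAl.
Qed.

Lemma follows_open t (w : t.-tuple I) : open [set z | follows w z].
Proof.
have -> : [set z | follows w z] =
    \big[setI/setT]_(k < t) (control_flow S k%:Z @^-1` V (nth i0 w k)).
  rewrite -(bigcap_mkord _ (fun k => control_flow S k%:Z @^-1` V (nth i0 w k))).
  by apply/seteqP; split=> z /= h k /=; exact: h.
elim/big_ind : _ => [|A B|k _]; [exact: openT|exact: openI|].
by apply: open_comp => // z _; exact: control_flow_nat_continuous.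
Qed.

(** Tube argument: the controls whose fiber is not covered form the projection of the points of [L]
    that follow no word of [W], which is a compact set. *)
Lemma covers_open t (W : {set t.-tuple I}) : open [set u | covers u W].
Proof.
pose K := L `&` ~` \bigcup_(w in [set w | w \in W]) [set z | follows w z].
have -> : [set u | covers u W] = ~` (fst @` K).
  apply/seteqP; split => [u uW [[u' x] [/= Lx nK] /= uu']|u nK x ux].
    by rewrite uu' in Lx nK; have [w wW h] := uW x Lx; apply: nK; exists w.
  apply: contrapT => nw; apply: nK; exists (u, x); last by [].
  split; first exact: ux.
  by move=> [w wW uw]; apply: nw; exists w.
apply: closed_openC; apply: compact_closed; first exact: controls_hausdorff.
apply: continuous_compact; first by apply: continuous_subspaceT; exact: continuous_fst.
apply: (subclosed_compact _ lift_compact); last by move=> z [].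
apply: closedI => //; apply: open_closedC; apply: bigcup_open => w _.
exact: follows_open.
Qed.

(** A value below [c] is witnessed by a single set of words, which still covers the fibers of all
    nearby controls. *)
Lemma cover_pressure_usc t c : open [set u | cover_pressure t u < c].
Proof.
have -> : [set u | cover_pressure t u < c] =
    \bigcup_(W in [set W : {set t.-tuple I} | log2 (cover_weight W) < c])
      [set u | covers u W].
  apply/seteqP; split=> [u uc|u [W /= Wc uW]].
    by exists (min_cover t u) => //; exact: min_coverP.
  apply: le_lt_trans Wc; apply: le_log2; last exact: min_cover_le.
  exact: (cover_weight_gt0 (@min_coverP _ u)).
by apply: bigcup_open => W _; exact: covers_open.
Qed.

Variable alpha : controls U * M -> R.
Hypothesis alpha_le : forall i z, L z -> V i z -> alpha z <= a i.

(** By the diameter bound, distinct points of a separated set never follow the same word. The set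
    thus injects into an optimal cover, and [a] dominates [alpha] along each word. *)
Lemma pressure_sum_le_cover t u eps :
  (forall i v x y, V i (v, x) -> V i (v, y) -> rdist X x y <= eps) ->
  (pressure_sum S Q alpha u t eps <= (2 `^ (cover_pressure t u))%:E)%E.
Proof.
move=> Veps; have uW := @min_coverP t u; rewrite powR_log2; last exact: cover_weight_gt0 uW.
apply: ge_ereal_sup => _ [F [Fu Fsep] <-]; apply: ge_ereal_sup => _ [A [finA AF] <-].
rewrite fsbig_finite//=; set s : seq M := finmap.enum_fset (fset_set A).
have sA x : x \in s -> A x by rewrite /s in_fset_set// => /set_mem.
have h x : exists w : t.-tuple I, x \in s -> w \in min_cover t u /\ follows w (u, x).
  have [xs|] := boolP (x \in s); last by move=> _; exists [tuple of nseq t i0].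
  by have [w wW wf] := uW x (Fu _ (AF _ (sA _ xs))); exists w.
pose str x := projT1 (cid (h x)).
have strP x : x \in s -> str x \in min_cover t u /\ follows (str x) (u, x).
  by rewrite /str; case: cid.
have str_inj : {in s &, injective str}.
  move=> x y xs ys xy; apply: contrapT => nxy.
  have [k kt] := Fsep x y (AF _ (sA _ xs)) (AF _ (sA _ ys)) nxy.
  apply/negP; rewrite -leNgt.
  have := (strP x xs).2 k kt; have := (strP y ys).2 k kt; rewrite xy.
  by move=> Vy Vx; exact: Veps Vx Vy.
rewrite sumEFin lee_fin.
apply: le_trans (_ : \sum_(x <- s) string_weight (str x) <= _).
  rewrite big_seq [leRHS]big_seq; apply: ler_sum => x xs.
  rewrite ler_powR ?ler1n//; apply: ler_sum => k _.
  apply: alpha_le; last exact: (strP x xs).2.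
  by apply: L_invariant; exact: Fu (AF _ (sA _ xs)).
rewrite -(big_map str xpredT (@string_weight t)) big_uniq/=; last first.
  by rewrite map_inj_in_uniq// finmap.fset_uniq.
rewrite /cover_weight [leRHS](bigID [in [seq str x | x <- s]])/=.
rewrite [X in X + _](eq_bigl [in [seq str x | x <- s]]).
  by rewrite lerDl; apply: sumr_ge0 => v _; exact/ltW/string_weight_gt0.
move=> v; apply: andb_idl => /mapP[x xs ->].
by have [] := strP x xs.
Qed.

(** A maximal separated set is spanning. Adding [y] creates the ordered pairs (x, y) and (y, x), and
    maximality tells only that one of them is never separated, hence the disjunction. *)
Lemma exists_maximal_separated t u delta : exists F : set M,
  [/\ F `<=` fiber S Q u, orbit_separated S u t delta F &
    forall y, fiber S Q u y -> exists2 x, F x &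
      x = y \/ forall k, (k < t)%N ->
        rdist X (forward S k x u) (forward S k y u) <= delta \/
        rdist X (forward S k y u) (forward S k x u) <= delta].
Proof.
have [C CP totC|F [[Fu Fsep] Fmax]] := @Zorn_bigcup M
  [set F | F `<=` fiber S Q u /\ orbit_separated S u t delta F].
  split; first by move=> x [F /CP[Fu _] /Fu].
  move=> x y [F1 CF1 F1x] [F2 CF2 F2y].
  have [F12|F21] := totC _ _ CF1 CF2.
    by have [_] := CP _ CF2; apply => //; exact: F12.
  by have [_] := CP _ CF1; apply => //; exact: F21.
exists F; split => // y uy; apply: contrapT => ny.
have sep x : F x -> x <> y /\
    (exists2 k, (k < t)%N & delta < rdist X (forward S k x u) (forward S k y u)) /\
    (exists2 k, (k < t)%N & delta < rdist X (forward S k y u) (forward S k x u)).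
  move=> Fx; split; first by move=> xy; apply: ny; exists x => //; left.
  split; apply: contrapT => nk; apply: ny; exists x => //; right => k kt.
    by left; rewrite leNgt; apply/negP => h; apply: nk; exists k.
  by right; rewrite leNgt; apply/negP => h; apply: nk; exists k.
apply: (Fmax (F `|` [set y])).
  split; first by move=> x Fx; left.
  move=> /(_ y (or_intror erefl)) Fy; apply: ny; exists y => //; by left.
split; first by move=> x [/Fu//|->].
move=> x x' [Fx|->] [Fx'|->] xx' //; first exact: Fsep.
  exact: (sep _ Fx).2.1.
exact: (sep _ Fx').2.2.
Qed.

(** [delta] acts as a Lebesgue number along fibers: at each time a point of a maximal separated set
    chooses a cover element containing everything within [delta] of it. Its word is then followed by
    all points that it spans, so these words cover the fiber. *)
Lemma cover_le_pressure_sum t u eta delta :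
  (forall i z, L z -> V i z -> a i <= alpha z + eta) ->
  (forall z, L z -> exists2 i, V i z & forall y, L (z.1, y) ->
     rdist X z.2 y <= delta \/ rdist X y z.2 <= delta -> V i (z.1, y)) ->
  ((2 `^ (cover_pressure t u - eta * t%:R))%:E <=
   pressure_sum S Q alpha u t delta)%E.
Proof.
move=> alpha_ge leb; have [F [Fu Fsep Fmax]] := exists_maximal_separated t u delta.
apply: le_trans (ereal_sup_ubound _); last by exists F.
have h k x : exists i, F x -> V i (Phi k (u, x)) /\ forall y, L (shift_by k%:Z u, y) ->
     rdist X (forward S k x u) y <= delta \/ rdist X y (forward S k x u) <= delta ->
     V i (shift_by k%:Z u, y).
  have [Fx|nFx] := pselect (F x); last by exists i0.
  by have [i Vi hi] := leb _ (L_invariant k (Fu _ Fx)); exists i.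
pose str x : t.-tuple I := projT1 (cid (exists_string t (fun k => projT1 (cid (h k x))))).
have strE x k : (k < t)%N -> nth i0 (str x) k = projT1 (cid (h k x)).
  by rewrite /str; case: (cid (exists_string _ _)) => w /= wE kt; rewrite wE.
pose W := [set w | `[< exists2 x, F x & str x = w >]]%SET.
have uW : covers u W.
  move=> y uy; have [x Fx xy] := Fmax y uy; exists (str x).
    by rewrite inE; apply/asboolP; exists x.
  move=> k kt; rewrite strE//; case: cid => i /= /(_ Fx) [Vi hi].
  case: xy => [<-//|/(_ k kt) xy]; apply: hi; last exact: xy.
  exact: L_invariant uy.
have g w : exists x, w \in W -> F x /\ str x = w.
  have [|nW] := boolP (w \in W); last by have [x _] := fiber_neq0 u; exists x.
  by rewrite inE => /asboolP[x Fx sx]; exists x.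
(* Several points may share a word; one representative per word gives a finite part of the sum over
   [F] that is already large enough. *)
pose rep w := projT1 (cid (g w)).
have repP w : w \in W -> F (rep w) /\ str (rep w) = w by rewrite /rep; case: cid.
apply: esum_ge; pose s := [seq rep w | w <- enum W].
exists [set` s].
  split; first exact: finite_seq.
  by move=> x /= /mapP[w]; rewrite mem_enum => /repP[Fr _] ->.
have us : uniq s.
  rewrite map_inj_in_uniq ?enum_uniq// => v w; rewrite !mem_enum => vW wW vw.
  by rewrite -(repP v vW).2 -(repP w wW).2 vw.
rewrite -fsbig_seq// sumEFin lee_fin big_map big_enum/=.
rewrite powRD ?powRN; last by rewrite pnatr_eq0 implybT.
rewrite powR_log2; last exact: (cover_weight_gt0 (@min_coverP _ u)).
rewrite ler_pdivrMr ?powR_gt0//.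
apply: le_trans (min_cover_le uW) _; rewrite /cover_weight mulr_suml.
apply: ler_sum => w wW; rewrite -powRD; last by rewrite pnatr_eq0 implybT.
rewrite ler_powR ?ler1n//.
have -> : eta * t%:R = \sum_(k < t) eta by rewrite sumr_const card_ord mulr_natr.
rewrite -big_split/=.
apply: ler_sum => k _; have [Fr sr] := repP w wW.
apply: alpha_ge; first by apply: L_invariant; exact: Fu.
rewrite -[in nth _ _ _]sr strE//; case: cid => i /= /(_ Fr).
by case.
Qed.

End Covers.

(** * Fine covers and the pressure cocycle *)

Lemma compact_finite_subcover (T : topologicalType) (A : set T)
    (f : T -> set T) : compact A -> (forall x, A x -> nbhs x (f x)) ->
  exists s : seq T, (forall x, x \in s -> A x) /\
    forall y, A y -> exists2 x, x \in s & f x y.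
Proof.
move=> /compact_near_coveringP cA fx.
pose inA (s : seq T) := forall x, x \in s -> A x.
pose F : set_system (seq T) := filter_from [set s | inA s]
  (fun s => [set s' | inA s' /\ {subset s <= s'}]).
have FF : Filter F.
  apply: filter_from_filter; first by exists [::].
  move=> s1 s2 s1A s2A; exists (s1 ++ s2).
    by move=> x; rewrite mem_cat => /orP[/s1A|/s2A].
  move=> s [sA ss]; split; split => // x xs; apply: ss; rewrite mem_cat xs//.
  by rewrite orbT.
have [|s sA sF] := cA _ F (fun s y => exists2 x, x \in s & f x y) FF.
  move=> x Ax; exists (f x, [set s | inA s /\ {subset [:: x] <= s}]).
    by split; [exact: fx|exists [:: x] => // y; rewrite inE => /eqP->].
  by move=> [y s] /= [fxy [_ xs]]; exists x => //; apply: xs; rewrite inE.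
exists s; split => // y Ay; apply: (sF s) Ay; by split.
Qed.

Lemma nbhs_cylinder_snd (A B : topologicalType) (z : A * B) (V : set B) :
  nbhs z.2 V -> nbhs z (setT `*` V).
Proof. by case: z => u x /= xV; exists (setT, V) => //; split => //; exact: filterT. Qed.

Lemma nbhs_pairP (A B : topologicalType) (z : A * B) (V : set (A * B)) :
  nbhs z V -> exists P Q, [/\ nbhs z.1 P, nbhs z.2 Q & P `*` Q `<=` V].
Proof. by case: z => u x [[P Q] /= [uP xQ] PQ]; exists P, Q. Qed.

Lemma nbhs_setX (A B : topologicalType) (z : A * B) (P : set A) (Q : set B) :
  nbhs z.1 P -> nbhs z.2 Q -> nbhs z (P `*` Q).
Proof. by case: z => u x /= uP xQ; exists (P, Q). Qed.

Section PressureCocycle.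
Variables (R : realType) (n : nat) (M : topologicalType).
Variables (X : riemannian_manifold R n M) (U : pmetricType R).
Variables (S : control_system X U) (Q : set M).
Hypothesis cU : compact [set: U].
Hypothesis cQ : compact Q.
Local Notation L := (all_time_lift S Q).
Local Notation Phi t := (control_flow S t%:Z).
Hypothesis L_closed : closed L.
Hypothesis L_invariant : forall (t : nat) z, L z -> L (Phi t z).
Hypothesis fiber_neq0 : forall u, fiber S Q u !=set0.
Hypothesis rdist_small : forall (x : M) e, 0 < e ->
  exists2 V : set M, nbhs x V & forall y z, V y -> V z -> rdist X y z <= e.
Hypothesis rdist_separates : forall (x : M) (V : set M), nbhs x V ->
  exists2 W : set M, nbhs x W & exists2 delta, 0 < delta & forall y z, W y ->
    rdist X y z <= delta \/ rdist X z y <= delta -> V z.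
Variable alpha : controls U * M -> R.
Hypothesis alpha_continuous : forall z, L z ->
  alpha @ within L (nbhs z) --> alpha z.

(** Each point gets a pair of neighborhoods: [V], small for [alpha] and for the distance, and a
    smaller [N] whose enlargement by [delta] along fibers stays in [V]. Compactness is applied to
    the sets [N], the cover consists of the sets [V]. *)
Lemma exists_cover eps eta : 0 < eps -> 0 < eta ->
  exists (I : finType) (i0 : I) (V : I -> set (controls U * M)) (a : I -> R)
    (delta : R),
  [/\ forall i, open (V i), forall z, L z -> exists i, V i z,
      forall i v x y, V i (v, x) -> V i (v, y) -> rdist X x y <= eps,
      forall i z, L z -> V i z -> alpha z <= a i <= alpha z + eta &
      0 < delta /\ forall z, L z -> exists2 i, V i z & forall y, L (z.1, y) ->
        rdist X z.2 y <= delta \/ rdist X y z.2 <= delta -> V i (z.1, y)].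
Proof.
move=> eps0 eta0.
have h z : exists (V : set (controls U * M)) (N : set (controls U * M)) (delta : R),
  L z -> [/\ open V, nbhs z N /\ N `<=` V,
    forall v x y, V (v, x) -> V (v, y) -> rdist X x y <= eps,
    forall z', L z' -> V z' -> `|alpha z' - alpha z| <= eta / 2 &
    0 < delta /\ forall u x y, N (u, x) ->
      rdist X x y <= delta \/ rdist X y x <= delta -> V (u, y)].
  have [Lz|nLz] := pselect (L z); last by exists set0, set0, 0.
  have [V1 zV1 V1eps] := rdist_small z.2 eps0.
  have /cvgrPdistC_le /(_ (eta / 2)) := alpha_continuous Lz.
  rewrite divr_gt0// => /(_ isT); rewrite near_withinE => zA.
  set A : set (controls U * M) := [set z' | (L z' -> `|alpha z' - alpha z| <= eta / 2)] in zA.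
  pose V : set (controls U * M) := interior (A `&` (setT `*` V1)).

  have zV : nbhs z V.
    by apply: nbhs_interior; apply: filterI; [exact: zA|exact: nbhs_cylinder_snd].
  have [A2 [V2 [zA2 zV2 AV2]]] := nbhs_pairP zV.
  have [W zW [delta delta0 Wdelta]] := rdist_separates zV2.
  exists V, (A2 `*` (W `&` V2)), delta => _; split.
  - exact: open_interior.
  - split.
      by apply: nbhs_setX => //; exact: filterI.
    by move=> [u x] [/= A2u [_ V2x]]; exact: AV2.
  - move=> v x y /interior_subset[_ [_ /= V1x]] /interior_subset[_ [_ /= V1y]].
    exact: V1eps.
  - by move=> z' Lz' /interior_subset[Az' _]; exact: Az'.
  - split => // u x y [/= A2u [Wx _]] xy; apply: AV2; split => //=.
    exact: Wdelta Wx xy.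
pose V z := projT1 (cid (h z)).
pose N z := projT1 (cid (projT2 (cid (h z)))).
pose delta z := projT1 (cid (projT2 (cid (projT2 (cid (h z)))))).
have VN z : L z -> [/\ open (V z), nbhs z (N z) /\ N z `<=` V z,
    forall v x y, V z (v, x) -> V z (v, y) -> rdist X x y <= eps,
    forall z', L z' -> V z z' -> `|alpha z' - alpha z| <= eta / 2 &
    0 < delta z /\ forall u x y, N z (u, x) ->
      rdist X x y <= delta z \/ rdist X y x <= delta z -> V z (u, y)].
  exact: (projT2 (cid (projT2 (cid (projT2 (cid (h z))))))).
have [|D [DL covD]] := compact_finite_subcover (f := N) (lift_compact cU cQ L_closed).
  by move=> z Lz; have [_ []] := VN z Lz.
have [x0 ux0] := fiber_neq0 point.
have [i0 i0D _] := covD (point, x0) ux0.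
pose I : finType := seq_sub D.
have LI (i : I) : L (ssval i) by apply: DL; exact: ssvalP.
have covI z : L z -> exists i : I, N (ssval i) z.
  by move=> /covD[i iD Nz]; exists (SeqSub iD).
(* The Lebesgue number along fibers: the least margin over the finitely many centers, started at 1
   so that it is positive. *)
pose dmin : R := \big[Order.min/1]_(i : I) delta (ssval i).
exists I, (SeqSub i0D).
(* On [L], [alpha] stays within [eta / 2] of its value at the center, so this label lies between
   [alpha] and [alpha + eta]. *)
exists (fun i => V (ssval i)), (fun i => alpha (ssval i) + eta / 2), dmin; split.
- by move=> i; have [] := VN _ (LI i).
- move=> z /covI [i Nz]; exists i.
  by have [_ [_ +] _ _ _] := VN _ (LI i); exact.
- by move=> i; have [] := VN _ (LI i).
- move=> i z Lz Vz; have [_ _ _ + _] := VN _ (LI i).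
  move=> /(_ z Lz Vz); rewrite ler_distl => /andP[h1 h2].
  move: h1; rewrite lerBlDr h2/= => h1; have := lerD h1 (lexx (eta / 2)).
  by rewrite -addrA -splitr.
- split.
    rewrite /dmin; elim/big_ind : _ => // [x y x0' y0'|i _]; first by rewrite lt_min x0'.
    by have [_ _ _ _ []] := VN _ (LI i).
  move=> z Lz; have [i Nz] := covI z Lz; exists i.
    by have [_ [_ +] _ _ _] := VN _ (LI i); exact.
  move=> y Ly zy; have [_ _ _ _ [_ Nleb]] := VN _ (LI i).
  have dmini : dmin <= delta (ssval i) by rewrite /dmin; exact: bigmin_le_cond.
  apply: (Nleb z.1 z.2); first by case: (z) Nz.
  by case: zy => zy; [left|right]; exact: le_trans dmini.
Qed.

Lemma le_elog2 (x y : \bar R) : (0 <= x)%E -> (x <= y)%E -> (elog2 x <= elog2 y)%E.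
Proof.
move=> x0 xy; rewrite /elog2 lee_wpmul2r// ?lee_fin ?invr_ge0 ?(ltW (ln2_gt0 R))//.
by rewrite lee_lne// in_itv/= leey andbT// (le_trans x0).
Qed.

Lemma elog2_powR (c : R) : elog2 (2 `^ c)%:E = c%:E.
Proof. by rewrite /elog2 lne_EFin ?powR_gt0// -EFinM -[X in X%:E]/(log2 (2 `^ c)) log2_powR. Qed.

Lemma pressure_sum_ge0 u t eps : (0 <= pressure_sum S Q alpha u t eps)%E.
Proof.
apply: ereal_sup_ubound; exists set0; last by rewrite esum_set0.
by split => // x y [].
Qed.

Lemma exists_pressure_cocycle eps eta : 0 < eps -> 0 < eta ->
  exists (g : nat -> controls U -> R) (B delta : R),
  [/\ [/\ forall s t u, g (s + t)%N u <= g s u + g t (shift_by s%:Z u),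
      forall t u, `|g t u| <= B * t%:R,
      forall t c, open [set u | g t u < c] & 0 < delta],
      forall t u, (elog2 (pressure_sum S Q alpha u t eps) <= (g t u)%:E)%E &
      forall t u, ((g t u - eta * t%:R)%:E <=
                   elog2 (pressure_sum S Q alpha u t delta))%E].
Proof.
move=> eps0 eta0.
have [I [i0 [V [a [delta [oV LV Veps Valpha [delta0 leb]]]]]]] := exists_cover eps0 eta0.
exists (cover_pressure S Q i0 V a), (cover_bound a), delta; split; first split.
- by move=> s t u; exact: cover_pressure_subadditive.
- by move=> t u; exact: cover_pressure_bounded.
- by move=> t c; exact: cover_pressure_usc.
- by [].
- move=> t u; rewrite -(elog2_powR (cover_pressure _ _ _ _ _ _ _)).
  apply: le_elog2; first exact: pressure_sum_ge0.
  by apply: pressure_sum_le_cover => // i z Lz Vz; have /andP[] := Valpha _ _ Lz Vz.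
- move=> t u; rewrite -elog2_powR; apply: le_elog2.
    by rewrite lee_fin powR_ge0.
  by apply: cover_le_pressure_sum => // i z Lz Vz; have /andP[] := Valpha _ _ Lz Vz.
Qed.

End PressureCocycle.

(** * Upper limits and monotonicity in the scale *)

Lemma lee_real_ub (R : realType) (x y : \bar R) :
  (forall r : R, (y < r%:E)%E -> (x <= r%:E)%E) -> (x <= y)%E.
Proof.
case: y => [y| |] h; last 2 first.
- exact: leey.
- case: x h => [x| |] h //.
    by have := h (x - 1) (ltNyr _); rewrite lee_fin lerBrDr gerDl ler10.
  by have := h 0 (ltNyr _).
by apply/lee_addgt0Pr => e e0; apply: h; rewrite lte_fin ltrDl.
Qed.

Lemma lee_real_lb (R : realType) (x y : \bar R) :
  (forall r : R, (r%:E < x)%E -> (r%:E <= y)%E) -> (x <= y)%E.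
Proof.
move=> h; rewrite -leeN2; apply: lee_real_ub => r xr.
rewrite leeNl -EFinN; apply: h; rewrite EFinN lteNl; exact: xr.
Qed.

Section Limsup.
Variable R : realType.
Implicit Type u : nat -> \bar R.

Lemma limn_esup_le_near u N (c : \bar R) :
  (forall k, (N <= k)%N -> (u k <= c)%E) -> (limn_esup u <= c)%E.
Proof.
move=> h; apply: le_trans (_ : ereal_sup (u @` [set k | (N <= k)%N]) <= _)%E.
  by apply: ereal_inf_lbound; exists [set k | (N <= k)%N] => //; exists N.
by apply: ge_ereal_sup => _ [k /= Nk <-]; exact: h.
Qed.

Lemma limn_esup_ge_near u N (c : \bar R) :
  (forall k, (N <= k)%N -> (c <= u k)%E) -> (c <= limn_esup u)%E.
Proof.
move=> h; apply: le_ereal_inf_tmp => _ [V [K _ KV] <-].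
apply: le_trans (h (maxn N K) (leq_maxl _ _)) _; apply: ereal_sup_ubound.
by exists (maxn N K) => //; apply: KV; exact: leq_maxr.
Qed.

Lemma limn_esup_gt u (c : \bar R) : (c < limn_esup u)%E ->
  forall N, exists2 k, (N <= k)%N & (c < u k)%E.
Proof.
move=> cu N; have /ereal_sup_gt[_ [k /= Nk <-] ck] :
    (c < ereal_sup (u @` [set k | (N <= k)%N]))%E.
  apply: lt_le_trans cu _; apply: ereal_inf_lbound.
  by exists [set k | (N <= k)%N] => //; exists N.
by exists k.
Qed.

Lemma le_limn_esup u v : (forall k, (u k <= v k)%E) -> (limn_esup u <= limn_esup v)%E.
Proof.
move=> uv; apply: le_ereal_inf_tmp => _ [V FV <-].
apply: le_trans (_ : ereal_sup (u @` V) <= _)%E.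
  by apply: ereal_inf_lbound; exists V.
apply: ge_ereal_sup => _ [k Vk <-]; apply: le_trans (uv k) _.
by apply: ereal_sup_ubound; exists k.
Qed.

Lemma lim_at_right0_nonincreasing (f : R -> \bar R) :
  (forall x y, 0 < x -> x <= y -> (f y <= f x)%E) ->
  lim (f e @[e --> (0 : R)^'+]) = ereal_sup (f @` [set e | 0 < e]).
Proof.
move=> h; apply/cvg_lim; first exact: ereal_hausdorff.
rewrite (_ : [set e | 0 < e] = [set` Interval (BRight 0) +oo%O]); last first.
  by apply/seteqP; split=> e /=; rewrite in_itv/= andbT.
apply: nonincreasing_at_right_cvge => // x y.
by rewrite in_itv/= andbT => x0 _ xy; exact: h.
Qed.

End Limsup.

Section PressureMonotone.
Variables (R : realType) (n : nat) (M : topologicalType).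
Variables (X : riemannian_manifold R n M) (U : pmetricType R).
Variables (S : control_system X U) (Q : set M) (alpha : controls U * M -> R).

Lemma pressure_sum_nonincreasing u t (eps eps' : R) : eps <= eps' ->
  (elog2 (pressure_sum S Q alpha u t eps') <= elog2 (pressure_sum S Q alpha u t eps))%E.
Proof.
move=> ee'; apply: le_elog2; first exact: pressure_sum_ge0.
apply: ge_ereal_sup => _ [F [Fu Fsep] <-]; apply: ereal_sup_ubound.
exists F => //; split => // x y Fx Fy xy; have [k kt h] := Fsep x y Fx Fy xy.
by exists k => //; exact: le_lt_trans h.
Qed.

Let inv_ge0 t : (0 <= (t%:R^-1)%:E :> \bar R)%E.
Proof. by rewrite lee_fin invr_ge0. Qed.

Lemma fiber_pressureE u : fiber_pressure S Q alpha u =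
  ereal_sup [set limn_esup (fun tau : nat =>
         (tau%:R^-1)%:E * elog2 (pressure_sum S Q alpha u tau eps))%E
       | eps in [set eps : R | 0 < eps]].
Proof.
apply: lim_at_right0_nonincreasing => x y x0 xy; apply: le_limn_esup => k.
apply: lee_wpmul2l; first exact: inv_ge0.
exact: pressure_sum_nonincreasing.
Qed.

Lemma top_pressureE (P : probability (borel_controls U) R) :
  top_pressure S Q alpha P =
  ereal_sup [set limn_esup (fun tau : nat => (tau%:R^-1)%:E *
         \int[P]_u elog2 (pressure_sum S Q alpha u tau eps))%E
       | eps in [set eps : R | 0 < eps]].
Proof.
apply: lim_at_right0_nonincreasing => x y x0 xy; apply: le_limn_esup => k.
apply: lee_wpmul2l; first exact: inv_ge0.
apply: le_integral_total => u.
exact: pressure_sum_nonincreasing.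
Qed.

End PressureMonotone.

(** * Variational principle *)

Section VariationalPressure.
Variables (R : realType) (n : nat) (M : topologicalType).
Variables (X : riemannian_manifold R n M) (U : pmetricType R).
Variables (S : control_system X U) (Q : set M).
Hypothesis cU : compact [set: U].
Hypothesis cQ : compact Q.
Local Notation L := (all_time_lift S Q).
Hypothesis L_closed : closed L.
Hypothesis L_invariant : forall (t : nat) z, L z -> L (control_flow S t%:Z z).
Hypothesis fiber_neq0 : forall u, fiber S Q u !=set0.
Hypothesis rdist_small : forall (x : M) e, 0 < e ->
  exists2 V : set M, nbhs x V & forall y z, V y -> V z -> rdist X y z <= e.
Hypothesis rdist_separates : forall (x : M) (V : set M), nbhs x V ->
  exists2 W : set M, nbhs x W & exists2 delta, 0 < delta & forall y z, W y ->
    rdist X y z <= delta \/ rdist X z y <= delta -> V z.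
Variable alpha : controls U * M -> R.
Hypothesis alpha_continuous : forall z, L z ->
  alpha @ within L (nbhs z) --> alpha z.
Local Notation pi u t eps := (pressure_sum S Q alpha u t eps).

Let cocycle := exists_pressure_cocycle cU cQ L_closed L_invariant fiber_neq0
  rdist_small rdist_separates alpha_continuous.

Lemma top_pressure_le_fiber_pressure (P : probability (borel_controls U) R) :
  (top_pressure S Q alpha P <= ereal_sup (range (fiber_pressure S Q alpha)))%E.
Proof.
rewrite top_pressureE; apply: ge_ereal_sup => _ [eps /= eps0 <-].
apply: lee_real_ub => s supS; apply/lee_addgt0Pr => e e0.
have e2 : 0 < e / 2 by rewrite divr_gt0.
have [g [B [delta [[gD gB g_usc delta0] pig gpi]]]] := cocycle eps0 e2.
have [|C gC] := subadditive_uniform cU gD gB g_usc (S := s + e / 2).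
  (* If [g t u] were at least [t * (s + e / 2)] at all positive times, the sandwich, losing [e / 2]
     per unit of time, would give [u] a fiber pressure of at least [s] at scale [delta]. *)
  move=> u; apply: contrapT => nu; move: supS; apply/negP; rewrite -leNgt.
  apply: le_trans (_ : fiber_pressure S Q alpha u <= _)%E; last first.
    by apply: ereal_sup_ubound; exists u.
  rewrite fiber_pressureE.
  apply: le_trans (ereal_sup_ubound _); last by exists delta.
  apply: (@limn_esup_ge_near _ _ 1) => t t0.
  have t0R : 0 < t%:R :> R by rewrite ltr0n.
  rewrite muleC lee_pdivlMr//; apply: le_trans (gpi t u).
  rewrite -EFinM lee_fin; have : t%:R * (s + e / 2) <= g t u.
    by rewrite leNgt; apply/negP => h; apply: nu; exists t.
  by lra.
(* From time [N] on, [C] is at most [t * (e / 2)]; this is the second half of the error [e]. *)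
pose N := (Num.truncn (C / (e / 2))).+1.
apply: (@limn_esup_le_near _ _ N) => t Nt.
have t0 : (0 < t)%N by apply: leq_trans Nt.
have t0R : 0 < t%:R :> R by rewrite ltr0n.
rewrite muleC lee_pdivrMr//.
apply: le_trans (_ : (t%:R * (s + e / 2) + C)%:E <= _)%E.
  apply: integral_le_cst => u; apply: le_trans (pig t u) _.
  by rewrite lee_fin.
rewrite -EFinD -EFinM lee_fin.
have : C <= t%:R * (e / 2).
  rewrite -ler_pdivrMr//; apply: le_trans (ltW (truncnS_gt _)) _.
  by rewrite ler_nat.
by lra.
Qed.

Lemma fiber_pressure_le_top_pressure u :
  (fiber_pressure S Q alpha u <=
   ereal_sup [set top_pressure S Q alpha P | P in @shift_invariant_measures R U])%E.
Proof.
rewrite fiber_pressureE; apply: ge_ereal_sup => _ [eps /= eps0 <-].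
apply: lee_real_lb => s /limn_esup_gt su; apply/lee_addgt0Pr => e e0.
have [g [B [delta [[gD gB g_usc delta0] pig gpi]]]] := cocycle eps0 e0.
have [|P invP Pg] := subadditive_measure cU gD gB g_usc (S := s) (u := u).
  (* Going beyond N + 1 makes [t] positive, so that the factor [1 / t] can be cleared. *)
  move=> N; have [t Nt ts] := su N.+1; exists t; first exact: ltnW.
  have t0R : 0 < t%:R :> R by rewrite ltr0n (leq_trans _ Nt).
  move: ts; rewrite muleC lte_pdivlMr// => /ltW /le_trans /(_ (pig t u)).
  by rewrite -EFinM lee_fin mulrC.
rewrite -leeBlDr//; apply: le_trans (ereal_sup_ubound _); last by exists P.
rewrite top_pressureE; apply: le_trans (ereal_sup_ubound _); last by exists delta.
apply: (@limn_esup_ge_near _ _ 1) => t t0.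
have t0R : 0 < t%:R :> R by rewrite ltr0n.
rewrite muleC lee_pdivlMr//.
apply: le_trans (_ : \int[P]_u (g t u - e * t%:R)%:E <= _)%E; last first.
  by apply: le_integral_total => v; exact: gpi.
have int_g : P.-integrable setT (EFin \o g t).
  apply: measurable_bounded_integrable => //.
  - by rewrite [ltLHS]probability_setT ltry.
  - exact: usc_measurable.
  - exists (B * t%:R); split; first exact: num_real.
    by move=> x Bx v _; exact: le_trans (gB t v) (ltW Bx).
have int_e : P.-integrable setT (EFin \o (fun=> e * t%:R)).
  exact: finite_measure_integrable_cst.
have -> : (\int[P]_u (g t u - e * t%:R)%:E =
           \int[P]_u (g t u)%:E - (e * t%:R)%:E)%E.
  transitivity (\int[P]_u ((g t u)%:E - (e * t%:R)%:E))%E; first by [].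
  rewrite integralB_EFin//; congr (_ - _)%E.
  by rewrite integral_cst//= probability_setT mule1.
rewrite leeBrDr// -EFinB -EFinM -EFinD; apply: le_trans (Pg t t0).
by rewrite lee_fin; lra.
Qed.

Theorem variational_pressure :
  ereal_sup [set top_pressure S Q alpha P | P in @shift_invariant_measures R U] =
  ereal_sup (range (fiber_pressure S Q alpha)).
Proof.
apply/eqP; rewrite eq_le; apply/andP; split; apply: ge_ereal_sup.
  by move=> _ [P _ <-]; exact: top_pressure_le_fiber_pressure.
by move=> _ [u _ <-]; exact: fiber_pressure_le_top_pressure.
Qed.

End VariationalPressure.

(** * Calculus in charts *)

(** Two chart expressions of the same map agree only near a point, whereas ['d] is taken of total
    functions; this lemma transfers derivatives between them. *)
Lemma near_eq_diff (R : numFieldType) (V W : normedModType R) (f g : V -> W) (a : V) :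
  (\near a, f a = g a) -> differentiable f a ->
  differentiable g a /\ 'd g a = 'd f a :> (V -> W).
Proof.
move=> fg df; have fga := nbhs_singleton fg.
have dfc : continuous ('d f a) by exact: diff_continuous.
have gE : g \o shift a = cst (g a) + 'd f a +o_ 0 id.
  apply/eqaddoP => e e0; have /diff_locally/eqaddoP/(_ e e0) := df.
  have fgs : \forall h \near 0, f (h + a) = g (h + a).
    have : {for (0 : V), continuous (shift a)} by apply: continuousD => //; exact: cvg_cst.
    by move=> /(_ [set x | f x = g x]); rewrite /= add0r; exact.
  apply: filter_app; near=> h => /=.
  rewrite -![(_ - _ : _ -> _) _]/(_ - _) -![(_ + _ : _ -> _) _]/(_ + _) /=.
  have -> : f (h + a) = g (h + a) by near: h.
  by rewrite fga.
have dgE : 'd g a = 'd f a :> (V -> W) by exact: diff_unique.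
split => //; apply/diff_locallyP; rewrite dgE; split => //.
Unshelve. all: by end_near. Qed.

Lemma within_openP (T V : topologicalType) (D : set T) (f : T -> V) : open D ->
  {within D, continuous f} <-> (forall x, D x -> {for x, continuous f}).
Proof.
move=> oD; rewrite continuous_open_subspace//; split => [h x Dx|h x /set_mem Dx].
  by apply: h; exact: mem_set.
exact: h.
Qed.

(** * Norms and limits of matrices, positive definite forms *)

Section MatrixNorm.
Variable R : realFieldType.

Lemma entry_le_norm m n (A : 'M[R]_(m, n)) i j : `|A i j| <= `|A|.
Proof.
rewrite [leRHS]/Num.norm/= mx_normE -[leLHS]nngE num_le.
exact: (le_bigmax _ (fun ij : 'I_m * 'I_n => `|A ij.1 ij.2|%:nng) (i, j)).
Qed.

Lemma norm_le_entries m n (A : 'M[R]_(m, n)) c : 0 <= c ->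
  (forall i j, `|A i j| <= c) -> `|A| <= c.
Proof.
move=> c0 Ac; rewrite [leLHS]/Num.norm/=.
have [->//|/mx_norm_neq0[ij ->]] := eqVneq (mx_norm A) 0; exact: Ac.
Qed.

End MatrixNorm.

Lemma cvg_sumr (R : realFieldType) (T : Type) (F : set_system T) (I : Type) (r : seq I)
    (f : I -> T -> R) (l : I -> R) : Filter F ->
  (forall i, f i @ F --> l i) ->
  (fun x => \sum_(i <- r) f i x) @ F --> \sum_(i <- r) l i.
Proof.
move=> FF fl; apply: cvg_big => // -[x y]; apply: cvgD; [exact: cvg_fst|exact: cvg_snd].
Qed.

Lemma cvg_prodr (R : realFieldType) (T : Type) (F : set_system T) (I : Type) (r : seq I)
    (f : I -> T -> R) (l : I -> R) : Filter F ->
  (forall i, f i @ F --> l i) ->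
  (fun x => \prod_(i <- r) f i x) @ F --> \prod_(i <- r) l i.
Proof.
move=> FF fl; apply: cvg_big => // -[x y]; apply: cvgM; [exact: cvg_fst|exact: cvg_snd].
Qed.

Lemma cvg_entries (R : realFieldType) (T : Type) (F : set_system T) m n
    (f : T -> 'M[R]_(m, n)) (A : 'M[R]_(m, n)) : Filter F ->
  (forall i j, (fun x => f x i j) @ F --> A i j) -> f @ F --> A.
Proof.
move=> FF h; apply/cvgrPdist_le => e e0.
have hij (ij : 'I_m * 'I_n) : \forall x \near F, `|A ij.1 ij.2 - f x ij.1 ij.2| <= e.
  by have /cvgrPdist_le /(_ e e0) := h ij.1 ij.2.
have : \forall x \near F, forall ij : 'I_m * 'I_n, `|A ij.1 ij.2 - f x ij.1 ij.2| <= e.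
  exact: filter_forall.
apply: filterS => x hx; apply: norm_le_entries; first exact: ltW.
by move=> i j; rewrite !mxE; exact: (hx (i, j)).
Qed.

Lemma cvg_entry (R : realFieldType) (T : Type) (F : set_system T) m n
    (f : T -> 'M[R]_(m, n)) (A : 'M[R]_(m, n)) i j : Filter F ->
  f @ F --> A -> (fun x => f x i j) @ F --> A i j.
Proof.
move=> FF fA; apply: (@cvg_comp _ _ _ f (fun M : 'M[R]_(m, n) => M i j) _ _ _ fA).
exact: coord_continuous.
Qed.

Lemma cvg_mulmx (R : realFieldType) (T : Type) (F : set_system T) m n p
    (f : T -> 'M[R]_(m, n)) (g : T -> 'M[R]_(n, p)) (A : 'M[R]_(m, n)) (B : 'M[R]_(n, p)) :
  Filter F ->
  f @ F --> A -> g @ F --> B -> (fun x => f x *m g x) @ F --> A *m B.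
Proof.
move=> FF fA gB; apply: cvg_entries => i j; rewrite mxE.
under eq_cvg do rewrite mxE.
by apply: cvg_sumr => k; apply: cvgM; exact: cvg_entry.
Qed.

Lemma cvg_trmx (R : realFieldType) (T : Type) (F : set_system T) m n
    (f : T -> 'M[R]_(m, n)) (A : 'M[R]_(m, n)) : Filter F ->
  f @ F --> A -> (fun x => (f x)^T) @ F --> A^T.
Proof.
move=> FF fA; apply: cvg_entries => i j; rewrite mxE.
by under eq_cvg do rewrite mxE; exact: cvg_entry.
Qed.

Lemma cvg_det (R : realFieldType) (T : Type) (F : set_system T) n
    (f : T -> 'M[R]_n) (A : 'M[R]_n) :
  Filter F -> f @ F --> A -> (fun x => \det (f x)) @ F --> \det A.
Proof.
move=> FF fA; rewrite /determinant; apply: cvg_sumr => s; apply: cvgM.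
  exact: cvg_cst.
by apply: cvg_prodr => i; exact: cvg_entry.
Qed.

Lemma cvg_bilin (R : realType) (T : Type) (F : set_system T) n
    (G : T -> 'M[R]_n) (v w : T -> 'rV[R]_n) (G0 : 'M[R]_n) (v0 w0 : 'rV[R]_n) : Filter F ->
  G @ F --> G0 -> v @ F --> v0 -> w @ F --> w0 ->
  (fun x => bilin (G x) (v x) (w x)) @ F --> bilin G0 v0 w0.
Proof.
move=> FF GG vv ww; rewrite /bilin; apply: cvg_entry.
by apply: cvg_mulmx; [apply: cvg_mulmx|apply: cvg_trmx].
Qed.

Section Bilin.
Variables (R : realType) (n : nat).
Implicit Types (G : 'M[R]_n) (v w : 'rV[R]_n).

Lemma bilinE G v w : bilin G v w = \sum_j \sum_i v 0 i * G i j * w 0 j.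
Proof.
rewrite /bilin mxE; apply: eq_bigr => j _; rewrite !mxE mulr_suml.
by apply: eq_bigr => i _; rewrite !ord1.
Qed.

Lemma bilinBl G G' v w : bilin (G - G') v w = bilin G v w - bilin G' v w.
Proof. by rewrite /bilin mulmxBr mulmxBl !mxE. Qed.

Lemma bilinZ G (c : R) v : bilin G (c *: v) (c *: v) = c ^+ 2 * bilin G v v.
Proof. by rewrite /bilin -!scalemxAl linearZ/= -scalemxAr !mxE expr2 mulrA. Qed.

Lemma norm_bilin_le G v : `|bilin G v v| <= n%:R ^+ 2 * `|G| * `|v| ^+ 2.
Proof.
have sum_cst (c : R) : \sum_(j < n) c = n%:R * c.
  by rewrite sumr_const card_ord -[c *+ n]mulr_natl.
rewrite bilinE; apply: le_trans (ler_norm_sum _ _ _) _.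
apply: le_trans (_ : \sum_(j < n) n%:R * (`|G| * `|v| ^+ 2) <= _); last first.
  by rewrite sum_cst expr2 !mulrA.
apply: ler_sum => j _; apply: le_trans (ler_norm_sum _ _ _) _.
apply: le_trans (_ : \sum_(i < n) (`|G| * `|v| ^+ 2) <= _); last first.
  by rewrite sum_cst.
apply: ler_sum => i _; rewrite !normrM expr2 mulrAC mulrC.
by rewrite ler_pM ?mulr_ge0// ?entry_le_norm// ler_pM// entry_le_norm.
Qed.

Lemma posdef_lower_bound G : (forall v, v != 0 -> 0 < bilin G v v) ->
  exists2 m, 0 < m & forall v, m * `|v| ^+ 2 <= bilin G v v.
Proof.
move=> Gpos; pose K := [set v : 'rV[R]_n | `|v| = 1].
have cK : compact K.
  apply: bounded_closed_compact.
    by exists 1; split; [exact: num_real|move=> x x1 v /= ->; exact: ltW].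
  have -> : K = (fun v : 'rV[R]_n => `|v|) @^-1` [set 1] by [].
  have c1 : closed [set (1 : R)] by exact/accessible_closed_set1/hausdorff_accessible/Rhausdorff.
  by apply: preimage_closed c1 => v _; exact: (@norm_continuous R 'rV[R]_n v).
have cb : continuous (fun v => bilin G v v).
  by move=> v; apply: (@cvg_bilin R _ (nbhs v) n (fun=> G) id id G v v) => //; exact: cvg_cst.
(* The unit sphere is empty in dimension 0, where every vector vanishes; otherwise the minimum of
   the form on the sphere is the constant. *)
have [K0|/set0P K0] := eqVneq K set0.
  exists 1 => // v; have [->|v0] := eqVneq v 0.
    by rewrite normr0 expr0n mulr0 /bilin !mul0mx mxE.
  exfalso; have : K (`|v|^-1 *: v).
    by rewrite /K/= normrZ normfV normr_id mulVf// normr_eq0.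
  by rewrite K0.
have [|v0 /set_mem v0K v0min] := EVT_min_rV K0 cK (f := fun v => bilin G v v).
  exact: continuous_subspaceT.
have v00 : v0 != 0 by rewrite -normr_eq0 v0K oner_eq0.
exists (bilin G v0 v0) => [|v]; first exact: Gpos.
have [->|v_neq0] := eqVneq v 0.
  by rewrite normr0 expr0n mulr0 /bilin !mul0mx mxE.
have nv0 : 0 < `|v| by rewrite normr_gt0.
have /v0min : `|v|^-1 *: v \in K.
  by apply/mem_set; rewrite /K/= normrZ normfV normr_id mulVf// gt_eqF.
by rewrite bilinZ exprVn mulrC ler_pdivlMr// exprn_gt0.
Qed.

End Bilin.

Lemma Ck1P (R : realType) (E V : normedModType R) (D : set E) (f : E -> V) :
  open D -> Ck 1 D f <->
  [/\ forall x, D x -> {for x, continuous f},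
      forall x, D x -> differentiable f x &
      forall v x, D x -> {for x, continuous (fun y => 'd f y v)}].
Proof.
move=> oD; split => [[/(within_openP _ oD) cf [df Cf]]|[cf df Cf]].
  split => // v x Dx.
  by have [/(within_openP _ oD) h _] := Cf v; exact: h.
split; first exact/within_openP.
by split => // v; split => //; exact/within_openP/Cf.
Qed.

(** * Charts, Gram norms and speeds of curves *)

Section Charts.
Variables (R : realType) (n : nat) (M : topologicalType).
Variable X : riemannian_manifold R n M.
Implicit Types (i j : chart X) (x : M).
Local Notation cdom := chart_dom.
Local Notation coord := (@chart_coord R n M X).
Local Notation param := (@chart_param R n M X).
Local Notation gram := (@chart_gram R n M X).

Definition chart_image i : set 'rV[R]_n := coord i @` cdom i.

Lemma coord_in_image i x : cdom i x -> chart_image i (coord i x).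
Proof. by move=> ix; exists x. Qed.

Lemma param_in_dom i y : chart_image i y -> cdom i (param i y).
Proof. by move=> [x ix <-]; rewrite coordK. Qed.

Lemma paramK i y : chart_image i y -> coord i (param i y) = y.
Proof. by move=> [x ix <-]; rewrite coordK. Qed.

Lemma coord_cvg i x : cdom i x -> {for x, continuous (coord i)}.
Proof. by move: x; apply/(within_openP _ (@dom_open R n M X i)); exact: Defs.coord_continuous. Qed.

Lemma param_cvg i y : chart_image i y -> {for y, continuous (param i)}.
Proof.
by rewrite /chart_image; move: y; apply/(within_openP _ (@im_open R n M X i));
  exact: param_continuous.
Qed.

Lemma gram_cvg i y : chart_image i y -> {for y, continuous (gram i)}.
Proof.
by rewrite /chart_image; move: y; apply/(within_openP _ (@im_open R n M X i));
  have [] := gram_smooth i 0.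
Qed.

Lemma nbhs_dom i x : cdom i x -> nbhs x (cdom i).
Proof. by move=> ix; apply: open_nbhs_nbhs; split => //; exact: dom_open. Qed.

Lemma nbhs_image i y : chart_image i y -> nbhs y (chart_image i).
Proof. by move=> iy; apply: open_nbhs_nbhs; split => //; exact: im_open. Qed.

Lemma overlap_open i j : open (coord i @` (cdom i `&` cdom j)).
Proof.
rewrite openE => _ [x [ix jx] <-].
have iy := coord_in_image ix.
have : nbhs (coord i x) (param i @^-1` cdom j).
  by apply: (param_cvg iy); rewrite coordK//; exact: nbhs_dom.
move=> /filterI /(_ (nbhs_image iy)); apply: filterS => y [jy iy'].
by exists (param i y); [split => //; exact: param_in_dom|rewrite paramK].
Qed.

Definition change i j : 'rV[R]_n -> 'rV[R]_n := coord j \o param i.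

Lemma change_diff i j x : cdom i x -> cdom j x ->
  differentiable (change i j) (coord i x) /\
  forall v, {for coord i x, continuous (fun y => 'd (change i j) y v)}.
Proof.
move=> ix jx; have /(Ck1P _ (@overlap_open i j)) [_ d c] := transition_smooth i j 1.
have xD : (coord i @` (cdom i `&` cdom j)) (coord i x) by exists x.
by split => [|v]; [exact: d|exact: c].
Qed.

Definition gram_norm i (y v : 'rV[R]_n) : R := Num.sqrt (bilin (gram i y) v v).

Lemma tangent_normE i x v : cdom i x ->
  tangent_norm X x v =
  gram_norm i (coord i x) ('d (change (chart_at X x) i) (coord (chart_at X x) x) v).
Proof.
move=> ix; rewrite /tangent_norm /gram_norm /tangent_inner.
by rewrite (gram_transition v v (chart_atP X x) ix).
Qed.

Lemma gram_norm_bounds i x : cdom i x -> exists m K : R, [/\ 0 < m, 0 < K &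
  \forall y \near coord i x, forall v,
    m * `|v| <= gram_norm i y v /\ gram_norm i y v <= K * `|v|].
Proof.
move=> ix; have iy := coord_in_image ix; pose G0 := gram i (coord i x).
have [m m0 mG] := posdef_lower_bound (fun v => @gram_pos R n M X i x v ix).
(* [c] exceeds the factor of [norm_bilin_le] and is positive even in dimension 0. A change of the
   Gram matrix by at most [m / (2 * c)] costs half of the lower bound [m] at [x]. *)
pose c : R := n%:R ^+ 2 + 1; have c0 : 0 < c by rewrite ltr_wpDl// exprn_ge0.
have d0 : 0 < m / (2 * c) by rewrite divr_gt0// mulr_gt0.
exists (Num.sqrt (m / 2)), (Num.sqrt (c * (`|G0| + m / (2 * c)))); split.
- by rewrite sqrtr_gt0 divr_gt0.
- by rewrite sqrtr_gt0 mulr_gt0// ltr_wpDl.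
have /cvgrPdist_le /(_ _ d0) := gram_cvg iy.
apply: filterS => y hy v.
have sqrtM (a : R) : 0 <= a -> Num.sqrt a * `|v| = Num.sqrt (a * `|v| ^+ 2).
  by move=> a0; rewrite sqrtrM// sqrtr_sqr normr_id.
rewrite !sqrtM; last 2 first.
- by rewrite ltW// mulr_gt0// ltr_wpDl.
- by rewrite ltW// divr_gt0.
have v2 : 0 <= `|v| ^+ 2 by rewrite exprn_ge0.
have nc : n%:R ^+ 2 <= c :> R by rewrite lerDl.
split; apply: ler_wsqrtr.
  have := mG v; have := norm_bilin_le (gram i (coord i x) - gram i y) v.
  rewrite bilinBl ler_norml => /andP[_ h1] h2.
  have : n%:R ^+ 2 * `|gram i (coord i x) - gram i y| * `|v| ^+ 2 <= m / 2 * `|v| ^+ 2.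
    rewrite ler_wpM2r//; apply: le_trans (_ : c * (m / (2 * c)) <= _).
      by rewrite ler_pM// exprn_ge0.
    by rewrite le_eqVlt; apply/orP; left; apply/eqP; field; rewrite gt_eqF.
  move: h1 h2; set a := bilin _ _ _; set b := bilin _ _ _; set e := _ * _ * _ => h1 h2 h3.
  have -> : m / 2 * `|v| ^+ 2 = m * `|v| ^+ 2 - m / 2 * `|v| ^+ 2 by field.
  lra.
apply: le_trans (ler_norm _) _; apply: le_trans (norm_bilin_le _ _) _.
rewrite ler_wpM2r// ler_pM// ?exprn_ge0//.
have -> : gram i y = G0 - (G0 - gram i y) by rewrite subKr.
by apply: le_trans (ler_normB _ _) _; rewrite lerD2l.
Qed.

Definition speed (g : R -> M) (t : R) : R := tangent_norm X (g t) (velocity X g t).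

Lemma curve_chart_diff (g : R -> M) i t : C1_curve X g -> cdom i (g t) ->
  differentiable (coord i \o g) t /\
  forall v, {for t, continuous (fun s => 'd (coord i \o g) s v)}.
Proof.
move=> [cg Cg] it; have oD : open (g @^-1` cdom i).
  by apply: open_comp; [move=> s _; exact: cg|exact: dom_open].
have [_ d c] := (Ck1P _ oD).1 (Cg i).
by split => [|v]; [exact: d|exact: c].
Qed.

Lemma curve_near_dom (g : R -> M) i t : continuous g -> cdom i (g t) ->
  \forall s \near t, cdom i (g s).
Proof. by move=> cg it; apply: (cg t); exact: nbhs_dom. Qed.

(** [velocity] is read in the chart attached to [g t], which may jump with [t]. In one fixed chart
    the speed becomes a visibly continuous expression. *)
Lemma speedE (g : R -> M) i t : C1_curve X g -> cdom i (g t) ->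
  speed g t = gram_norm i (coord i (g t)) ('d (coord i \o g) t 1).
Proof.
move=> Cg it; have [cg _] := Cg; set j := chart_at X (g t).
have jt : cdom j (g t) := chart_atP X (g t).
have [dj _] := curve_chart_diff Cg jt; have [dc _] := change_diff jt it.
rewrite /speed (tangent_normE _ it) -/j /velocity -/j derive1E'//; congr gram_norm.
have fg : \forall s \near t, (change j i \o (coord j \o g)) s = (coord i \o g) s.
  by apply: filterS (curve_near_dom cg jt) => s js; rewrite /change/= coordK.
have [_ dE] := near_eq_diff fg (differentiable_comp dj dc).
have e1 := congr1 (fun f : R -> 'rV[R]_n => f 1) dE.
have e2 := congr1 (fun f : R -> 'rV[R]_n => f 1) (diff_comp dj dc).
exact: esym (etrans e1 e2).
Qed.

Lemma speed_continuous (g : R -> M) : C1_curve X g -> continuous (speed g).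
Proof.
move=> Cg t; have [cg _] := Cg; set i := chart_at X (g t).
have it : cdom i (g t) := chart_atP X (g t).
have sE : \forall s \near t, gram_norm i (coord i (g s)) ('d (coord i \o g) s 1) = speed g s.
  by apply: filterS (curve_near_dom cg it) => s si; rewrite (speedE Cg si).
apply: cvg_trans (near_eq_cvg sE) _; rewrite (speedE Cg it).
have [d c] := curve_chart_diff Cg it.
have dt : {for t, continuous (coord i \o g)} by exact: differentiable_continuous.
apply: (@cvg_comp _ _ _ (fun s => bilin (gram i (coord i (g s))) ('d (coord i \o g) s 1)
  ('d (coord i \o g) s 1)) (@Num.sqrt R)); last exact: sqrt_continuous.
apply: cvg_bilin; [|exact: c|exact: c].
by apply: (@cvg_comp _ _ _ (coord i \o g) (gram i) _ _ _ dt);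
  apply: gram_cvg; exact: coord_in_image.
Qed.

End Charts.

(** * Calculus in one variable *)

Lemma is_derive_quadratic_error (R : realType) (f : R -> R) a l K :
  (forall h, `|f (a + h) - f a - l * h| <= K * h ^+ 2) -> is_derive a 1 f l.
Proof.
move=> fK.
have lim_f : (fun h => h^-1 *: ((f \o shift a) (h *: 1) - f a)) @ (0 : R)^' --> l.
  apply/cvgrPdist_le => e e0; near=> h.
  have h0 : h != 0 by near: h; exact: nbhs_dnbhs_neq.
  have hK : (`|K| + 1) * `|h| <= e.
    rewrite mulrC -ler_pdivlMr ?ltr_wpDl//; near: h; apply: dnbhs0_le.
    by rewrite divr_gt0// ltr_wpDl.
  apply: le_trans hK; rewrite distrC.
  have -> : (f \o shift a) (h *: 1) = f (a + h) by rewrite /= [h *: 1]mulr1 addrC.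
  have -> : h^-1 *: (f (a + h) - f a) - l = h^-1 * (f (a + h) - f a - l * h).
    by rewrite [h^-1 *: _]/(_ * _) mulrBr mulrCA mulVf// mulr1.
  rewrite normrM normfV mulrC ler_pdivrMr ?normr_gt0//.
  apply: le_trans (fK h) _; rewrite -mulrA -expr2 real_normK ?num_real//.
  by rewrite ler_wpM2r ?sqr_ge0// (le_trans (ler_norm _))// lerDl.
apply: DeriveDef; first by apply/cvg_ex; exists l.
exact: cvg_lim lim_f.
Unshelve. all: by end_near. Qed.

(** Squaring removes the kink of the maximum at 0, which is why the bump function below is a squared
    positive part. *)
Lemma is_derive_sqr_maxr (R : realType) (a : R) :
  is_derive a 1 (fun s => Num.max 0 s ^+ 2) (2 * Num.max 0 a).
Proof.
apply: (@is_derive_quadratic_error _ _ _ _ 1) => h; rewrite mul1r.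
have h2 := sqr_ge0 h; rewrite ler_norml.
by case: (leP 0 a) => a0; case: (leP 0 (a + h)) => ah; apply/andP; split; nra.
Qed.

Lemma continuous_primitive (R : realType) (f : R -> R) : continuous f ->
  exists2 F : R -> R, forall x : R, -1 < x < 2 -> is_derive x 1 F (f x) &
    \int[lebesgue_measure]_(x in `[0, 1]) f x = F 1 - F 0.
Proof.
(* Integrating from -1 makes 0 and 1 interior points, so the one-sided limits required there follow
   from continuity. *)
move=> cf; pose F x := \int[lebesgue_measure]_(t in `[(-1 : R), x]) f t.
have Fd (x : R) : -1 < x < 2 -> is_derive x 1 F (f x).
  move=> /andP[x1 x2].
  have [|dF FE] := @continuous_FTC1_closed R f (-1) x 2 x2 _ x1 (cf x).
    apply: continuous_compact_integrable; first exact: segment_compact.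
    exact: continuous_subspaceT.
  by apply: DeriveDef; [exact: dF|rewrite -derive1E; exact: FE].
exists F => //.
have cF (x : R) : -1 < x < 2 -> {for x, continuous F}.
  by move=> /Fd [dF _]; apply: differentiable_continuous; exact/derivable1_diffP.
rewrite /Rintegral (@continuous_FTC2 R f F 0 1)//.
- exact: continuous_subspaceT.
- split.
  + move=> x; rewrite in_itv/= => /andP[x0 x1].
    by have [] : is_derive x 1 F (f x) by apply: Fd; apply/andP; split; lra.
  + by apply: cvg_at_right_filter; apply: cF; apply/andP; split; lra.
  + by apply: cvg_at_left_filter; apply: cF; apply/andP; split; lra.
- move=> x; rewrite in_itv/= => /andP[x0 x1]; rewrite derive1E.
  by have [] : is_derive x 1 F (f x) by apply: Fd; apply/andP; split; lra.
Qed.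

(** The derivative of [f] is not known to be integrable, so [f] is not recovered by integration.
    With [F] a primitive of [s] and c = 1 or c = -1, the function [C * F - c * f] has nonnegative
    derivative, and the mean value theorem compares its values at 0 and 1. *)
Lemma dist_le_integral (R : realType) (f s : R -> R) (C : R) : continuous s ->
  (forall t : R, exists2 h : R, is_derive t 1 f h & `|h| <= C * s t) ->
  `|f 1 - f 0| <= C * \int[lebesgue_measure]_(x in `[0, 1]) s x.
Proof.
move=> cs fs; have [F Fd ->] := continuous_primitive cs.
pose df t := projT1 (cid2 (fs t)).
have dfP (t : R) : is_derive t 1 f (df t) by rewrite /df; case: cid2.
have dfs (t : R) : `|df t| <= C * s t by rewrite /df; case: cid2.
have cont_der (k dk : R -> R) (x : R) : is_derive x 1 k (dk x) -> {for x, continuous k}.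
  by move=> [dk' _]; apply: differentiable_continuous; exact/derivable1_diffP.
have in01 (x : R) : x \in `[0, 1]%R -> -1 < x < 2.
  by rewrite in_itv/= => /andP[x0 x1]; apply/andP; split; lra.
have mvt (c : R) : `|c| = 1 -> c * (f 1 - f 0) <= C * (F 1 - F 0).
  move=> c1; pose k := (fun=> C) * F - (fun=> c) * f.
  have kd (x : R) : -1 < x < 2 -> is_derive x 1 k (C * s x - c * df x).
    move=> /Fd Fx; have fx := dfP x; apply: is_derive_eq.
    by rewrite /= !scaler0 !addr0.
  have [|||x x01] := @MVT_segment R k (fun x => C * s x - c * df x) 0 1.
  - by rewrite ler01.
  - by move=> x; rewrite in_itv/= => /andP[x0 x1]; apply: kd; apply/andP; split; lra.
  - apply: derivable_within_continuous => x x01.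
    by have [] := kd x (in01 x x01).
  - rewrite /k -![(_ - _ : R -> R) _]/(_ - _) -![(_ * _ : R -> R) _]/(_ * _) subr0 mulr1.
    move=> kE; have : 0 <= C * s x - c * df x.
      rewrite subr_ge0; apply: le_trans (dfs x); apply: le_trans (ler_norm _) _.
      by rewrite normrM c1 mul1r.
    rewrite -kE; lra.
rewrite ler_norml; apply/andP; split.
  by have := mvt (-1); rewrite normrN1 => /(_ erefl); lra.
by have := mvt 1; rewrite normr1 => /(_ erefl); lra.
Qed.

Section SquaredDistance.
Variables (R : realType) (n : nat) (c : 'rV[R]_n).

(** The norm on row vectors is the maximum norm, which is not differentiable; the bump function
    needs a smooth radial variable. *)
Definition sqdist (y : 'rV[R]_n) : R := \sum_k (y 0 k - c 0 k) ^+ 2.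

Lemma sqdist_ge0 y : 0 <= sqdist y.
Proof. by apply: sumr_ge0 => k _; exact: sqr_ge0. Qed.

Lemma sqdist_center : sqdist c = 0.
Proof. by rewrite /sqdist big1// => k _; rewrite subrr expr0n. Qed.

Lemma entry_sqr_le_sqdist (y : 'rV[R]_n) k : (y 0 k - c 0 k) ^+ 2 <= sqdist y.
Proof. by rewrite /sqdist (bigD1 k)//= lerDl; apply: sumr_ge0 => j _; exact: sqr_ge0. Qed.

Lemma norm_le_of_sqdist r (y : 'rV[R]_n) : 0 <= r -> sqdist y <= r ^+ 2 -> `|y - c| <= r.
Proof.
move=> r0 yr; apply: norm_le_entries => // i k; rewrite !mxE ord1.
rewrite -[leRHS](ger0_norm r0) -!sqrtr_sqr ler_wsqrtr//.
exact: le_trans (entry_sqr_le_sqdist y k) yr.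
Qed.

Lemma sqdist_continuous : continuous sqdist.
Proof.
move=> y; apply: (@cvg_sumr R _ _ _ _ (fun k (z : 'rV[R]_n) => (z 0 k - c 0 k) ^+ 2)
  (fun k => (y 0 k - c 0 k) ^+ 2) (nbhs_filter y)) => k.
have h : (fun z : 'rV[R]_n => z 0 k - c 0 k) @ nbhs y --> y 0 k - c 0 k.
  by apply: cvgB; [exact: coord_continuous|exact: cvg_cst].
exact: (cvgM h h).
Qed.

Lemma is_derive_entry (y : R -> 'rV[R]_n) t k : differentiable y t ->
  is_derive t 1 (fun s => y s 0 k) ('d y t 1 0 k).
Proof.
move=> dy; have dv : derivable y t 1 by exact: diff_derivable.
apply: DeriveDef; first exact: ((derivable_mxP _ _ _).1 dv).
by rewrite -deriveE// derive_mx// mxE.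
Qed.

Lemma is_derive_sqdist (y : R -> 'rV[R]_n) (t : R) : differentiable y t ->
  is_derive t 1 (sqdist \o y)
    (\sum_k 2 * (y t 0 k - c 0 k) * 'd y t 1 0 k).
Proof.
move=> dy; have -> : sqdist \o y = \sum_k (fun s => (y s 0 k - c 0 k) ^+ 2).
  by apply/funext => s; rewrite fct_sumE.
apply: is_derive_sum => k; have dk := is_derive_entry k dy.
pose f := (fun s : R => y s 0 k) - (fun=> c 0 k).
have df : is_derive t 1 f ('d y t 1 0 k) by apply: is_derive_eq; rewrite subr0.
have -> : (fun s => (y s 0 k - c 0 k) ^+ 2) = f * f.
  by apply/funext => s; rewrite expr2.
apply: is_derive_eq; rewrite -[f t]/(y t 0 k - c 0 k).
rewrite -![_ *: _]/(_ * _); ring.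
Qed.

End SquaredDistance.

(** * Riemannian distance *)

Section Distance.
Variables (R : realType) (n : nat) (M : topologicalType).
Variable X : riemannian_manifold R n M.
Local Notation cdom := (@chart_dom R n M X).
Local Notation coord := (@chart_coord R n M X).
Local Notation param := (@chart_param R n M X).

(* H is max(0, r^2 - |y - y0|^2)^2 in a chart y centered at x, extended by 0. *)
Lemma exists_bump (x : M) (V : set M) : nbhs x V ->
  exists (H : M -> R) (C : R), [/\ 0 < C, 0 < H x, {for x, continuous H},
    forall p, ~ V p -> H p = 0 &
    forall g, C1_curve X g -> forall t : R,
      exists2 h : R, is_derive t 1 (H \o g) h & `|h| <= C * speed X g t].
Proof.
move=> xV; set i := chart_at X x; have ix : cdom i x := chart_atP X x.
have iy := coord_in_image ix; set y0 := coord i x in iy.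
have [m [K [m0 K0 mK]]] := gram_norm_bounds ix.
have : nbhs y0 (chart_image i `&` param i @^-1` V `&`
    [set y | forall v, m * `|v| <= gram_norm i y v]).
  apply: filterI; first apply: filterI; first exact: nbhs_image.
    by apply: (param_cvg iy); rewrite coordK.
  by apply: filterS mK => y h v; have [] := h v.
move=> /nbhs_ballP[e /= e0 eB]; pose r := e / 2; have r0 : 0 < r by rewrite divr_gt0.
have inB y : sqdist y0 y <= r ^+ 2 -> chart_image i y /\ V (param i y) /\
    forall v, m * `|v| <= gram_norm i y v.
  move=> /(norm_le_of_sqdist (ltW r0)) yr.
  have /eB[[]] : ball y0 e y.
    by rewrite -ball_normE/= distrC (le_lt_trans yr)// /r ltr_pdivrMr// ltr_pMr// ltr1n.
  by [].
pose H p := if `[< cdom i p >] then Num.max 0 (r ^+ 2 - sqdist y0 (coord i p)) ^+ 2 else 0.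
have HE p : cdom i p -> H p = Num.max 0 (r ^+ 2 - sqdist y0 (coord i p)) ^+ 2.
  by move=> ip; rewrite /H asboolT.
have H0 p : ~ V p -> H p = 0.
  move=> nVp; rewrite /H; case: asboolP => // ip.
  rewrite (_ : Num.max _ _ = 0) ?expr0n//; apply/max_idPl; rewrite subr_le0 leNgt.
  apply/negP => /ltW /inB[_ [+ _]]; rewrite coordK//.
(* [Kc] contains the support of [H]. It is compact, hence closed in the Hausdorff space [M], so [H]
   vanishes along a curve near every time at which the curve is outside the chart. *)
pose Kc := param i @` [set y | sqdist y0 y <= r ^+ 2].
have cKc : closed Kc.
  apply: compact_closed; first exact: (manifold_hausdorff X).
  apply: continuous_compact.
    apply/subspace_continuousP => y /inB[iy' _].
    by apply: cvg_within_filter; exact: param_cvg.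
  apply: bounded_closed_compact.
    exists (r + `|y0|); split; first exact: num_real.
    move=> b rb y /(norm_le_of_sqdist (ltW r0)) yr; apply: le_trans (ltW rb).
    by rewrite -[y](subrK y0) (le_trans (ler_normD _ _))// lerD2r.
  have : closed [set s : R | s <= r ^+ 2] by exact: closed_le.
  by apply: preimage_closed => y _; exact: sqdist_continuous.
have H_out p : ~ Kc p -> H p = 0.
  move=> nKp; rewrite /H; case: asboolP => // ip.
  rewrite (_ : Num.max _ _ = 0) ?expr0n//; apply/max_idPl; rewrite subr_le0 leNgt.
  by apply/negP => /ltW pr; apply: nKp; exists (coord i p) => //; rewrite coordK.
(* Product of three bounds: [2 * r ^ 2] for the outer derivative, [n * (2 * r)] for the gradient of
   [sqdist], and [1 / m] to pass from coordinate speed to Riemannian speed. The 1 added below keeps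
   the constant positive in dimension 0. *)
pose C0 := 4 * r ^+ 3 * n%:R / m.
have C00 : 0 <= C0.
  by rewrite /C0 divr_ge0 ?(ltW m0)// mulr_ge0// mulr_ge0// exprn_ge0// ltW.
have sqr_max_cont (a : R) : {for a, continuous (fun s : R => Num.max 0 s ^+ 2)}.
  have [da _] := is_derive_sqr_maxr a.
  by apply: differentiable_continuous; exact/derivable1_diffP.
exists H, (C0 + 1); split => //.
- by rewrite ltr_wpDl.
- by rewrite HE// sqdist_center subr0 exprn_gt0// lt_max exprn_gt0 ?orbT.
- have hE : \forall p \near x, Num.max 0 (r ^+ 2 - sqdist y0 (coord i p)) ^+ 2 = H p.
    by apply: filterS (nbhs_dom ix) => p ip; rewrite HE.
  apply: cvg_trans (near_eq_cvg hE) _; rewrite HE//.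
  apply: (@cvg_comp _ _ _ (fun p => r ^+ 2 - sqdist y0 (coord i p))
    (fun s : R => Num.max 0 s ^+ 2)); last exact: sqr_max_cont.
  apply: cvgB; first exact: cvg_cst.
  apply: (@cvg_comp _ _ _ (coord i) (sqdist y0)); first exact: coord_cvg.
  exact: sqdist_continuous.
move=> g Cg t; have [cg _] := Cg.
have speed0 : 0 <= speed X g t by exact: sqrtr_ge0.
have [it|nit] := pselect (cdom i (g t)); last first.
  exists 0; last by rewrite normr0 mulr_ge0// addr_ge0.
  have d0 : is_derive t (1 : R) (cst (0 : R)) (0 : R) by exact: is_derive_cst.
  apply: near_eq_is_derive d0.
  have : nbhs (g t) (~` Kc).
    apply: open_nbhs_nbhs; split; first exact: closed_openC.
    by move=> [y /inB[iy' _] yg]; apply: nit; rewrite -yg; exact: param_in_dom.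
  move=> gnK; have nK : \forall s \near t, ~ Kc (g s) by exact: (cg t _ gnK).
  by apply: filterS nK => s ns; rewrite /= H_out.
have [dy _] := curve_chart_diff Cg it; pose y := coord i \o g.
pose D := \sum_k 2 * (y t 0 k - y0 0 k) * 'd y t 1 0 k.
exists ((2 * Num.max 0 (r ^+ 2 - sqdist y0 (y t))) * (0 - D)).
  have dc : is_derive t (1 : R) (cst (r ^+ 2)) (0 : R) by exact: is_derive_cst.
  have dq : is_derive t 1 (sqdist y0 \o y) D by exact: is_derive_sqdist.
  have dsq : is_derive t 1 (cst (r ^+ 2) - (sqdist y0 \o y)) (0 - D).
    exact: is_deriveB.
  have dmax := is_derive_sqr_maxr (r ^+ 2 - sqdist y0 (y t)).
  have dH := @is_derive1_comp R (fun s : R => Num.max 0 s ^+ 2)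
    (cst (r ^+ 2) - (sqdist y0 \o y)) t _ _ dmax dsq.
  apply: near_eq_is_derive dH.
  by apply: filterS (curve_near_dom cg it) => s si; rewrite /= HE.
have [qr|qr] := leP (r ^+ 2) (sqdist y0 (y t)).
  have -> : Num.max 0 (r ^+ 2 - sqdist y0 (y t)) = 0 by apply/max_idPl; rewrite subr_le0.
  by rewrite mulr0 mul0r normr0 mulr_ge0// addr_ge0.
have yr := norm_le_of_sqdist (ltW r0) (ltW qr).
have [_ [_ /(_ ('d y t 1)) my]] := inB _ (ltW qr).
have max_le : Num.max 0 (r ^+ 2 - sqdist y0 (y t)) <= r ^+ 2.
  by rewrite ge_max sqr_ge0/= gerBl sqdist_ge0.
have max_ge : 0 <= Num.max 0 (r ^+ 2 - sqdist y0 (y t)) by rewrite le_max lexx.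
have D_le : `|D| <= n%:R * (2 * r * `|'d y t 1|).
  apply: le_trans (ler_norm_sum _ _ _) _.
  apply: le_trans (_ : \sum_(k < n) (2 * r * `|'d y t 1|) <= _); last first.
    by rewrite sumr_const card_ord -[_ *+ n]mulr_natl.
  apply: ler_sum => k _; rewrite !normrM ger0_norm//.
  rewrite ler_pM// ?mulr_ge0// ?entry_le_norm// ler_wpM2l//.
  by apply: le_trans yr; have := entry_le_norm (y t - y0) 0 k; rewrite !mxE.
rewrite sub0r mulrN normrN normrM (ger0_norm (mulr_ge0 _ max_ge))//.
apply: le_trans (_ : 2 * r ^+ 2 * (n%:R * (2 * r * `|'d y t 1|)) <= _).
  by rewrite ler_pM// ?mulr_ge0// ler_wpM2l.
apply: le_trans (_ : C0 * speed X g t <= _); last by rewrite ler_wpM2r// lerDl.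
rewrite (speedE Cg it).
have -> : 2 * r ^+ 2 * (n%:R * (2 * r * `|'d y t 1|)) = C0 * (m * `|'d y t 1|).
  by rewrite /C0; field; rewrite gt_eqF.
by rewrite ler_wpM2l.
Qed.

End Distance.

Lemma diff_line (R : realType) n (f : R -> R) (a w : 'rV[R]_n) (s l : R) :
  is_derive s 1 f l -> differentiable (fun t => f t *: w + a) s /\
  forall v : R, 'd (fun t => f t *: w + a) s v = (v * l) *: w.
Proof.
move=> df; have df' : differentiable f s by apply/derivable1_diffP; case: df.
have dg : differentiable (fun t => f t *: w + a) s.
  exact: differentiableD (differentiableZl w df') (differentiable_cst a s).
split => // v; set g := fun t => _ in dg *.
have -> : 'd g s v = v *: 'd g s 1 by rewrite -linearZ /= [v *: 1]mulr1.
rewrite -scalerA; congr (_ *: _); apply/rowP => k.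
suff fE : is_derive s 1 (fun t => g t 0 k) ((l *: w) 0 k).
  have [_ <-] := is_derive_entry k dg; exact: (@derive_val _ _ _ _ _ _ _ fE).
have -> : (fun t => g t 0 k) = w 0 k \*: f + cst (a 0 k).
  by apply/funext => t; rewrite /g !mxE mulrC.
by apply: is_derive_eq; rewrite mxE addr0 mulrC.
Qed.

(** * Path lengths and the distance *)

Section Paths.
Variables (R : realType) (n : nat) (M : topologicalType).
Variable X : riemannian_manifold R n M.
Local Notation cdom := (@chart_dom R n M X).
Local Notation coord := (@chart_coord R n M X).
Local Notation param := (@chart_param R n M X).

Lemma curve_length_ge0 g : 0 <= curve_length X g.
Proof. by apply: Rintegral_ge0 => t _; exact: sqrtr_ge0. Qed.

Lemma path_length_ge0 x y l : path_length X x y l -> 0 <= l.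
Proof. by elim=> // g y' l' _ _ l0; rewrite addr_ge0// curve_length_ge0. Qed.

Lemma path_length_trans x y z l l' :
  path_length X x y l -> path_length X y z l' -> path_length X x z (l + l').
Proof.
elim=> [x'|g y' l1 Cg _ ih] yz; first by rewrite add0r.
by rewrite -addrA; apply: path_length_cons => //; exact: ih.
Qed.

Lemma path_length_curve g : C1_curve X g -> path_length X (g 0) (g 1) (curve_length X g).
Proof.
by move=> Cg; rewrite -[curve_length _ _]addr0; apply: path_length_cons => //;
  exact: path_length_nil.
Qed.

Lemma dist_le_path_length (H : M -> R) (C : R) :
  (forall g, C1_curve X g -> forall t : R,
      exists2 h : R, is_derive t 1 (H \o g) h & `|h| <= C * speed X g t) ->
  forall x y l, path_length X x y l -> `|H y - H x| <= C * l.
Proof.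
move=> HC x y l; elim=> [x'|g y' l' Cg _ ih]; first by rewrite subrr normr0 mulr0.
have -> : H y' - H (g 0) = (H y' - H (g 1)) + (H (g 1) - H (g 0)) by rewrite addrA subrK.
rewrite addrC (le_trans (ler_normD _ _))// mulrDr lerD//.
exact: dist_le_integral (speed_continuous Cg) (HC g Cg).
Qed.

(* A chart segment reparametrized by the sine, so that it is defined and stays
   in the chart for all times. *)
Section Segment.
Variables (i : chart X) (a w : 'rV[R]_n).
Let f (s : R) : R := sin (pi / 2 * s).
Let gam (s : R) : 'rV[R]_n := f s *: w + a.
Hypothesis gam_in : forall s, chart_image i (gam s).

Let is_derive_f (s : R) : is_derive s 1 f (pi / 2 * cos (pi / 2 * s)).
Proof.
have h1 : is_derive s 1 (fun t : R => pi / 2 * t) (pi / 2).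
  by apply: is_derive_eq; rewrite [_ *: 1]mulr1.
have := @is_derive1_comp R sin (fun t : R => pi / 2 * t) s _ _ (is_derive_sin _) h1.
by rewrite [cos _ * _]mulrC.
Qed.

Let gam_diff (s : R) : differentiable gam s /\
  forall v : R, 'd gam s v = (v * (pi / 2 * cos (pi / 2 * s))) *: w.
Proof.
exact: diff_line (is_derive_f s).
Qed.

Let gam_cont : continuous gam.
Proof. by move=> s; apply: differentiable_continuous; have [] := gam_diff s. Qed.

Definition segment (s : R) : M := param i (gam s).

Lemma segment_dom s : cdom i (segment s).
Proof. exact: param_in_dom. Qed.

Lemma segment_coord s : coord i (segment s) = gam s.
Proof. exact: paramK. Qed.

Lemma segment_continuous : continuous segment.
Proof.
move=> s; apply: (@cvg_comp _ _ _ gam (param i)); first exact: gam_cont.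
exact: param_cvg.
Qed.

Lemma segment_C1 : C1_curve X segment.
Proof.
split; first exact: segment_continuous.
move=> j; have oD : open (segment @^-1` cdom j).
  by apply: open_comp; [move=> s _; exact: segment_continuous|exact: dom_open].
apply/(Ck1P _ oD).
have dj s : cdom j (segment s) -> differentiable (change i j) (gam s) /\
    forall v, {for gam s, continuous (fun y => 'd (change i j) y v)}.
  by move=> js; have := change_diff (segment_dom s) js; rewrite segment_coord.
split.
- move=> s js; apply: (@cvg_comp _ _ _ segment (coord j)); first exact: segment_continuous.
  exact: coord_cvg.
- by move=> s js; apply: (@differentiable_comp _ _ _ _ gam (change i j));
    [have [] := gam_diff s|have [] := dj s js].
move=> v s js.
have dE t : cdom j (segment t) -> (v * (pi / 2 * cos (pi / 2 * t))) *: 'd (change i j) (gam t) w =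
    'd (coord j \o segment) t v.
  move=> jt; have [dg dgv] := gam_diff t; have [dc _] := dj t jt.
  have := congr1 (fun k : R -> 'rV[R]_n => k v) (diff_comp dg dc).
  by move=> /= e; rewrite -linearZ -dgv; exact: esym e.
have near_dE : \forall t \near s, (v * (pi / 2 * cos (pi / 2 * t))) *: 'd (change i j) (gam t) w =
    'd (coord j \o segment) t v.
  by apply: filterS (curve_near_dom segment_continuous js) => t; exact: dE.
apply: cvg_trans (near_eq_cvg near_dE) _; rewrite -(dE s js).
apply: cvgZ.
  apply: cvgM; first exact: cvg_cst.
  apply: cvgM; first exact: cvg_cst.
  apply: (@cvg_comp _ _ _ (fun t : R => pi / 2 * t) cos); last exact: continuous_cos.
  by apply: cvgM; [exact: cvg_cst|exact: cvg_id].
apply: (@cvg_comp _ _ _ gam (fun y => 'd (change i j) y w)); first exact: gam_cont.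
by have [_] := dj s js; exact.
Qed.

(** The factor 2 bounds [pi / 2], the largest derivative of the sine reparametrization. *)
Lemma segment_speed s (K : R) : 0 <= K ->
  (forall v, gram_norm i (gam s) v <= K * `|v|) ->
  speed X segment s <= K * (2 * `|w|).
Proof.
move=> K0 hK; rewrite (speedE segment_C1 (segment_dom s)) segment_coord.
apply: le_trans (hK _) _; rewrite ler_wpM2l//.
have [dg dgv] := gam_diff s.
have -> : 'd (coord i \o segment) s 1 = 'd gam s 1.
  have [_ e] := near_eq_diff (f := gam) (g := coord i \o segment) (a := s)
    (filterE _ (fun t => esym (segment_coord t))) dg.
  have e1 := congr1 (fun k : R -> 'rV[R]_n => k 1) e; exact: e1.
rewrite dgv mul1r normrZ ler_wpM2r// normrM -[leRHS]mulr1.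
rewrite ler_pM// ?cos_max//.
have /andP[p0 p2] := @pihalf_02 R; rewrite gtr0_norm//; exact: ltW.
Qed.

End Segment.

End Paths.

Lemma connected_clopen_full (T : topologicalType) (B : set T) :
  connected [set: T] -> B !=set0 -> open B -> closed B -> forall x, B x.
Proof.
move=> cT B0 oB cB x; suff -> : B = setT by [].
by apply: cT => //; exists B; rewrite ?setTI.
Qed.

Section RiemannianDistance.
Variables (R : realType) (n : nat) (M : topologicalType).
Variable X : riemannian_manifold R n M.
Local Notation cdom := (@chart_dom R n M X).
Local Notation coord := (@chart_coord R n M X).
Local Notation param := (@chart_param R n M X).

Lemma curve_length_le g (B : R) : C1_curve X g ->
  (forall t, speed X g t <= B) -> curve_length X g <= B.
Proof.
move=> Cg gB.
have -> : B = \int[lebesgue_measure]_(t in `[0, 1]) B.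
  have mu1 : lebesgue_measure `[(0 : R), 1]%classic = 1%E.
    by rewrite lebesgue_measure_itv/= lte_fin ltr01 oppr0 adde0.
  by rewrite Rintegral_cst//= mu1 mulr1.
have int_cont (f : R -> R) : continuous f ->
    lebesgue_measure.-integrable `[0, 1] (EFin \o f).
  move=> cf; apply: continuous_compact_integrable; first exact: segment_compact.
  exact: continuous_subspaceT.
apply: le_Rintegral => //.
- exact: (int_cont _ (speed_continuous Cg)).
- exact: (int_cont _ (@cst_continuous _ _ B)).
- by move=> t _; exact: gB.
Qed.

Lemma short_paths (x : M) (e : R) : 0 < e -> exists2 V : set M, nbhs x V &
  forall y z, V y -> V z -> exists2 l, path_length X y z l & l <= e.
Proof.
move=> e0; set i := chart_at X x; have ix : cdom i x := chart_atP X x.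
have iy := coord_in_image ix; set y0 := coord i x in iy.
have [m [K [m0 K0 mK]]] := gram_norm_bounds ix.
have : nbhs y0 (chart_image i `&` [set y | forall v, gram_norm i y v <= K * `|v|]).
  by apply: filterI; [exact: nbhs_image|apply: filterS mK => y h v; have [] := h v].
move=> /nbhs_ballP[d /= d0 dB].
(* The sine takes values in [-1, 1], so the curve stays within [|w|] of [a], hence within [3 * r] of
   [y0]; its speed is at most [K * (2 * |w|)], hence at most [4 * K * r]. *)
pose r := Num.min (d / 4) (e / (4 * K)).
have r0 : 0 < r by rewrite lt_min !divr_gt0// mulr_gt0.
have r1 : r <= d / 4 by rewrite /r ge_min lexx.
have r2 : r <= e / (4 * K) by rewrite /r ge_min lexx orbT.
exists (cdom i `&` [set y | `|coord i y - y0| < r]).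
  apply: filterI; first exact: nbhs_dom.
  have /cvgr_dist_lt /(_ _ r0) := coord_cvg ix.
  by apply: filterS => y; rewrite distrC.
move=> y z [iy1 yr] [iz1 zr] /=.
pose a := coord i y; pose w := coord i z - a.
have w2 : `|w| <= 2 * r.
  have -> : w = (coord i z - y0) - (a - y0) by rewrite /w opprB addrA subrK.
  by apply: le_trans (ler_normB _ _) _; rewrite mulr_natl mulr2n lerD// ltW.
have gB s : chart_image i (sin (pi / 2 * s) *: w + a) /\
    forall v, gram_norm i (sin (pi / 2 * s) *: w + a) v <= K * `|v|.
  apply: dB; rewrite -ball_normE/= distrC -addrA.
  apply: le_lt_trans (ler_normD _ _) _; rewrite normrZ.
  apply: le_lt_trans (_ : 2 * r + `|a - y0| < d).
    by rewrite lerD2r (le_trans _ w2)// -[leRHS]mul1r ler_wpM2r// sin_max.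
  apply: lt_le_trans (_ : 4 * r <= d); last by rewrite mulrC -ler_pdivlMr.
  have : `|a - y0| < r by []; lra.
have gin s := (gB s).1.
exists (curve_length X (segment i a w)).
  have := path_length_curve (segment_C1 gin).
  have -> : segment i a w 0 = y by rewrite /segment mulr0 sin0 scale0r add0r coordK.
  suff -> : segment i a w 1 = z by [].
  by rewrite /segment mulr1 sin_pihalf scale1r subrK coordK.
apply: curve_length_le => [|t]; first exact: segment_C1.
apply: le_trans (segment_speed gin (ltW K0) (gB t).2) _.
apply: le_trans (_ : K * (2 * (2 * (e / (4 * K)))) <= _).
  rewrite ler_pM2l// ler_pM2l// (le_trans w2)// ler_pM2l//.
by rewrite le_eqVlt; apply/orP; left; apply/eqP; field; rewrite gt_eqF.
Qed.

Lemma rdist_small (x : M) (e : R) : 0 < e -> exists2 V : set M, nbhs x V &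
  forall y z, V y -> V z -> rdist X y z <= e.
Proof.
move=> /(short_paths x)[V xV Vl]; exists V => // y z Vy Vz.
have [l yzl le] := Vl y z Vy Vz; apply: le_trans le; apply: ge_inf => //.
by exists 0 => k /path_length_ge0.
Qed.

Hypothesis M_connected : connected [set: M].

(** The infimum of the empty set is 0, so without a joining path two points would be at distance 0.
    Being joined to [x] is an open and closed condition. *)
Lemma path_connected_manifold (x y : M) : exists l, path_length X x y l.
Proof.
apply: (@connected_clopen_full _ [set y | exists l, path_length X x y l]) => //.
- by exists x; exists 0; exact: path_length_nil.
- rewrite openE => z [l xzl]; have [V zV Vl] := short_paths z (@ltr01 R).
  have Vz := nbhs_singleton zV; apply: filterS zV => v Vv; have [l' zvl' _] := Vl z v Vz Vv.
  by exists (l + l'); exact: path_length_trans zvl'.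
- move=> z cz; have [V zV Vl] := short_paths z (@ltr01 R).
  have [v [[l xvl] Vv]] := cz V zV.
  have [l' vzl' _] := Vl v z Vv (nbhs_singleton zV).
  by exists (l + l'); exact: path_length_trans vzl'.
Qed.

(** The bump function [H] is [C]-Lipschitz for the distance, exceeds [H x / 2] on [W] and vanishes
    outside [V]. Leaving [V] from [W] thus costs more than [H x / (4 * C)], in either direction. *)
Lemma rdist_separates (x : M) (V : set M) : nbhs x V ->
  exists2 W : set M, nbhs x W & exists2 delta : R, 0 < delta &
    forall y z, W y -> rdist X y z <= delta \/ rdist X z y <= delta -> V z.
Proof.
move=> xV; have [H [C [C0 Hx cH HV HC]]] := exists_bump X xV.
have H_lip y z : `|H z - H y| <= C * rdist X y z.
  rewrite mulrC -ler_pdivrMr//; apply: lb_le_inf.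
    by have [l yz] := path_connected_manifold y z; exists l.
  by move=> l yz; rewrite ler_pdivrMr// mulrC; exact: dist_le_path_length HC _ _ _ yz.
exists [set y | H x / 2 < H y].
  by have /cvgr_gt h := cH; apply: (h (H x / 2)); rewrite ltr_pdivrMr// ltr_pMr// ltr1n.
exists (H x / (4 * C)); first by rewrite divr_gt0// mulr_gt0.
move=> y z Wy yz; apply: contrapT => /HV Hz.
have : `|H y| <= H x / 4.
  have -> : H x / 4 = C * (H x / (4 * C)) by field; rewrite gt_eqF.
  case: yz => yz; [have := H_lip y z|have := H_lip z y]; rewrite Hz ?sub0r ?normrN ?subr0;
    by move=> /le_trans; apply; rewrite ler_pM2l.
have := ler_norm (H y); have : H x / 2 < H y by []; lra.
Qed.

End RiemannianDistance.

(** * Fibers *)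

Section FibersNonempty.
Variables (R : realType) (n : nat) (M : topologicalType).
Variables (X : riemannian_manifold R n M) (U : pmetricType R).
Variables (S : control_system X U) (Q : set M).

(* The set of u with nonempty fiber is clopen, hence by connectedness of U it is
   invariant under changing one coordinate. *)
Lemma fiber_nonempty : compact [set: U] -> connected [set: U] -> compact Q ->
  Q !=set0 -> all_time_controlled_invariant S Q -> closed (all_time_lift S Q) ->
  fiber_lower_semicontinuous S Q -> forall u, fiber S Q u !=set0.
Proof.
move=> cU connU cQ [x0 Qx0] ciQ cL lscQ.
pose B := [set u | fiber S Q u !=set0].
have B_closed : closed B.
  have -> : B = fst @` all_time_lift S Q.
    apply/seteqP; split => [u [x Lx]|_ [[u x] Lx <-]]; last by exists x.
    by exists (u, x).
  apply: compact_closed; first exact: controls_hausdorff.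
  apply: continuous_compact; last exact: lift_compact cU cQ cL.
  by apply: continuous_subspaceT => z; exact: continuous_fst.
have B_open : open B.
  rewrite openE => u [x ux]; apply: filterS (lscQ u x ux setT filterT).
  by move=> u' [y [uy _]]; exists y.
pose upd (j : int) (u : controls U) (a : U) : controls U := fun s => if s == j then a else u s.
have B_upd j u a : B u -> B (upd j u a).
  have cupd : continuous (upd j u).
    by apply: continuous_ptws => s; rewrite /upd; case: eqP => _ b; [exact: cvg_id|exact: cvg_cst].
  move=> Bu; apply: (@connected_clopen_full U (upd j u @^-1` B)) => //.
  - exists (u j); rewrite /= (_ : upd j u (u j) = u)//.
    by apply/funext => s; rewrite /upd; case: eqP => [->|].
  - by apply: open_comp => // b _; exact: cupd.
  - by apply: preimage_closed => // b _; exact: cupd.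
move=> u; have [u0 Lu0] := ciQ x0 Qx0.
have Bu0 : B u0 by exists x0.
(* [v k] copies [u] on coordinates of absolute value below [k] and [u0] elsewhere. It arises from
   [u0] by finitely many single changes and tends to [u], while [B] is closed. *)
pose v (k : nat) : controls U := fun s => if (`|s| < k)%N then u s else u0 s.
have Bv k : B (v k).
  elim: k => [|k ih]; first by rewrite (_ : v 0%N = u0).
  have -> : v k.+1 = upd k%:Z (upd (- k%:Z) (v k) (u (- k%:Z))) (u k%:Z).
    apply/funext => s; rewrite /upd /v; case: eqP => [->|sk]; first by rewrite absz_nat ltnSn.
    case: eqP => [->|skN]; first by rewrite abszN absz_nat ltnSn.
    rewrite ltnS leq_eqVlt (_ : (`|s| == k)%N = false)//.
    by apply/negP => /eqP e; case: s sk skN e => s; lia.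
  exact: (B_upd _ _ _ (B_upd _ _ _ ih)).
apply: (@closed_cvg nat (controls U) \oo _ v B B_closed) => //; first by exact: nearW.
apply: cvg_ptws => s; suff : (fun k : nat => v k s) @ \oo --> u s by [].
apply: cvg_near_cst; near=> k; suff : (`|s| < k)%N by rewrite /v => ->.
near: k; exact: nbhs_infty_gt.
Unshelve. all: by end_near.
Qed.

End FibersNonempty.

(** * Unstable Jacobian *)

Lemma gram_mxE (R : realType) m p n (G : 'M[R]_n) (B : 'M[R]_(m, n)) (C : 'M[R]_(p, n)) i j :
  (B *m G *m C^T) i j = bilin G (row i B) (row j C).
Proof. by rewrite /bilin -row_mul !mxE; apply: eq_bigr => l _; rewrite !mxE. Qed.

(** * Orthonormal bases and absolute determinants *)

Section OrthonormalBases.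
Variables (R : realType) (n : nat) (G : 'M[R]_n).
Hypothesis G_sym : G^T = G.
Hypothesis G_pos : forall v : 'rV[R]_n, v != 0 -> 0 < bilin G v v.

Definition tuple_mx k (b : k.-tuple 'rV[R]_n) : 'M[R]_(k, n) := \matrix_i tnth b i.

Definition orthonormal_mx k (B : 'M[R]_(k, n)) : Prop := B *m G *m B^T = 1%:M.

Lemma orthonormal_mxP k (b : k.-tuple 'rV[R]_n) :
  orthonormal_mx (tuple_mx b) <->
  forall i j, bilin G (tnth b i) (tnth b j) = (i == j)%:R.
Proof.
split => [/matrixP e i j|e]; last by apply/matrixP => i j; rewrite gram_mxE !rowK e mxE.
by have := e i j; rewrite gram_mxE !rowK mxE.
Qed.

(** Gram-Schmidt by a dimension count: pairing with the k rows already found maps [E] to a space of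
    dimension k, so it kills a nonzero vector of [E], which is then normalized. *)
Lemma orthonormal_extend (E : {vspace 'rV[R]_n}) k : (k <= \dim E)%N ->
  exists2 B : 'M[R]_(k, n), orthonormal_mx B & forall i, row i B \in E.
Proof.
elim: k => [_|k ih kE]; first by exists 0 => [|[]//]; apply/matrixP => -[].
have [B BB BE] := ih (ltnW kE).
pose f := linfun (mulmxr (G *m B^T) : {linear 'rV[R]_n -> 'rV[R]_k}).
have ker_gt0 : (0 < \dim (E :&: lker f))%N.
  have fk : (\dim (f @: E) <= k)%N.
    by apply: leq_trans (dimvS (subvf _)) _; rewrite dimvf dim_matrix mul1r.
  have dE := limg_ker_dim f E.
  by rewrite -(ltn_add2r (\dim (f @: E))) dE add0n; exact: leq_ltn_trans fk kE.
pose e0 := vpick (E :&: lker f)%VS.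
have e0n : e0 != 0 by rewrite vpick0 -dimv_eq0 -lt0n.
have /[!memv_cap] /andP[e0E] := memv_pick (E :&: lker f)%VS.
rewrite memv_ker lfunE/= => /eqP e0B.
have p0 := G_pos e0n; pose e := (Num.sqrt (bilin G e0 e0))^-1 *: e0.
have ee : e *m G *m e^T = 1%:M.
  apply/matrixP => i j; rewrite !ord1 -[LHS]/(bilin G e e) bilinZ exprVn sqr_sqrtr ?ltW//.
  by rewrite mulVf ?gt_eqF// mxE.
have eB : e *m G *m B^T = 0.
  by rewrite /e -!scalemxAl -mulmxA e0B scaler0.
have Be : B *m G *m e^T = 0.
  by have := congr1 trmx eB; rewrite !trmx_mul G_sym trmx0 trmxK mulmxA.
exists (col_mx e B : 'M[R]_(1 + k, n)); last first.
  move=> i; case: (@split_ordP 1 k i) => j ->; last by rewrite (@rowKd R 1).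
  by rewrite (@rowKu R 1) row_id memvZ.
suff : @orthonormal_mx (1 + k) (col_mx e B) by [].
rewrite /orthonormal_mx tr_col_mx mul_col_mx mul_col_row ee eB Be BB.
by rewrite scalar_mx_block.
Qed.

Lemma orthonormal_basis_of (E : {vspace 'rV[R]_n}) k (b : k.-tuple 'rV[R]_n) :
  orthonormal_mx (tuple_mx b) -> (forall i, tnth b i \in E) -> (\dim E <= k)%N ->
  basis_of E b.
Proof.
move=> bb bE Ek; rewrite basisEfree size_tuple Ek andbT; apply/andP; split.
  apply/freeP => c c0 i; pose r := \row_i c i.
  have rB : r *m tuple_mx b = 0.
    rewrite mulmx_sum_row -[RHS]c0; apply: eq_bigr => j _; rewrite mxE rowK.
    by rewrite (tnth_nth 0).
  have : r = 0 by rewrite -[r]mulmx1 -bb !mulmxA rB !mul0mx.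
  by move=> /rowP /(_ i); rewrite !mxE.
by apply/span_subvP => v /tnthP[i ->].
Qed.

Lemma exists_orthonormal_basis (E : {vspace 'rV[R]_n}) :
  exists b : (\dim E).-tuple 'rV[R]_n, basis_of E b /\
    forall i j, bilin G (tnth b i) (tnth b j) = (i == j)%:R.
Proof.
have [B BB BE] := orthonormal_extend (leqnn (\dim E)).
pose b := [tuple row i B | i < \dim E]; have bE : tuple_mx b = B.
  by apply/row_matrixP => i; rewrite rowK tnth_mktuple.
have bb : orthonormal_mx (tuple_mx b) by rewrite bE.
exists b; split; last exact/orthonormal_mxP.
by apply: orthonormal_basis_of => // i; rewrite tnth_mktuple.
Qed.

Lemma factor_basis (E : {vspace 'rV[R]_n}) k (b : k.-tuple 'rV[R]_n) m (A : 'M[R]_(m, n)) :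
  basis_of E b -> (forall i, row i A \in E) -> exists P, A = P *m tuple_mx b.
Proof.
move=> bE AE; exists (\matrix_(i, j) coord b j (row i A)).
apply/row_matrixP => i; rewrite row_mul mulmx_sum_row {1}(coord_basis bE (AE i)).
by apply: eq_bigr => j _; rewrite !mxE rowK (tnth_nth 0).
Qed.

(** Parseval's identity. It eliminates the target basis from the square of a determinant between two
    orthonormal bases. *)
Lemma gram_parseval (E : {vspace 'rV[R]_n}) k (b : k.-tuple 'rV[R]_n) m (A : 'M[R]_(m, n)) :
  basis_of E b -> orthonormal_mx (tuple_mx b) -> (forall i, row i A \in E) ->
  (A *m G *m (tuple_mx b)^T) *m (A *m G *m (tuple_mx b)^T)^T = A *m G *m A^T.
Proof.
move=> bE bb AE; have [P ->] := factor_basis bE AE; set B := tuple_mx b in bb *.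
have e : P *m B *m G *m B^T = P by rewrite -[P *m B *m G]mulmxA -mulmxA bb mulmx1.
by rewrite e trmx_mul !mulmxA e.
Qed.

Lemma det_orthonormal_change (E : {vspace 'rV[R]_n}) k (b b' : k.-tuple 'rV[R]_n)
    (H : 'M[R]_n) :
  basis_of E b -> orthonormal_mx (tuple_mx b) ->
  basis_of E b' -> orthonormal_mx (tuple_mx b') ->
  \det (tuple_mx b *m H *m (tuple_mx b)^T) = \det (tuple_mx b' *m H *m (tuple_mx b')^T).
Proof.
move=> bE bb b'E bb'; have [|P PE] := factor_basis (A := tuple_mx b') bE.
  by move=> i; rewrite rowK (basis_mem b'E)// mem_tnth.
rewrite PE trmx_mul; set B := tuple_mx b in bb PE *.
have PP : P *m P^T = 1%:M.
  have := bb'; rewrite /orthonormal_mx PE trmx_mul !mulmxA => <-.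
  by rewrite -[P *m B *m G]mulmxA -[P *m _ *m B^T]mulmxA bb mulmx1.
have d1 : \det P * \det P^T = 1 by rewrite -det_mulmx PP det1.
have -> : P *m B *m H *m (B^T *m P^T) = P *m (B *m H *m B^T) *m P^T by rewrite !mulmxA.
by rewrite !det_mulmx mulrAC d1 mul1r.
Qed.

End OrthonormalBases.

Lemma tuple_mxM (R : realType) n k (b : k.-tuple 'rV[R]_n) (A : {linear 'rV[R]_n -> 'rV[R]_n}) i :
  row i (tuple_mx b *m lin1_mx A) = A (tnth b i).
Proof. by rewrite row_mul mul_rV_lin1 rowK. Qed.

Section AbsDet.
Variables (R : realType) (n : nat) (M : topologicalType).
Variable X : riemannian_manifold R n M.

Definition tangent_gram (x : M) : 'M[R]_n :=
  chart_gram (chart_at X x) (chart_coord (chart_at X x) x).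

Lemma tangent_gram_sym x : (tangent_gram x)^T = tangent_gram x.
Proof. exact: gram_sym (chart_atP X x). Qed.

Lemma tangent_gram_pos x (v : 'rV[R]_n) : v != 0 -> 0 < bilin (tangent_gram x) v v.
Proof. by move=> v0; exact: gram_pos (chart_atP X x) v0. Qed.

Lemma orthonormal_basisP x E k (b : k.-tuple 'rV[R]_n) : orthonormal_basis X x E b <->
  basis_of E b /\ orthonormal_mx (tangent_gram x) (tuple_mx b).
Proof.
split => [[bE bb]|[bE bb]]; split => //.
  by apply/orthonormal_mxP.
by move/orthonormal_mxP: bb.
Qed.

Variables (x y : M) (A : {linear 'rV[R]_n -> 'rV[R]_n}) (E F : {vspace 'rV[R]_n}).
Hypothesis AEF : forall v, v \in E -> A v \in F.
Hypothesis dimEF : \dim E = \dim F.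

(** The Gram matrix of the images of [b]. The form in parentheses is independent of [b], so a change
    of orthonormal basis acts by an orthogonal congruence and preserves the determinant. *)
Definition image_gram k (b : k.-tuple 'rV[R]_n) : 'M[R]_k :=
  tuple_mx b *m (lin1_mx A *m tangent_gram y *m (lin1_mx A)^T) *m (tuple_mx b)^T.

Lemma abs_detP : exists k (b : k.-tuple 'rV[R]_n), [/\ orthonormal_basis X x E b,
  abs_det X x y A E F ^+ 2 = \det (image_gram b) & 0 <= abs_det X x y A E F].
Proof.
rewrite /abs_det; set D := [set r | _].
have [|k [b [c [ob oc ->]]]] := @xgetPex R 0 D.
  have [b ob] := exists_orthonormal_basis (tangent_gram_sym x) (@tangent_gram_pos x) E.
  have [c oc] := exists_orthonormal_basis (tangent_gram_sym y) (@tangent_gram_pos y) F.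
  move: b ob; rewrite dimEF => b ob.
  by eexists; exists (\dim F), b, c; split; [exact: ob|exact: oc|reflexivity].
exists k, b; split => //; rewrite real_normK ?num_real// expr2 -{2}det_tr -det_mulmx.
congr (\det _); have [cF cc] := (orthonormal_basisP _ _ _).1 oc.
have [bE _] := ob.
have -> : (\matrix_(i < k, j < k) tangent_inner X y (A (tnth b i)) (tnth c j)) =
    tuple_mx b *m lin1_mx A *m tangent_gram y *m (tuple_mx c)^T.
  by apply/matrixP => i j; rewrite gram_mxE tuple_mxM rowK mxE.
rewrite (gram_parseval cF cc); last first.
  by move=> i; rewrite tuple_mxM; apply: AEF; rewrite (basis_mem bE)// mem_tnth.
by rewrite /image_gram trmx_mul !mulmxA.
Qed.

Lemma abs_detE k (b : k.-tuple 'rV[R]_n) : orthonormal_basis X x E b ->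
  abs_det X x y A E F = Num.sqrt (\det (image_gram b)).
Proof.
move=> ob; have [k' [b' [ob' eb' b'0]]] := abs_detP.
rewrite -[LHS](ger0_norm b'0) -sqrtr_sqr eb'; congr Num.sqrt.
have kk : k' = k by rewrite -(size_basis ob.1) (size_basis ob'.1).
case: _ / kk in b ob *.
have /orthonormal_basisP[bE bb] := ob; have /orthonormal_basisP[b'E bb'] := ob'.
exact: (@det_orthonormal_change _ _ (tangent_gram x) E).
Qed.

(** A kernel vector of the Gram matrix of the images would yield a nonzero vector of [E] whose image
    has norm 0. *)
Lemma abs_det_gt0 : (forall v, v \in E -> A v = 0 -> v = 0) -> 0 < abs_det X x y A E F.
Proof.
move=> Ainj; have [k [b [/orthonormal_basisP[bE bb] eb b0]]] := abs_detP.
rewrite lt_neqAle b0 andbT eq_sym -sqrf_eq0 eb; apply/negP => /det0P[r r0].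
rewrite /image_gram => rb; suff rB : r *m tuple_mx b = 0.
  by move: r0; rewrite -[r]mulmx1 -bb !mulmxA rB !mul0mx eqxx.
apply: Ainj.
  rewrite mulmx_sum_row; apply: memv_suml => i _; rewrite memvZ// rowK.
  by rewrite (basis_mem bE)// mem_tnth.
rewrite -mul_rV_lin1; apply/eqP; apply: contraT => /(@tangent_gram_pos y).
have -> : bilin (tangent_gram y) (r *m tuple_mx b *m lin1_mx A) (r *m tuple_mx b *m lin1_mx A) = 0.
  rewrite /bilin; have := congr1 (fun m => m *m r^T) rb.
  rewrite !trmx_mul !mulmxA mul0mx => ->; exact: mxE.
by rewrite ltxx.
Qed.

End AbsDet.

(** * Chain rule and derivatives along orbits *)

Section ChainRule.
Variables (R : realType) (n : nat) (M : topologicalType).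
Variable X : riemannian_manifold R n M.
Implicit Types (i j k : chart X) (x : M) (g h : M -> M).
Local Notation cdom := (@chart_dom R n M X).
Local Notation coord := (@chart_coord R n M X).
Local Notation param := (@chart_param R n M X).

Definition chart_map i j h : 'rV[R]_n -> 'rV[R]_n := coord j \o h \o param i.

Definition chart_deriv i j h x : {linear 'rV[R]_n -> 'rV[R]_n} :=
  'd (chart_map i j h) (coord i x).

(** Continuity is included because a chart expression represents [h] only as long as [h] stays in
    the target chart. *)
Definition chart_diff h x : Prop := {for x, continuous h} /\
  forall i j, cdom i x -> cdom j (h x) -> differentiable (chart_map i j h) (coord i x).

Lemma chart_deriv_comp i j k h g x :
  cdom i x -> cdom j (h x) -> cdom k (g (h x)) -> chart_diff h x -> chart_diff g (h x) ->
  differentiable (chart_map i k (g \o h)) (coord i x) /\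
  forall v, chart_deriv i k (g \o h) x v = chart_deriv j k g (h x) (chart_deriv i j h x v).
Proof.
move=> ix jhx kghx [ch dh] [cg dg].
have hy : chart_map i j h (coord i x) = coord j (h x) by rewrite /chart_map/= coordK.
have nE : \forall y \near coord i x,
    (chart_map j k g \o chart_map i j h) y = chart_map i k (g \o h) y.
  have : nbhs (coord i x) ((h \o param i) @^-1` cdom j).
    have cp : {for coord i x, continuous (h \o param i)}.
      apply: continuous_comp; first exact: param_cvg (coord_in_image ix).
      by rewrite coordK.
    by apply: cp; rewrite /= coordK//; exact: nbhs_dom.
  by apply: filterS => y jy; rewrite /chart_map/= coordK.
have d1 := dh _ _ ix jhx; have := dg _ _ jhx kghx; rewrite -hy => d2.
have [dgh dE] := near_eq_diff nE (differentiable_comp d1 d2).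
split; first exact: dgh.
move=> v.
have e1 := congr1 (fun f : 'rV[R]_n -> 'rV[R]_n => f v) dE.
have e2 := congr1 (fun f : 'rV[R]_n -> 'rV[R]_n => f v) (diff_comp d1 d2).
by rewrite /chart_deriv -hy; exact: etrans e1 e2.
Qed.

Lemma chart_diff_comp h g x : chart_diff h x -> chart_diff g (h x) -> chart_diff (g \o h) x.
Proof.
move=> dh dg; split; first by apply: continuous_comp; [exact: dh.1|exact: dg.1].
move=> i k ix kghx.
by have [] := @chart_deriv_comp i (chart_at X (h x)) k h g x ix (chart_atP X (h x)) kghx dh dg.
Qed.

Lemma chart_diff_id x : chart_diff id x.
Proof. by split => // i j ix jx; have [] := change_diff ix jx. Qed.

Lemma chart_deriv_id i x v : cdom i x -> chart_deriv i i id x v = v.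
Proof.
move=> ix; have nE : \forall y \near coord i x, id y = chart_map i i id y.
  have := nbhs_image (coord_in_image ix).
  by apply: filterS => y iy; rewrite /chart_map/= paramK.
have did : differentiable (@id 'rV[R]_n) (coord i x) by [].
have [_ dE] := near_eq_diff nE did.
have e1 := congr1 (fun f : 'rV[R]_n -> 'rV[R]_n => f v) dE.
have e2 := congr1 (fun f : 'rV[R]_n -> 'rV[R]_n => f v)
  (@diff_val _ _ _ _ _ _ _ (is_diff_id (coord i x))).
exact: etrans e1 e2.
Qed.

Lemma tangent_map_comp h g x v : chart_diff h x -> chart_diff g (h x) ->
  tangent_map X (g \o h) x v = tangent_map X g (h x) (tangent_map X h x v).
Proof.
move=> dh dg; have [_] := @chart_deriv_comp _ _ _ h g x (chart_atP X x) (chart_atP X (h x))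
  (chart_atP X (g (h x))) dh dg.
exact.
Qed.

Lemma tangent_map_id x v : tangent_map X id x v = v.
Proof. exact: chart_deriv_id (chart_atP X x). Qed.

(* [push i x v] is the tangent vector v at x in the coordinates of the chart i. *)
Definition push i x : {linear 'rV[R]_n -> 'rV[R]_n} := chart_deriv (chart_at X x) i id x.

Lemma push_tangent_map i j h x v : cdom i x -> cdom j (h x) -> chart_diff h x ->
  push j (h x) (tangent_map X h x v) = chart_deriv i j h x (push i x v).
Proof.
move=> ix jhx dh.
have [_ e1] := @chart_deriv_comp _ _ j h id x (chart_atP X x) (chart_atP X (h x)) jhx dh
  (chart_diff_id (h x)).
have [_ e2] := @chart_deriv_comp _ i j id h x (chart_atP X x) ix jhx (chart_diff_id x) dh.
exact: (etrans (esym (e1 v)) (e2 v)).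
Qed.

Lemma tangent_inner_push i x v w : cdom i x -> tangent_inner X x v w =
  bilin (chart_gram i (coord i x)) (push i x v) (push i x w).
Proof. by move=> ix; exact: gram_transition (chart_atP X x) ix. Qed.

Lemma tangent_norm_push i x v : cdom i x ->
  tangent_norm X x v = gram_norm i (coord i x) (push i x v).
Proof. by move=> ix; rewrite (tangent_normE v ix). Qed.

End ChainRule.

Section StepDerivative.
Variables (R : realType) (n : nat) (M : topologicalType).
Variables (X : riemannian_manifold R n M) (U : pmetricType R).
Variable S : control_system X U.
Implicit Types (i j : chart X) (x : M) (a : U).
Local Notation cdom := (@chart_dom R n M X).
Local Notation coord := (@chart_coord R n M X).
Local Notation param := (@chart_param R n M X).

Lemma rhs_continuous_fixed a : continuous (rhs S ^~ a).
Proof.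
move=> x; have := @rhs_continuous _ _ _ _ _ S (x, a).
by apply: (@cvg_comp _ _ _ (fun y => (y, a)) (fun p => rhs S p.1 p.2));
  apply: cvg_pair; [exact: cvg_id|exact: cvg_cst].
Qed.

Lemma rhs_inv_continuous_fixed a : continuous (rhs_inv S a).
Proof.
move=> x; have := @rhs_inv_continuous _ _ _ _ _ S (x, a).
by apply: (@cvg_comp _ _ _ (fun y => (y, a)) (fun p => rhs_inv S p.2 p.1));
  apply: cvg_pair; [exact: cvg_id|exact: cvg_cst].
Qed.

Let step_dom i j : set (U * 'rV[R]_n) :=
  [set p | chart_image i p.2 /\ cdom j (rhs S (param i p.2) p.1)].

Let step_dom_open i j : open (step_dom i j).
Proof.
rewrite openE => -[a y] [/= iy jy].
have c2 : {for (a, y), continuous (fun p : U * 'rV[R]_n => (param i p.2, p.1))}.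
  apply: cvg_pair; last exact: cvg_fst.
  by apply: (@cvg_comp _ _ _ snd (param i)); [exact: cvg_snd|exact: param_cvg].
have c3 : {for (a, y), continuous (fun p : U * 'rV[R]_n => rhs S (param i p.2) p.1)}.
  apply: (@cvg_comp _ _ _ (fun p : U * 'rV[R]_n => (param i p.2, p.1))
    (fun q => rhs S q.1 q.2) _ _ _ c2).
  exact: (@rhs_continuous _ _ _ _ _ S (param i y, a)).
apply: filterI; last by apply: c3; exact: nbhs_dom.
exact: (@continuous_snd U 'rV[R]_n (a, y) _ (nbhs_image iy)).
Qed.

Lemma chart_diff_rhs a x : chart_diff X (rhs S ^~ a) x.
Proof.
split; first exact: rhs_continuous_fixed.
move=> i j ix jx; have [/(_ i j) [_ [d _]] _] := rhs_C1 S.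
by apply: (d (a, coord i x)); split; [exact: coord_in_image|rewrite /= coordK].
Qed.

Lemma chart_diff_rhs_inv a x : chart_diff X (rhs_inv S a) x.
Proof.
split; first exact: rhs_inv_continuous_fixed.
move=> i j ix jx; have [_ /(_ a i j) [_ [d _]]] := rhs_C1 S.
by apply: d; split; [exact: coord_in_image|rewrite coordK].
Qed.

Definition step_mx i j a x : 'M[R]_n := lin1_mx (chart_deriv i j (rhs S ^~ a) x).

Lemma step_mxE i j a x v : v *m step_mx i j a x = chart_deriv i j (rhs S ^~ a) x v.
Proof. exact: mul_rV_lin1. Qed.

Lemma step_mx_cvg i j a x : cdom i x -> cdom j (rhs S x a) ->
  {for (a, x), continuous (fun p => step_mx i j p.1 p.2)}.
Proof.
move=> ix jx; have [/(_ i j) [_ [_ c]] _] := rhs_C1 S.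
have c1 : {for (a, x), continuous (fun p : U * M => (p.1, coord i p.2))}.
  have h1 : {for (a, x), continuous (fun p : U * M => p.1)} by exact: continuous_fst.
  have h2 : {for (a, x), continuous (fun p : U * M => coord i p.2)}.
    by apply: (@cvg_comp _ _ _ snd (coord i)); [exact: cvg_snd|exact: coord_cvg].
  exact: cvg_pair h1 h2.
have Dp : step_dom i j (a, coord i x).
  by split; [exact: coord_in_image|rewrite /= coordK].
apply: cvg_entries => r s.
have [cv _] := c (delta_mx 0 r).
have cvo := (within_openP _ (@step_dom_open i j)).1 cv _ Dp.
have ce := @cvg_entry _ _ _ _ _ _ _ 0 s (nbhs_filter _) cvo.
pose F (p : U * 'rV[R]_n) :=
  'd (fun y : 'rV[R]_n => coord j (rhs S (param i y) p.1)) (p.2) (delta_mx 0 r) 0 s.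
have FE : (fun p => step_mx i j p.1 p.2 r s) = F \o (fun p : U * M => (p.1, coord i p.2)).
  by apply/funext => p; rewrite /step_mx mxE.
rewrite FE; have -> : step_mx i j (a, x).1 (a, x).2 r s = F (a, coord i x).
  by rewrite /step_mx mxE.
exact: (@cvg_comp _ _ _ (fun p : U * M => (p.1, coord i p.2)) F _ _ _ c1 ce).
Qed.

End StepDerivative.

Section OrbitDerivatives.
Variables (R : realType) (n : nat) (M : topologicalType).
Variables (X : riemannian_manifold R n M) (U : pmetricType R).
Variable S : control_system X U.
Implicit Types (s t : nat) (x : M) (u : controls U) (z : controls U * M).

Lemma backward_continuous s :
  continuous (fun z : controls U * M => backward S s z.2 z.1).
Proof.
elim: s => [|s ih]; first exact: continuous_snd.
have h : continuous (fun z : controls U * M => (backward S s z.2 z.1, z.1 (- s.+1%:Z))).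
  apply: continuous_pair; first exact: ih.
  exact: (continuous_compT (@continuous_fst _ _) (@eval_continuous int U (- s.+1%:Z))).
exact: (continuous_compT h (@rhs_inv_continuous _ _ _ _ _ S)).
Qed.

Lemma transition_oppz s x u : transition S (- s%:Z) x u = backward S s x u.
Proof. by case: s. Qed.

Lemma rhs_backwardS s x u : rhs S (backward S s.+1 x u) (u (- s.+1%:Z)) = backward S s x u.
Proof. exact: rhs_invK. Qed.

Lemma backwardK s x u : forward S s (backward S s x u) (shift_by (- s%:Z) u) = x.
Proof.
elim: s => [//|s ih].
have e : forward S 1 (backward S s.+1 x u) (shift_by (- s.+1%:Z) u) = backward S s x u.
  by rewrite -[RHS]rhs_backwardS /= /shift_by add0r.
rewrite -[X in forward S X](add1n s) forwardD e shift_byD -[RHS]ih.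
by congr (forward S s _ (shift_by _ u)); lia.
Qed.

Lemma chart_diff_forward s x u : chart_diff X (forward S s ^~ u) x.
Proof.
elim: s => [|s ih]; first exact: chart_diff_id.
exact: (chart_diff_comp ih (chart_diff_rhs S (u s%:Z) (forward S s x u))).
Qed.

Lemma chart_diff_backward s x u : chart_diff X (backward S s ^~ u) x.
Proof.
elim: s => [|s ih]; first exact: chart_diff_id.
exact: (chart_diff_comp ih (chart_diff_rhs_inv S (u (- s.+1%:Z)) (backward S s x u))).
Qed.

Definition backward_deriv s z : {linear 'rV[R]_n -> 'rV[R]_n} :=
  tangent_map X (backward S s ^~ z.1) z.2.

Lemma transition_deriv_oppz s z v : transition_deriv S (- s%:Z) z v = backward_deriv s z v.
Proof. by case: s. Qed.

Lemma backward_deriv0 z v : backward_deriv 0 z v = v.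
Proof. exact: tangent_map_id. Qed.

Lemma rhs_backward_deriv s z v :
  tangent_map X (rhs S ^~ (z.1 (- s.+1%:Z))) (backward S s.+1 z.2 z.1)
    (backward_deriv s.+1 z v) = backward_deriv s z v.
Proof.
have e := tangent_map_comp v (chart_diff_backward s.+1 z.2 z.1)
  (chart_diff_rhs S (z.1 (- s.+1%:Z)) (backward S s.+1 z.2 z.1)).
have e2 : rhs S ^~ (z.1 (- s.+1%:Z)) \o backward S s.+1 ^~ z.1 = backward S s ^~ z.1.
  by apply/funext => y; exact: rhs_backwardS.
rewrite e2 in e; exact: esym e.
Qed.

Lemma backward_derivS s z v : backward_deriv s.+1 z v =
  tangent_map X (rhs_inv S (z.1 (- s.+1%:Z))) (backward S s z.2 z.1) (backward_deriv s z v).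
Proof.
exact: (tangent_map_comp v (chart_diff_backward s z.2 z.1)
  (chart_diff_rhs_inv S (z.1 (- s.+1%:Z)) (backward S s z.2 z.1))).
Qed.

Lemma rhs_derivK a x v :
  tangent_map X (rhs_inv S a) (rhs S x a) (tangent_map X (rhs S ^~ a) x v) = v.
Proof.
have e := tangent_map_comp v (chart_diff_rhs S a x) (chart_diff_rhs_inv S a (rhs S x a)).
have e2 : rhs_inv S a \o rhs S ^~ a = id by apply/funext => y; exact: rhsK.
rewrite e2 in e; exact: etrans (esym e) (tangent_map_id X x v).
Qed.

Lemma backward_derivK s z v :
  transition_deriv S s%:Z (control_flow S (- s%:Z) z) (backward_deriv s z v) = v.
Proof.
have e := tangent_map_comp v (chart_diff_backward s z.2 z.1)
  (chart_diff_forward s (backward S s z.2 z.1) (shift_by (- s%:Z) z.1)).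
have e2 : forward S s ^~ (shift_by (- s%:Z) z.1) \o backward S s ^~ z.1 = id.
  by apply/funext => y; exact: backwardK.
rewrite e2 in e; rewrite /transition_deriv /control_flow/= transition_oppz.
exact: etrans (esym e) (tangent_map_id X z.2 v).
Qed.

Lemma transition_deriv1_inj z v : transition_deriv S 1 z v = 0 -> v = 0.
Proof.
move=> v0; have e := rhs_derivK (z.1 0) z.2 v.
apply: etrans (esym e) _; apply: etrans (congr1 _ v0) _; exact: linear0.
Qed.

End OrbitDerivatives.

(** * Limits of tangent vectors and of unstable spaces *)

Section TangentLimits.
Variables (R : realType) (n : nat) (M : topologicalType).
Variable X : riemannian_manifold R n M.
Variables (T : Type) (G : set_system T) (p : M) (f : T -> M).
Hypothesis GU : UltraFilter G.
Hypothesis fp : f @ G --> p.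
Local Notation i := (chart_at X p).
Local Notation coord := (@chart_coord R n M X).

Lemma near_chart_at : \forall t \near G, chart_dom i (f t).
Proof. exact: (fp (nbhs_dom (chart_atP X p))). Qed.

Lemma coord_chart_at_cvg : (fun t => coord i (f t)) @ G --> coord i p.
Proof. exact: (@cvg_comp _ _ _ f (coord i) _ _ _ fp (coord_cvg (chart_atP X p))). Qed.

Lemma tangent_inner_cvg (v v' : T -> 'rV[R]_n) w w' :
  (fun t => push i (f t) (v t)) @ G --> w -> (fun t => push i (f t) (v' t)) @ G --> w' ->
  (fun t => tangent_inner X (f t) (v t) (v' t)) @ G --> tangent_inner X p w w'.
Proof.
move=> vw vw'.
have nE : \forall t \near G, bilin (chart_gram i (coord i (f t)))
    (push i (f t) (v t)) (push i (f t) (v' t)) = tangent_inner X (f t) (v t) (v' t).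
  by apply: filterS near_chart_at => t it; rewrite (tangent_inner_push _ _ it).
apply: cvg_trans (near_eq_cvg nE) _; apply: cvg_bilin => //.
apply: (@cvg_comp _ _ _ _ (@chart_gram R n M X i) _ _ _ coord_chart_at_cvg).
by apply: gram_cvg; exact: coord_in_image (chart_atP X p).
Qed.

Lemma tangent_norm_cvg (v : T -> 'rV[R]_n) w :
  (fun t => push i (f t) (v t)) @ G --> w ->
  (fun t => tangent_norm X (f t) (v t)) @ G --> tangent_norm X p w.
Proof.
move=> vw; apply: (@cvg_comp _ _ _ (fun t => tangent_inner X (f t) (v t) (v t)) (@Num.sqrt R)).
  exact: (tangent_inner_cvg vw vw).
exact: sqrt_continuous.
Qed.

(** Near the limit point the Riemannian norm dominates the coordinate norm of one fixed chart, so
    the pushed vectors eventually lie in a compact set and the ultrafilter picks a limit. *)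
Lemma tangent_bounded_cvg (v : T -> 'rV[R]_n) (B : R) :
  (\forall t \near G, tangent_norm X (f t) (v t) <= B) ->
  exists2 w, (fun t => push i (f t) (v t)) @ G --> w & tangent_norm X p w <= B.
Proof.
move=> vB; have [m [K [m0 _ mK]]] := gram_norm_bounds (chart_atP X p).
have bnd : \forall t \near G, `|push i (f t) (v t)| <= B / m.
  have h := coord_chart_at_cvg mK.
  apply: filterS (filterI (filterI near_chart_at h) vB) => t [[it ht] vt].
  rewrite ler_pdivlMr// mulrC (le_trans (ht _).1)//.
  by rewrite -(tangent_norm_push _ it).
have cK : compact [set w : 'rV[R]_n | `|w| <= B / m].
  apply: bounded_closed_compact.
    by exists (B / m); split; [exact: num_real|move=> r Br w wB; exact: le_trans wB (ltW Br)].
  have : closed [set r : R | r <= B / m] by exact: closed_le.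
  by apply: preimage_closed => w _; exact: norm_continuous.
have [w _ vw] := @ultra_cvg_compact T _ G (fun t => push i (f t) (v t)) _ GU cK bnd.
exists w => //.
have cl : closed [set r : R | r <= B] by exact: closed_le.
exact: (@closed_cvg T R G _ (fun t => tangent_norm X (f t) (v t)) _ cl vB _ (tangent_norm_cvg vw)).
Qed.

End TangentLimits.

Section UnstableLimits.
Variables (R : realType) (n : nat) (M : topologicalType).
Variables (X : riemannian_manifold R n M) (U : pmetricType R).
Variables (S : control_system X U) (Q : set M).
Variables Em Ep : controls U * M -> {vspace 'rV[R]_n}.
Local Notation L := (all_time_lift S Q).
Local Notation Phi := (control_flow S).

Lemma tangent_norm_ge0 x (v : 'rV[R]_n) : 0 <= tangent_norm X x v.
Proof. exact: sqrtr_ge0. Qed.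

Lemma tangent_norm_eq0 x (v : 'rV[R]_n) : tangent_norm X x v <= 0 -> v = 0.
Proof.
move=> v0; apply/eqP; apply: contraT => /(@tangent_gram_pos _ _ _ X x) h.
by move: v0; rewrite leNgt /tangent_norm sqrtr_gt0 h.
Qed.

(** A triangle inequality up to the factor 2, from the parallelogram identity; the factor is
    absorbed by the constant of an exponential bound. *)
Lemma tangent_normB_le x (v w : 'rV[R]_n) :
  tangent_norm X x (v - w) <= 2 * (tangent_norm X x v + tangent_norm X x w).
Proof.
pose q w := bilin (tangent_gram X x) w w.
have q0 u : 0 <= q u.
  have [->|/(@tangent_gram_pos _ _ _ X x)/ltW//] := eqVneq u 0.
  by rewrite /q /bilin !mul0mx mxE.
have nE u : tangent_norm X x u ^+ 2 = q u by apply: sqr_sqrtr; exact: q0.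
have par : q (v - w) + q (v + w) = 2 * q v + 2 * q w.
  rewrite /q /bilin; set H := tangent_gram X x.
  have tB : (v - w)^T = v^T - w^T by apply/matrixP => k l; rewrite !mxE.
  have tD : (v + w)^T = v^T + w^T by apply/matrixP => k l; rewrite !mxE.
  have entryD (A B : 'M[R]_1) : (A + B) ord0 ord0 = A ord0 ord0 + B ord0 ord0 by rewrite mxE.
  have entryN (A : 'M[R]_1) : (- A) ord0 ord0 = - A ord0 ord0 by rewrite mxE.
  rewrite tB tD !(mulmxBl, mulmxDl) !(mulmxBr, mulmxDr) !(entryD, entryN).
  move: ((v *m H *m v^T) ord0 ord0) ((v *m H *m w^T) ord0 ord0)
    ((w *m H *m v^T) ord0 ord0) => a b d.
  ring.
have a0 := tangent_norm_ge0 x v; have b0 := tangent_norm_ge0 x w.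
rewrite -[leLHS]ger0_norm ?tangent_norm_ge0// -[leRHS]ger0_norm ?mulr_ge0 ?addr_ge0//.
rewrite -ler_sqr ?nnegrE// real_normK ?num_real// real_normK ?num_real// nE.
have := q0 (v + w); have := nE v; have := nE w.
move: a0 b0 par; set a := tangent_norm _ _ v; set b := tangent_norm _ _ w.
move=> a0 b0 par e1 e2 h; have := mulr_ge0 a0 b0; have := sqr_ge0 a; have := sqr_ge0 b; nra.
Qed.

Lemma le0_of_geometric (x K lambda : R) : 0 < lambda < 1 ->
  (forall s : nat, x <= K * lambda ^+ s) -> x <= 0.
Proof.
move=> /andP[l0 l1] h.
have c : (fun s : nat => K * lambda ^+ s) @ \oo --> K * 0.
  by apply: cvgM; [exact: cvg_cst|apply: cvg_expr; rewrite gtr0_norm].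
rewrite mulr0 in c.
have cl : closed [set r : R | x <= r] by exact: closed_ge.
exact: (@closed_cvg nat R \oo _ (fun s => K * lambda ^+ s) _ cl (nearW _ h) _ c).
Qed.

Hypothesis L_flow : forall t z, L z -> L (Phi t z).
Hypothesis splitting : forall z, L z -> (Em z + Ep z)%VS = fullv /\ (Em z :&: Ep z)%VS = 0%VS.
Hypothesis invariance : forall z (t : int), L z ->
  (linfun (transition_deriv S t z) @: Em z)%VS = Em (Phi t z) /\
  (linfun (transition_deriv S t z) @: Ep z)%VS = Ep (Phi t z).
Variables c lambda : R.
Hypothesis c_ge1 : 1 <= c.
Hypothesis lambda01 : 0 < lambda < 1.
Hypothesis contraction : forall z (t : nat), L z ->
  (forall v, v \in Em z ->
     tangent_norm X (transition S t%:Z z.2 z.1) (transition_deriv S t%:Z z v)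
     <= c * lambda ^+ t * tangent_norm X z.2 v) /\
  (forall v, v \in Ep z ->
     tangent_norm X (transition S (- t%:Z) z.2 z.1) (transition_deriv S (- t%:Z) z v)
     <= c * lambda ^+ t * tangent_norm X z.2 v).

Let c_ge0 : 0 <= c. Proof. exact: le_trans c_ge1. Qed.

Let lambda_exp (s : nat) : 0 <= lambda ^+ s <= 1.
Proof.
have /andP[l0 l1] := lambda01.
by rewrite exprn_ge0 ?(ltW l0)// exprn_ile1// ltW.
Qed.

Lemma backward_contraction z (s : nat) v : L z -> v \in Ep z ->
  tangent_norm X (backward S s z.2 z.1) (backward_deriv S s z v)
  <= c * lambda ^+ s * tangent_norm X z.2 v.
Proof.
move=> Lz vE; have := (contraction s Lz).2 v vE.
have e := transition_deriv_oppz S s z v.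
have e2 := transition_oppz S s z.2 z.1.
by move=> h; rewrite e2 in h; rewrite e in h; exact: h.
Qed.

(* The stable component of w is contracted forward, while its backward orbit
   stays bounded, so it vanishes. *)
Lemma mem_unstable z w (C : R) : L z -> 0 <= C ->
  (forall s : nat, tangent_norm X (backward S s z.2 z.1) (backward_deriv S s z w)
     <= C * lambda ^+ s) -> w \in Ep z.
Proof.
move=> Lz C0 hw; have : w \in (Em z + Ep z)%VS by rewrite (splitting Lz).1 memvf.
move=> /memv_addP[wm wmE [wp wpE wE]].
suff wm0 : wm = 0 by rewrite wE wm0 add0r.
apply: (@tangent_norm_eq0 z.2).
pose K := c * (2 * (C + c * tangent_norm X z.2 wp)).
apply: (@le0_of_geometric _ K lambda lambda01) => s.
have /andP[ls0 ls1] := lambda_exp s.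
set y := backward S s z.2 z.1; set D := backward_deriv S s z.
have DwmE : D wm \in Em (Phi (- s%:Z) z).
  rewrite -(invariance (- s%:Z) Lz).1.
  have -> : D wm = linfun (transition_deriv S (- s%:Z) z) wm.
    exact: etrans (esym (transition_deriv_oppz S s z wm)) (esym (lfunE _ _)).
  exact: memv_img.
have yE : (Phi (- s%:Z) z).2 = y by exact: transition_oppz.
have zE : transition S s%:Z (Phi (- s%:Z) z).2 (Phi (- s%:Z) z).1 = z.2.
  by rewrite yE; exact: backwardK.
have h1 : tangent_norm X z.2 wm <= c * lambda ^+ s * tangent_norm X y (D wm).
  have h := (contraction s (L_flow (- s%:Z) Lz)).1 _ DwmE.
  have e : transition_deriv S s%:Z (Phi (- s%:Z) z) (D wm) = wm := backward_derivK S s z wm.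
  rewrite zE yE in h.
  exact: (eq_ind _ (fun d => tangent_norm X z.2 d <= c * lambda ^+ s * tangent_norm X y (D wm))
    h _ e).
have h2 : tangent_norm X y (D wm) <= 2 * (C + c * tangent_norm X z.2 wp).
  have -> : D wm = D w - D wp by rewrite wE linearD addrK.
  apply: le_trans (tangent_normB_le _ _ _) _; rewrite ler_pM2l// lerD//.
    by apply: le_trans (hw s) _; rewrite ler_piMr.
  apply: le_trans (backward_contraction s Lz wpE) _.
  by rewrite ler_wpM2r ?tangent_norm_ge0// ler_piMr.
apply: le_trans h1 _; rewrite /K mulrAC.
by rewrite ler_wpM2r// ler_wpM2l.
Qed.

Lemma unstable_limit z (G : set_system (controls U * M))
    (v : controls U * M -> 'rV[R]_n) w :
  UltraFilter G -> G --> z -> L z ->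
  (\forall z' \near G, [/\ L z', v z' \in Ep z' & tangent_norm X z'.2 (v z') <= 1]) ->
  (fun z' => push (chart_at X z.2) z'.2 (v z')) @ G --> w -> w \in Ep z.
Proof.
move=> GU Gz Lz vG vw.
pose b s (z' : controls U * M) := backward S s z'.2 z'.1.
have bz s : b s @ G --> b s z by exact: (cvg_comp _ _ Gz (@backward_continuous _ _ _ _ _ S s z)).
pose V s z' := push (chart_at X (b s z)) (b s z') (backward_deriv S s z' (v z')).
have exW s : exists2 w', V s @ G --> w' & tangent_norm X (b s z) w' <= c * lambda ^+ s.
  apply: (tangent_bounded_cvg GU (bz s)); apply: filterS vG => z' [Lz' vE v1].
  apply: le_trans (backward_contraction s Lz' vE) _.
  by rewrite ler_piMr// mulr_ge0//; have /andP[] := lambda_exp s.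
pose W s := projT1 (cid2 (exW s)).
have WV s : V s @ G --> W s by rewrite /W; case: cid2.
have Wle s : tangent_norm X (b s z) (W s) <= c * lambda ^+ s by rewrite /W; case: cid2.
have W0 : W 0%N = w.
  have V0 : V 0%N = (fun z' => push (chart_at X z.2) z'.2 (v z')).
    apply/funext => z'.
    exact: (congr1 (push (chart_at X z.2) z'.2) (backward_deriv0 S z' (v z'))).
  have := WV 0%N; rewrite V0 => W0.
  exact: (cvg_unique _ W0 vw).
(* [regularity_class] provides joint continuity in control and state for the derivative of the
   forward step. The limits are therefore linked by forward steps, and the relation is inverted
   afterwards, at [z] alone. *)
have Wstep s : tangent_map X (rhs S ^~ (z.1 (- s.+1%:Z))) (b s.+1 z) (W s.+1) = W s.
  pose a (z' : controls U * M) := z'.1 (- s.+1%:Z).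
  pose i := chart_at X (b s z); pose i' := chart_at X (b s.+1 z).
  have bE z' : rhs S (b s.+1 z') (a z') = b s z' := rhs_backwardS S s z'.2 z'.1.
  have az : (fun z' => (a z', b s.+1 z')) @ G --> (a z, b s.+1 z).
    have ca : continuous a.
      exact: (continuous_compT (@continuous_fst _ _) (@eval_continuous int U (- s.+1%:Z))).
    by apply: cvg_pair; [exact: (cvg_comp _ _ Gz (ca z))|exact: bz].
  have i'z : chart_dom i' (b s.+1 z) := chart_atP X (b s.+1 z).
  have iz : chart_dom i (rhs S (b s.+1 z) (a z)) by rewrite bE; exact: chart_atP.
  have mz : (fun z' => step_mx S i' i (a z') (b s.+1 z')) @ G --> step_mx S i' i (a z) (b s.+1 z).
    exact: (cvg_comp _ _ az (step_mx_cvg i'z iz)).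
  have Vstep : [set z' | chart_dom i (b s z') /\ chart_dom i' (b s.+1 z')] `<=`
      [set z' | V s.+1 z' *m step_mx S i' i (a z') (b s.+1 z') = V s z'].
    move=> z' [iz' i'z'].
    have ia : chart_dom i (rhs S (b s.+1 z') (a z')) by rewrite bE.
    have e := push_tangent_map (backward_deriv S s.+1 z' (v z')) i'z' ia
      (chart_diff_rhs S (a z') (b s.+1 z')).
    have e1 := step_mxE S i' i (a z') (b s.+1 z') (V s.+1 z').
    have e2 := congr1 (fun y => push i y (tangent_map X (rhs S ^~ (a z')) (b s.+1 z')
      (backward_deriv S s.+1 z' (v z'))) : 'rV[R]_n) (bE z').
    have e3 := congr1 (push i (b s z')) (rhs_backward_deriv S s z' (v z')).
    exact: (etrans e1 (etrans (esym e) (etrans e2 e3))).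
  have n1 : \forall z' \near G, chart_dom i (b s z') := near_chart_at X (bz s).
  have n2 : \forall z' \near G, chart_dom i' (b s.+1 z') := near_chart_at X (bz s.+1).
  have FG : Filter G by exact: _.
  have n3 := @filterS _ G FG _ _ Vstep (@filterI _ G FG _ _ n1 n2).
  have Wm : V s @ G --> W s.+1 *m step_mx S i' i (a z) (b s.+1 z).
    exact: cvg_trans (@near_eq_cvg _ _ G FG _ _ n3) (cvg_mulmx FG (WV s.+1) mz).
  have e : W s = W s.+1 *m step_mx S i' i (a z) (b s.+1 z).
    exact: cvg_unique _ (WV s) Wm.
  have e1 := step_mxE S i' i (a z) (b s.+1 z) (W s.+1).
  have e2 := congr1 (fun y => chart_deriv i' (chart_at X y) (rhs S ^~ (a z)) (b s.+1 z)
    (W s.+1) : 'rV[R]_n) (bE z).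
  exact: etrans e2 (etrans (esym e1) (esym e)).
have DW s : backward_deriv S s z w = W s.
  elim: s => [|s ih]; first by rewrite W0; exact: backward_deriv0.
  apply: etrans (backward_derivS S s z w) _.
  apply: etrans (congr1 (tangent_map X (rhs_inv S (z.1 (- s.+1%:Z))) (backward S s z.2 z.1))
    (etrans ih (esym (Wstep s)))) _.
  have e := rhs_derivK S (z.1 (- s.+1%:Z)) (b s.+1 z) (W s.+1).
  exact: (eq_ind _ (fun y => tangent_map X (rhs_inv S (z.1 (- s.+1%:Z))) y
    (tangent_map X (rhs S ^~ (z.1 (- s.+1%:Z))) (b s.+1 z) (W s.+1)) = W s.+1)
    e _ (rhs_backwardS S s z.2 z.1)).
apply: (mem_unstable Lz c_ge0) => s.
exact: (eq_ind _ (fun d => tangent_norm X (b s z) d <= c * lambda ^+ s) (Wle s) _ (esym (DW s))).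
Qed.

End UnstableLimits.

(** If the preimage of some neighborhood is missing from [F], then [F] restricted to its complement
    is proper, and an ultrafilter refining that restriction violates the assumption. *)
Lemma cvg_ultra (T : Type) (V : topologicalType) (F : set_system T) (f : T -> V) (l : V) :
  Filter F -> (forall G, UltraFilter G -> F `<=` G -> f @ G --> l) -> f @ F --> l.
Proof.
move=> FF h W lW; apply: contrapT => nFW; pose D := ~` (f @^-1` W).
have PF : ProperFilter (within D F).
  apply: Build_ProperFilter_ex => A FA; apply: contrapT => nA; apply: nFW.
  have FDA : F [set x | D x -> A x] by [].
  suff : F (f @^-1` W) by [].
  apply: filterS FDA => x DA; apply: contrapT => nW.
  by apply: nA; exists x; exact: DA.
have [G [GU FG]] := ultraFilterLemma PF.
have GD : G D by apply: FG; exact: withinT.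
have FWG : F `<=` G by move=> A FA; apply: FG; exact: (@cvg_within _ F FF D A FA).
have GW : G (f @^-1` W) := h G GU FWG W lW.
have GDW : G (D `&` f @^-1` W) by exact: filterI.
by have [x [nx /nx]] := filter_ex GDW.
Qed.

(** * Continuity of the unstable Jacobian *)

Section JacobianContinuity.
Variables (R : realType) (n : nat) (M : topologicalType).
Variables (X : riemannian_manifold R n M) (U : pmetricType R).
Variables (S : control_system X U) (Q : set M).
Variables Em Ep : controls U * M -> {vspace 'rV[R]_n}.
Local Notation L := (all_time_lift S Q).
Local Notation Phi := (control_flow S).
Local Notation J := (unstable_jacobian S Ep).
Hypothesis L_flow : forall t z, L z -> L (Phi t z).
Hypothesis splitting : hyperbolic_splitting S Q Em Ep.

Lemma image_gramE y (A : {linear 'rV[R]_n -> 'rV[R]_n}) k (b : k.-tuple 'rV[R]_n) :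
  image_gram X y A b =
  \matrix_(r, s) tangent_inner X y (A (tnth b r)) (A (tnth b s)).
Proof.
apply/matrixP => r s; rewrite [RHS]mxE /image_gram.
have -> : tuple_mx b *m (lin1_mx A *m tangent_gram X y *m (lin1_mx A)^T) *m (tuple_mx b)^T =
    (tuple_mx b *m lin1_mx A) *m tangent_gram X y *m (tuple_mx b *m lin1_mx A)^T.
  by rewrite trmx_mul !mulmxA.
by rewrite gram_mxE !tuple_mxM.
Qed.

Let step_deriv (z : controls U * M) : {linear 'rV[R]_n -> 'rV[R]_n} :=
  tangent_map X (rhs S ^~ (z.1 0)) z.2.
Let step_end (z : controls U * M) : M := rhs S z.2 (z.1 0).

Let JE z : J z = abs_det X z.2 (step_end z) (step_deriv z) (Ep z) (Ep (Phi 1 z)).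
Proof. by []. Qed.

Let step_unstable z v : L z -> v \in Ep z -> step_deriv z v \in Ep (Phi 1 z).
Proof.
move=> Lz vE; have [_ inv _ _] := splitting; rewrite -(inv z 1 Lz).2.
have -> : step_deriv z v = linfun (transition_deriv S 1 z) v by exact: (esym (lfunE _ _)).
exact: memv_img.
Qed.

Let dim_unstable z : L z -> \dim (Ep z) = \dim (Ep (Phi 1 z)).
Proof.
move=> Lz; have [_ _ _ [dm [dp dims]]] := splitting.
by rewrite (dims z Lz).2 (dims _ (L_flow 1 Lz)).2.
Qed.

Lemma unstable_jacobian_gt0 z : L z -> 0 < J z.
Proof.
move=> Lz; rewrite JE; apply: abs_det_gt0.
- by move=> v; exact: step_unstable.
- exact: dim_unstable.
- by move=> v _; exact: (@transition_deriv1_inj _ _ _ _ _ S z v).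
Qed.

(** The formula holds for whichever orthonormal basis of the source space a limit produces and
    mentions no basis of the target space. *)
Lemma unstable_jacobianE z k (b : k.-tuple 'rV[R]_n) : L z -> orthonormal_basis X z.2 (Ep z) b ->
  J z = Num.sqrt (\det (\matrix_(r, s)
    tangent_inner X (step_end z) (step_deriv z (tnth b r)) (step_deriv z (tnth b s)))).
Proof.
move=> Lz ob; rewrite JE -image_gramE; apply: abs_detE ob.
- by move=> v; exact: step_unstable.
- exact: dim_unstable.
Qed.

Let step_end_continuous : continuous step_end.
Proof.
have h : continuous (fun z : controls U * M => (z.2, z.1 0)).
  apply: continuous_pair; first exact: continuous_snd.
  exact: (continuous_compT (@continuous_fst _ _) (@eval_continuous int U 0)).
exact: (continuous_compT h (@rhs_continuous _ _ _ _ _ S)).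
Qed.

Let step_deriv_cvg z (G : set_system (controls U * M)) (v : controls U * M -> 'rV[R]_n) w :
  Filter G -> G --> z ->
  (fun z' => push (chart_at X z.2) z'.2 (v z')) @ G --> w ->
  (fun z' => push (chart_at X (step_end z)) (step_end z') (step_deriv z' (v z'))) @ G
    --> step_deriv z w.
Proof.
move=> FG Gz vw; pose i := chart_at X z.2; pose i1 := chart_at X (step_end z).
pose a (z' : controls U * M) : U := z'.1 0.
have az : (fun z' => (a z', z'.2)) @ G --> (a z, z.2).
  have ca : continuous a.
    exact: (continuous_compT (@continuous_fst _ _) (@eval_continuous int U 0)).
  apply: cvg_pair; first exact: (cvg_comp _ _ Gz (ca z)).
  exact: (cvg_comp _ _ Gz (@continuous_snd _ _ z)).
have x2z : (fun z' : controls U * M => z'.2) @ G --> z.2.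
  exact: (cvg_comp _ _ Gz (@continuous_snd _ _ z)).
have x1z : step_end @ G --> step_end z by exact: (cvg_comp _ _ Gz (step_end_continuous (x := z))).
have mz : (fun z' => step_mx S i i1 (a z') z'.2) @ G --> step_mx S i i1 (a z) z.2.
  exact: (cvg_comp _ _ az (step_mx_cvg (chart_atP X z.2) (chart_atP X (step_end z)))).
have sub : [set z' : controls U * M | chart_dom i z'.2 /\ chart_dom i1 (step_end z')] `<=`
    [set z' | push i z'.2 (v z') *m step_mx S i i1 (a z') z'.2 =
              push i1 (step_end z') (step_deriv z' (v z'))].
  move=> z' [iz i1z].
  have e1 := step_mxE S i i1 (a z') z'.2 (push i z'.2 (v z')).
  have e2 := push_tangent_map (v z') iz i1z (chart_diff_rhs S (a z') z'.2).
  have e3 : push i1 (step_end z') (step_deriv z' (v z')) =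
      chart_deriv i i1 (rhs S ^~ (a z')) z'.2 (push i z'.2 (v z')).
    exact: e2.
  refine (etrans e1 _).
  refine (esym _).
  exact: e3.
have n1 : \forall z' \near G, chart_dom i z'.2 := near_chart_at X x2z.
have n2 : \forall z' \near G, chart_dom i1 (step_end z') := near_chart_at X x1z.
have nn := @filterS _ G FG _ _ sub (@filterI _ G FG _ _ n1 n2).
have Wm : (fun z' => push i1 (step_end z') (step_deriv z' (v z'))) @ G -->
    w *m step_mx S i i1 (a z) z.2.
  exact: cvg_trans (@near_eq_cvg _ _ G FG _ _ nn) (cvg_mulmx FG vw mz).
have e := step_mxE S i i1 (a z) z.2 w.
by rewrite e in Wm; exact: Wm.
Qed.

Lemma unstable_jacobian_continuous z : L z -> J @ within L (nbhs z) --> J z.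
Proof.
move=> Lz; have [spl inv [c [lambda [c1 l01 contr]]] [dm [dp dims]]] := splitting.
apply: cvg_ultra => G GU LG.
have FG : Filter G by exact: _.
have Gz : G --> z by move=> A zA; apply: LG; exact: (@cvg_within _ (nbhs z) _ L A zA).
have GL : G L by apply: LG; exact: withinT.
(* The bases are chosen pointwise, with no continuity. Their common length [dp] is the dimension of
   the limit space, which makes the orthonormal limit family a basis of it. *)
have exb z' : exists b : dp.-tuple 'rV[R]_n, L z' -> orthonormal_basis X z'.2 (Ep z') b.
  have [Lz'|nLz'] := pselect (L z'); last by exists [tuple 0 | _ < dp].
  have := exists_orthonormal_basis (tangent_gram_sym X z'.2)
    (@tangent_gram_pos _ _ _ X z'.2) (Ep z').
  by rewrite (dims z' Lz').2 => -[b ob]; exists b.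
pose b z' := projT1 (cid (exb z')).
have bP z' : L z' -> orthonormal_basis X z'.2 (Ep z') (b z') by rewrite /b; case: cid.
pose v r z' := tnth (b z') r.
have x2z : (fun z' : controls U * M => z'.2) @ G --> z.2.
  exact: (cvg_comp _ _ Gz (@continuous_snd _ _ z)).
have v_norm r : [set z' | L z'] `<=` [set z' | tangent_norm X z'.2 (v r z') <= 1].
  by move=> z' Lz'; rewrite /= /tangent_norm (bP z' Lz').2 eqxx sqrtr1.
have vlim r : exists w : 'rV[R]_n, (fun z' => push (chart_at X z.2) z'.2 (v r z')) @ G --> w.
  have h : \forall z' \near G, tangent_norm X z'.2 (v r z') <= 1 by exact: (filterS (v_norm r) GL).
  by have [w vw _] := tangent_bounded_cvg GU x2z h; exists w.
pose w r := projT1 (cid (vlim r)).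
have vw r : (fun z' => push (chart_at X z.2) z'.2 (v r z')) @ G --> w r.
  by rewrite /w; case: cid.
have wE r : w r \in Ep z.
  apply: (unstable_limit L_flow spl inv c1 l01 contr GU Gz Lz _ (vw r)).
  have sub : L `<=` [set z' | [/\ L z', v r z' \in Ep z' & tangent_norm X z'.2 (v r z') <= 1]].
    move=> z' Lz'; split => //; last exact: v_norm.
    by rewrite (basis_mem (bP z' Lz').1)// mem_tnth.
  exact: (filterS sub GL).
pose bw := [tuple w r | r < dp].
have ww r s : tangent_inner X z.2 (w r) (w s) = (r == s)%:R.
  have c2 := tangent_inner_cvg GU x2z (vw r) (vw s).
  have sub : L `<=` [set z' | (r == s)%:R = tangent_inner X z'.2 (v r z') (v s z')].
    by move=> z' Lz'; rewrite /= (bP z' Lz').2.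
  have c0 : (fun=> (r == s)%:R : R) @ G --> ((r == s)%:R : R) by exact: cvg_cst.
  have nE := @filterS _ G FG _ _ sub GL.
  have c3 : (fun z' => tangent_inner X z'.2 (v r z') (v s z')) @ G --> ((r == s)%:R : R).
    exact: cvg_trans (@near_eq_cvg _ _ G FG _ _ nE) c0.
  exact: (cvg_unique _ c2 c3).
have obw : orthonormal_basis X z.2 (Ep z) bw.
  have bwbw : forall r s, tangent_inner X z.2 (tnth bw r) (tnth bw s) = (r == s)%:R.
    by move=> r s; rewrite !tnth_mktuple.
  split => //; apply: (orthonormal_basis_of (G := tangent_gram X z.2)).
  - exact/orthonormal_mxP.
  - by move=> r; rewrite tnth_mktuple.
  - by rewrite (dims z Lz).2.
have sub : L `<=` [set z' | Num.sqrt (\det (\matrix_(r, s)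
    tangent_inner X (step_end z') (step_deriv z' (v r z')) (step_deriv z' (v s z')))) = J z'].
  by move=> z' Lz'; rewrite /= (unstable_jacobianE Lz' (bP z' Lz')).
apply: cvg_trans (@near_eq_cvg _ _ G FG _ _ (filterS sub GL)) _.
rewrite (unstable_jacobianE Lz obw).
apply: (@cvg_comp _ _ _ (fun z' => \det (\matrix_(r < dp, s < dp)
    tangent_inner X (step_end z') (step_deriv z' (v r z')) (step_deriv z' (v s z'))))
    (@Num.sqrt R)); last exact: sqrt_continuous.
apply: cvg_det; apply: cvg_entries => r s; rewrite mxE !tnth_mktuple.
under eq_cvg do rewrite mxE.
have x1z : step_end @ G --> step_end z by exact: (cvg_comp _ _ Gz (step_end_continuous (x := z))).
exact: (tangent_inner_cvg GU x1z (step_deriv_cvg FG Gz (vw r)) (step_deriv_cvg FG Gz (vw s))).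
Qed.

Lemma log2_jacobian_continuous z : L z ->
  (fun z => - log2 (J z)) @ within L (nbhs z) --> - log2 (J z).
Proof.
move=> Lz; apply: cvgN; rewrite /log2; apply: cvgM; last exact: cvg_cst.
apply: (cvg_comp _ _ (unstable_jacobian_continuous Lz)).
by apply: continuous_ln; exact: unstable_jacobian_gt0.
Qed.

End JacobianContinuity.

Theorem proposition4p11 (R : realType) (n : nat) (M : topologicalType)
    (X : riemannian_manifold R n M) (U : pmetricType R)
    (S : control_system X U) (Q : set M)
    (Em Ep : controls U * M -> {vspace 'rV[R]_n}) :
  connected [set: M] ->
  compact [set: U] -> connected [set: U] ->
  system_class 2 S ->
  compact Q -> all_time_controlled_invariant S Q ->
  uniformly_hyperbolic S Q Em Ep ->
  isolated_invariant (control_flow S) (all_time_lift S Q) ->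
  fiber_lower_semicontinuous S Q ->
  ereal_sup [set top_pressure S Q (fun z => - log2 (unstable_jacobian S Ep z)) P
            | P in @shift_invariant_measures R U] =
  ereal_sup (range
    (fiber_pressure S Q (fun z => - log2 (unstable_jacobian S Ep z)))).
Proof.
move=> connM cU connU _ cQ ciQ [Q0 _ _ splitting] [L_closed L_inv _] lscQ.
have L_flow t z : all_time_lift S Q z -> all_time_lift S Q (control_flow S t z).
  by move=> Lz; rewrite -(L_inv t); exists z.
apply: variational_pressure => //.
- by move=> t z; exact: L_flow.
- exact: fiber_nonempty.
- exact: rdist_small.
- exact: rdist_separates.
- by move=> z Lz; exact: log2_jacobian_continuous L_flow splitting _ Lz.
Qed.
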